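(* Let $T=[T_1,\ldots,T_n]$, $T_i\in B(\mathcal H)$, be a completely non-coisometric row contraction and let $\Theta:F^2(H_n)\otimes\mathcal E\to F^2(H_n)\otimes\mathcal E_*$ be a contractive multi-analytic operator which coincides with the characteristic function $\Theta_T$ of $T$. If $\mathcal H_1\subset\mathcal H$ is a joint invariant subspace under the operators $T_1,\ldots,T_n$, then there exists a regular factorization $\Theta=\Theta_2\Theta_1$, where $\Theta_1:F^2(H_n)\otimes\mathcal E\to F^2(H_n)\otimes\mathcal F$ and $\Theta_2:F^2(H_n)\otimes\mathcal F\to F^2(H_n)\otimes\mathcal E_*$ are contractive multi-analytic operators ($\mathcal F$ a Hilbert space), such that $T$ is unitarily equivalent to the row contraction $\mathbb T=[\mathbb T_1,\ldots,\mathbb T_n]$ defined on the Hilbert space $$\mathbb H:=\big[(F^2(H_n)\otimes\mathcal E_* )\oplus\overline{\Delta_2(F^2(H_n)\otimes\mathcal F)}\oplus\overline{\Delta_1(F^2(H_n)\otimes\mathcal E)}\big]\ominus\{\Theta_2\Theta_1f\oplus\Delta_2\Theta_1f\oplus\Delta_1f:\ f\in F^2(H_n)\otimes\mathcal E\}$$ by $$\mathbb T_i^*(f\oplus\varphi\oplus\psi):=(S_i^*\otimes I_{\mathcal E_*})f\oplus F_i^*\varphi\oplus E_i^*\psi,\qquad f\oplus\varphi\oplus\psi\in\mathbb H,\ i=1,\ldots,n.$$ Moreover, the subspaces of $\mathbb H$ corresponding (under this unitary equivalence) to $\mathcal H_1$ and $\mathcal H_2:=\mathcal H\ominus\mathcal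 H_1$ are $$\mathbb H_1:=\{\Theta_2f\oplus\Delta_2f\oplus g:\ f\in F^2(H_n)\otimes\mathcal F,\ g\in\overline{\Delta_1(F^2(H_n)\otimes\mathcal E)}\}\ominus\{\Theta_2\Theta_1f\oplus\Delta_2\Theta_1f\oplus\Delta_1f:\ f\in F^2(H_n)\otimes\mathcal E\}$$ and $$\mathbb H_2:=\big[(F^2(H_n)\otimes\mathcal E_* )\oplus\overline{\Delta_2(F^2(H_n)\otimes\mathcal F)}\oplus\{0\}\big]\ominus\{\Theta_2f\oplus\Delta_2f\oplus0:\ f\in F^2(H_n)\otimes\mathcal F\},$$ respectively. Conversely, for every regular factorization $\Theta=\Theta_2\Theta_1$, with $\Theta_1:F^2(H_n)\otimes\mathcal E\to F^2(H_n)\otimes\mathcal F$ and $\Theta_2:F^2(H_n)\otimes\mathcal F\to F^2(H_n)\otimes\mathcal E_*$ contractive multi-analytic operators, let $\mathbb T=[\mathbb T_1,\ldots,\mathbb T_n]$ be the row contraction defined on $$\mathbb H:=\big[(F^2(H_n)\otimes\mathcal E_* )\oplus\overline{\Delta_2(F^2(H_n)\otimes\mathcal F)}\oplus\overline{\Delta_1(F^2(H_n)\otimes\mathcal E)}\big]\ominus\{\Theta_2\Theta_1f\oplus\Delta_2\Theta_1f\oplus\Delta_1f:\ f\in F^2(H_n)\otimes\mathcal E\}$$ by $\mathbb T_i^*(f\oplus\varphi\oplus\psi):=(S_i^*\otimes I_{\mathcal E_*})f\oplus F_i^*\varphi\oplus E_i^*\psi$, $i=1,\ldots,n$. Then the subspaces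 $$\mathbb H_1:=\{\Theta_2f\oplus\Delta_2f\oplus g:\ f\in F^2(H_n)\otimes\mathcal F,\ g\in\overline{\Delta_1(F^2(H_n)\otimes\mathcal E)}\}\ominus\{\Theta_2\Theta_1f\oplus\Delta_2\Theta_1f\oplus\Delta_1f:\ f\in F^2(H_n)\otimes\mathcal E\}$$ and $$\mathbb H_2:=\big[(F^2(H_n)\otimes\mathcal E_* )\oplus\overline{\Delta_2(F^2(H_n)\otimes\mathcal F)}\oplus\{0\}\big]\ominus\{\Theta_2f\oplus\Delta_2f\oplus0:\ f\in F^2(H_n)\otimes\mathcal F\}$$ have the following properties: (i) $\mathbb H_1$ is invariant under each operator $\mathbb T_i$, $i=1,\ldots,n$; (ii) $\mathbb H_2=\mathbb H\ominus\mathbb H_1$. Under the identification of $\mathcal H$ with $\mathbb H$ given by the unitary equivalence of $T$ and $\mathbb T$, $\mathbb H_1$ corresponds to a subspace $\mathcal H_1\subset\mathcal H$ which is invariant under each operator $T_i$, $i=1,\ldots,n$.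
   Context: Conventions: $n\in\{1,2,\ldots\}$ or $n=\infty$; Hilbert spaces are complex, operators are bounded, subspaces are closed, and infinite operator sums converge strongly. $H_n$ is an $n$-dimensional Hilbert space with orthonormal basis $e_1,e_2,\ldots$; $F^2(H_n)=\bigoplus_{k\ge0}H_n^{\otimes k}$ is the full Fock space ($H_n^{\otimes0}=\mathbb C1$), and $S_i\varphi=e_i\otimes\varphi$ are the left creation operators. $\mathbb F_n^+$ is the free semigroup with generators $g_1,\ldots,g_n$ and identity $g_0$; for $\alpha=g_{i_1}\cdots g_{i_k}$, $|\alpha|=k$, $e_\alpha=e_{i_1}\otimes\cdots\otimes e_{i_k}$, $T_\alpha=T_{i_1}\cdots T_{i_k}$; $|g_0|=0$, $e_{g_0}=1$, $T_{g_0}=I$. A bounded operator $A:F^2(H_n)\otimes\mathcal K\to F^2(H_n)\otimes\mathcal K'$ is multi-analytic if $A(S_i\otimes I_{\mathcal K})=(S_i\otimes I_{\mathcal K'})A$ for all $i$; it is determined by its symbol $k\mapsto A(1\otimes k)$, $k\in\mathcal K$. Two multi-analytic operators $A:F^2(H_n)\otimes\mathcal E\to F^2(H_n)\otimes\mathcal E_*$ and $A':F^2(H_n)\otimes\mathcal E'\to F^2(H_n)\otimes\mathcal E_*'$ coincide if there are unitaries $W:\mathcal E\to\mathcal E'$, $W_*:\mathcal E_*\to\mathcal E_*'$ with $(I\otimes W_* )A=A'(I\otimes W)$. Row contractions: $T=[T_1,\ldots,T_n]$, $T_i\in B(\mathcal H)$, is a row contraction if $\sum_iT_iT_i^*\le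 I$; $T$ is also regarded as the row operator from $\mathcal H^{(n)}=\bigoplus_{i=1}^n\mathcal H$ to $\mathcal H$. It is completely non-coisometric (c.n.c.) if the only $h\in\mathcal H$ with $\sum_{|\alpha|=k}\|T_\alpha^*h\|^2=\|h\|^2$ for all $k=1,2,\ldots$ is $h=0$. Put $\Delta_{T^*}=(I-\sum_iT_iT_i^* )^{1/2}$, $\Delta_T=(I-T^*T)^{1/2}\in B(\mathcal H^{(n)})$, $\mathcal D_*=\overline{\Delta_{T^*}\mathcal H}$, $\mathcal D=\overline{\Delta_T\mathcal H^{(n)}}$. The characteristic function of $T$ is the contractive multi-analytic operator $\Theta_T:F^2(H_n)\otimes\mathcal D\to F^2(H_n)\otimes\mathcal D_*$ with symbol $$\theta_T(h)=-1\otimes\sum_iT_iP_ih+\sum_i(S_i\otimes I_{\mathcal D_*})\Big(\sum_{\alpha\in\mathbb F_n^+}e_\alpha\otimes\Delta_{T^*}T_\alpha^*P_i\Delta_Th\Big),\quad h\in\mathcal D,$$ where $P_i$ is the projection of $\mathcal H^{(n)}$ onto its $i$-th component. Regular factorization: for a contractive multi-analytic $\Theta$, $\Delta_\Theta=(I-\Theta^*\Theta)^{1/2}$. If $\Theta=\Theta_2\Theta_1$ with $\Theta_1:F^2(H_n)\otimes\mathcal E\to F^2(H_n)\otimes\mathcal F$, $\Theta_2:F^2(H_n)\otimes\mathcal F\to F^2(H_n)\otimes\mathcal E_*$ contractive multi-analytic, put $\Delta_j=(I-\Theta_j^*\Theta_j)^{1/2}$. The formula $X_\Theta(\Delta_\Theta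 f)=\Delta_2\Theta_1f\oplus\Delta_1f$ defines an isometry $X_\Theta:\overline{\Delta_\Theta(F^2(H_n)\otimes\mathcal E)}\to\overline{\Delta_2(F^2(H_n)\otimes\mathcal F)}\oplus\overline{\Delta_1(F^2(H_n)\otimes\mathcal E)}$; the factorization is regular if $X_\Theta$ is unitary. The isometries $E_i$ on $\overline{\Delta_1(F^2(H_n)\otimes\mathcal E)}$ and $F_i$ on $\overline{\Delta_2(F^2(H_n)\otimes\mathcal F)}$ are defined by $E_i\Delta_1f=\Delta_1(S_i\otimes I_{\mathcal E})f$ and $F_i\Delta_2g=\Delta_2(S_i\otimes I_{\mathcal F})g$. *)

(* Defs.v *)
From HB Require Import structures.
From mathcomp Require Import all_boot all_order all_algebra finmap complex.
From mathcomp Require Import all_classical all_reals.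
From mathcomp Require Import topology normedtype ring.
From mathcomp.analysis Require Import showcase.summability.

Set Implicit Arguments.
Unset Strict Implicit.
Unset Printing Implicit Defensive.

Import Order.TTheory GRing.Theory Num.Theory.
Import numFieldNormedType.Exports.

Local Open Scope classical_set_scope.
Local Open Scope ring_scope.

HB.mixin Record NormedModule_isPreHilbert (C : numClosedFieldType) H
    & NormedModule C H := {
  dot : H -> H -> C ;
  dotP : forall (a : C) (x y z : H),
    dot (a *: x + y) z = a * dot x z + dot y z ;
  dotC : forall x y : H, dot y x = (dot x y)^* ;
  dot_norm : forall x : H, dot x x = `|x| ^+ 2
}.

#[short(type="preHilbertType")]
HB.structure Definition PreHilbert (C : numClosedFieldType) :=
  {H of NormedModule C H & NormedModule_isPreHilbert C H}.

#[short(type="hilbertType")]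
HB.structure Definition Hilbert (C : numClosedFieldType) :=
  {H of PreHilbert C H & Complete H}.

HB.factory Record Lmodule_isPreHilbert (C : numClosedFieldType) H
    & GRing.Lmodule C H := {
  dot : H -> H -> C ;
  dotP : forall (a : C) (x y z : H),
    dot (a *: x + y) z = a * dot x z + dot y z ;
  dotC : forall x y : H, dot y x = (dot x y)^* ;
  dot_ge0 : forall x : H, 0 <= dot x x ;
  dot_eq0 : forall x : H, dot x x = 0 -> x = 0
}.

HB.builders Context C H & Lmodule_isPreHilbert C H.

Let dotDl x y z : dot (x + y) z = dot x z + dot y z.
Proof. by rewrite -[x]scale1r dotP mul1r scale1r. Qed.
Let dotZl a x z : dot (a *: x) z = a * dot x z.
Proof.
have d0 : dot 0 z = 0.
  by apply: (@addrI _ (dot 0 z)); rewrite -dotDl !addr0.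
by rewrite -[a *: x]addr0 dotP d0 addr0.
Qed.
Let dotDr x y z : dot z (x + y) = dot z x + dot z y.
Proof. by rewrite dotC dotDl rmorphD /= -!dotC. Qed.
Let dotZr a x z : dot z (a *: x) = a^* * dot z x.
Proof. by rewrite dotC dotZl rmorphM /= -dotC. Qed.

Let normh x : C := sqrtC (dot x x).

Let normh_ge0 x : 0 <= normh x. Proof. by rewrite sqrtC_ge0 dot_ge0. Qed.
Let normhK x : normh x ^+ 2 = dot x x. Proof. by rewrite sqrtCK. Qed.

Let cauchy_schwarz x y : `|dot x y| <= normh x * normh y.
Proof.
have [y0|ny0] := eqVneq (dot y y) 0.
  have -> : y = 0 by exact: dot_eq0.
  by rewrite -(scale0r 0) dotZr rmorph0 mul0r normr0 mulr_ge0.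
have yp : 0 < dot y y by rewrite lt_def ny0 dot_ge0.
rewrite -(@ler_pXn2r _ 2) ?nnegrE ?mulr_ge0// exprMn !normhK.
have yr : (dot y y)^* = dot y y by rewrite -dotC.
have := dot_ge0 (dot y y *: x + (- dot x y) *: y).
rewrite dotDl !dotDr !dotZl !dotZr yr rmorphN /= -dotC.
rewrite normCK -dotC.
have -> : dot y y * (dot y y * dot x x) + dot y y * (- dot y x * dot x y) +
   (- dot x y * (dot y y * dot y x) + - dot x y * (- dot y x * dot y y)) =
   dot y y * (dot x x * dot y y - dot x y * dot y x).
  by ring.
by rewrite pmulr_rge0// subr_ge0.
Qed.

Let ler_normhD x y : normh (x + y) <= normh x + normh y.
Proof.
rewrite -(@ler_pXn2r _ 2) ?nnegrE ?addr_ge0// sqrrD !normhK.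
have -> : dot (x + y) (x + y) = dot x x + 'Re (dot x y) *+ 2 + dot y y.
  rewrite dotDl !dotDr -!addrA; congr (_ + _); rewrite !addrA; congr (_ + _).
  by rewrite ReE -(dotC x y) -splitr.
rewrite lerD2r lerD2l ler_pMn2r// (le_trans _ (cauchy_schwarz x y))//.
exact: (leif_Re_Creal (dot x y)).
Qed.

Let normhZ a x : normh (a *: x) = `|a| * normh x.
Proof.
rewrite /normh dotZl dotZr mulrA -normCK sqrtCM ?nnegrE ?exprn_ge0 ?dot_ge0//.
by rewrite sqrCK.
Qed.

Let normh_eq0 x : normh x = 0 -> x = 0.
Proof. by move=> /eqP; rewrite sqrtC_eq0 => /eqP /dot_eq0. Qed.

HB.instance Definition _ :=
  Lmodule_isNormed.Build C H ler_normhD normhZ normh_eq0.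

HB.instance Definition _ :=
  NormedModule_isPreHilbert.Build C H dotP dotC (fun x => esym (normhK x)).

HB.end.

Section PreHilbertTheory.
Variables (C : numClosedFieldType) (H : preHilbertType C).
Implicit Types (a : C) (x y z : H).

Lemma dotDl x y z : dot (x + y) z = dot x z + dot y z.
Proof. by rewrite -[x]scale1r dotP mul1r scale1r. Qed.

Lemma dot0l z : dot 0 z = 0.
Proof. by apply: (@addrI _ (dot 0 z)); rewrite -dotDl !addr0. Qed.

Lemma dotZl a x z : dot (a *: x) z = a * dot x z.
Proof. by rewrite -[a *: x]addr0 dotP dot0l addr0. Qed.

Lemma dotBl x y z : dot (x - y) z = dot x z - dot y z.
Proof. by rewrite dotDl -(scaleN1r y) dotZl mulN1r. Qed.

Lemma dotDr x y z : dot z (x + y) = dot z x + dot z y.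
Proof. by rewrite dotC dotDl rmorphD /= -!dotC. Qed.

Lemma dot0r z : dot z 0 = 0.
Proof. by rewrite dotC dot0l rmorph0. Qed.

Lemma dotZr a x z : dot z (a *: x) = a^* * dot z x.
Proof. by rewrite dotC dotZl rmorphM /= -dotC. Qed.

Lemma dot_ge0 x : 0 <= dot x x.
Proof. by rewrite dot_norm exprn_ge0. Qed.

Lemma dot_eq0 x : dot x x = 0 -> x = 0.
Proof. by rewrite dot_norm => /eqP; rewrite expf_eq0 /= normr_eq0 => /eqP. Qed.

Lemma cauchy_schwarz x y : `|dot x y| <= `|x| * `|y|.
Proof.
have [/dot_eq0->|ny0] := eqVneq (dot y y) 0.
  by rewrite dot0r !normr0 mulr0.
have yp : 0 < dot y y by rewrite lt_def ny0 dot_ge0.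
rewrite -(@ler_pXn2r _ 2) ?nnegrE ?mulr_ge0// exprMn -!dot_norm.
have yr : (dot y y)^* = dot y y by rewrite -dotC.
have := dot_ge0 (dot y y *: x + (- dot x y) *: y).
rewrite dotDl !dotDr !dotZl !dotZr yr rmorphN /= -dotC.
rewrite normCK -dotC.
have -> : dot y y * (dot y y * dot x x) + dot y y * (- dot y x * dot x y) +
   (- dot x y * (dot y y * dot y x) + - dot x y * (- dot y x * dot y y)) =
   dot y y * (dot x x * dot y y - dot x y * dot y x).
  by ring.
by rewrite pmulr_rge0// subr_ge0.
Qed.

End PreHilbertTheory.

HB.instance Definition _ (R : realType) := GRing.ComAlgebra.copy R[i] R[i]^o.
HB.instance Definition _ (R : realType) := NormedModule.copy R[i] R[i]^o.

Section ComplexComplete.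
Variable R : realType.
Implicit Type z : R[i].

Lemma normc_ge_Im z : `|complex.Im z|%:C%C <= `|z|.
Proof.
have := normc_ge_Re (z * 'i%C); rewrite ReiNIm normrN => /le_trans; apply.
by rewrite normrM [Num.norm 'i%C]normc_def /= expr0n add0r expr1n sqrtr1 mulr1.
Qed.

Lemma normc_le_ReIm z :
  `|z| <= (`|complex.Re z| + `|complex.Im z|)%:C%C.
Proof.
rewrite {1}[z]complexE (le_trans (ler_normD _ _))// rmorphD lerD//.
  by rewrite normc_def/= expr0n addr0 sqrtr_sqr.
by rewrite normrM [Num.norm 'i%C]normc_def /= expr0n add0r expr1n sqrtr1 mul1r
  normc_def/= expr0n addr0 sqrtr_sqr.
Qed.

Lemma complex_complete (F : set_system R[i]) :
  ProperFilter F -> cauchy F -> cvg F.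
Proof.
move=> FF /cauchyP Fc.
have cR (f : R[i] -> R) : (forall x y, (`|f x - f y|)%:C%C <= `|x - y|) ->
    cvg (f @ F).
  move=> fL; apply/cauchy_cvgP/cauchy_exP => e e0.
  have e0' : 0 < e%:C%C by rewrite ltcR.
  have [x Fx] := Fc _ e0'; exists (f x) => /=.
  apply: filterS Fx => y; rewrite -!ball_normE/= => xy.
  by rewrite -ltcR (le_lt_trans (fL _ _)).
have /cvg_ex[/= a Fa] : cvg ((@complex.Re R) @ F).
  by apply: cR => x y; rewrite -raddfB /= normc_ge_Re.
have /cvg_ex[/= b Fb] : cvg ((@complex.Im R) @ F).
  by apply: cR => x y; rewrite -raddfB /= normc_ge_Im.
apply/cvg_ex; exists (a +i* b)%C; apply/cvgrPdist_lt => /= e e0.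
have [d d0 ->] : exists2 d : R, 0 < d & e = d%:C%C.
  move: e0; rewrite ltcE /= => /andP[/eqP ei er].
  by exists (complex.Re e) => //; rewrite [LHS]complexE ei mulr0 addr0.
have d20 : 0 < d / 2 by rewrite divr_gt0.
move/cvgrPdist_lt : Fa => /(_ _ d20) Fa.
move/cvgrPdist_lt : Fb => /(_ _ d20) Fb.
apply: filterS2 Fa Fb => x xa xb.
rewrite (le_lt_trans (normc_le_ReIm _))// ltcR !raddfB /= [d]splitr.
by rewrite ltrD.
Qed.

HB.instance Definition _ := Uniform_isComplete.Build R[i] complex_complete.

End ComplexComplete.

Record csub (C : numClosedFieldType) (H : preHilbertType C) := CSub {
  csub_set : set H ;
  csub0 : csub_set 0 ;
  csubP : forall (a : C) (x y : H),
    csub_set x -> csub_set y -> csub_set (a *: x + y) ;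
  csub_closed : closed csub_set }.

Section Subspace.
Variables (C : numClosedFieldType) (H : preHilbertType C) (M : csub H).

Definition csub_pred : {pred H} := fun x => x \in csub_set M.

Lemma csub_pred_submod : submod_closed csub_pred.
Proof.
split=> [|a x y]; first by apply/mem_set; exact: csub0.
by move=> /set_mem Mx /set_mem My; apply/mem_set; exact: csubP.
Qed.

HB.instance Definition _ :=
  GRing.isSubmodClosed.Build C H csub_pred csub_pred_submod.

Record subspace := Subspace {
  subspace_val :> H ;
  _ : subspace_val \in csub_pred }.

HB.instance Definition _ := [isSub for subspace_val].
HB.instance Definition _ := [Choice of subspace by <:].
HB.instance Definition _ := [SubChoice_isSubLmodule of subspace by <:].

Definition subspace_dot (x y : subspace) : C := dot (val x) (val y).

Fact subspace_dotP (a : C) (x y z : subspace) :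
  subspace_dot (a *: x + y) z = a * subspace_dot x z + subspace_dot y z.
Proof. by rewrite /subspace_dot linearP dotP. Qed.

Fact subspace_dotC (x y : subspace) :
  subspace_dot y x = (subspace_dot x y)^*.
Proof. exact: dotC. Qed.

Fact subspace_dot_ge0 (x : subspace) : 0 <= subspace_dot x x.
Proof. exact: dot_ge0. Qed.

Fact subspace_dot_eq0 (x : subspace) : subspace_dot x x = 0 -> x = 0.
Proof. by move=> /dot_eq0 x0; apply: val_inj; rewrite x0 raddf0. Qed.

HB.instance Definition _ := Lmodule_isPreHilbert.Build C subspace
  subspace_dotP subspace_dotC subspace_dot_ge0 subspace_dot_eq0.

Lemma subspace_norm (x : subspace) : `|x| = `|val x|.
Proof.
apply/eqP; rewrite -(@eqrXn2 _ 2)//; apply/eqP.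
by rewrite -!dot_norm.
Qed.

Lemma subspaceP (x : subspace) : csub_set M (val x).
Proof. by apply/set_mem; exact: (valP x). Qed.

End Subspace.

Section SubspaceComplete.
Variables (C : numClosedFieldType) (H : hilbertType C) (M : csub H).

Fact subspace_complete (F : set_system (subspace M)) :
  ProperFilter F -> cauchy F -> cvg F.
Proof.
move=> FF /cauchyP Fc.
have /cvg_ex[/= l Fl] : cvg ((val : subspace M -> H) @ F).
  apply/cauchy_cvgP/cauchy_exP => e e0; have [x Fx] := Fc e e0.
  exists (val x); apply: (@filterS _ F _ (ball x e)) => // y.
  rewrite /preimage /= -(ball_normE (V := H)) -(ball_normE (V := subspace M)).
  by rewrite /= subspace_norm raddfB.
have Ml : csub_set M l.
  apply: (closed_cvg _ (@csub_closed _ _ M)) Fl => //.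
  by apply: nearW => x; exact: subspaceP.
have Ml' : l \in csub_pred M by exact/mem_set.
apply/cvg_ex; exists (Subspace Ml'); apply/cvgrPdist_lt => /= e e0.
move/cvgrPdist_lt : Fl => /(_ e e0); apply: filterS => x.
by rewrite subspace_norm raddfB.
Qed.

HB.instance Definition _ :=
  Uniform_isComplete.Build (subspace M) subspace_complete.

End SubspaceComplete.

Coercion csub_type (C : numClosedFieldType) (H : hilbertType C) (M : csub H) :
  hilbertType C := (subspace M : hilbertType C).

Definition hprod (C : numClosedFieldType) (H K : preHilbertType C) : Type :=
  (H * K)%type.

Section HProd.
Variables (C : numClosedFieldType) (H K : preHilbertType C).

HB.instance Definition _ := GRing.Lmodule.copy (hprod H K) (H * K)%type.

Definition hpair (x : H) (y : K) : hprod H K := (x, y).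

Definition hprod_dot (x y : hprod H K) : C := dot x.1 y.1 + dot x.2 y.2.

Fact hprod_dotP (a : C) (x y z : hprod H K) :
  hprod_dot (a *: x + y) z = a * hprod_dot x z + hprod_dot y z.
Proof. by rewrite /hprod_dot !dotP mulrDr addrACA. Qed.

Fact hprod_dotC (x y : hprod H K) : hprod_dot y x = (hprod_dot x y)^*.
Proof. by rewrite /hprod_dot rmorphD /= -!dotC. Qed.

Fact hprod_dot_ge0 (x : hprod H K) : 0 <= hprod_dot x x.
Proof. by rewrite addr_ge0 ?dot_ge0. Qed.

Fact hprod_dot_eq0 (x : hprod H K) : hprod_dot x x = 0 -> x = 0.
Proof.
move=> /eqP; rewrite paddr_eq0 ?dot_ge0// => /andP[/eqP/dot_eq0 x1].
by move=> /eqP/dot_eq0 x2; case: x x1 x2 => ? ? /= -> ->.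
Qed.

HB.instance Definition _ := Lmodule_isPreHilbert.Build C (hprod H K)
  hprod_dotP hprod_dotC hprod_dot_ge0 hprod_dot_eq0.

Lemma hprod_norm (x : hprod H K) : `|x| ^+ 2 = `|x.1| ^+ 2 + `|x.2| ^+ 2.
Proof. by rewrite -!dot_norm. Qed.

Lemma hprod_norm1 (x : hprod H K) : `|x.1| <= `|x|.
Proof.
by rewrite -(@ler_pXn2r _ 2) ?nnegrE// hprod_norm lerDl exprn_ge0.
Qed.

Lemma hprod_norm2 (x : hprod H K) : `|x.2| <= `|x|.
Proof.
by rewrite -(@ler_pXn2r _ 2) ?nnegrE// hprod_norm lerDr exprn_ge0.
Qed.

Lemma hprod_norm_le (x : hprod H K) : `|x| <= `|x.1| + `|x.2|.
Proof.
rewrite -(@ler_pXn2r _ 2) ?nnegrE ?addr_ge0// hprod_norm sqrrD addrAC.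
by rewrite lerDl mulrn_wge0 ?mulr_ge0.
Qed.

End HProd.

Section HProdComplete.
Variables (C : numClosedFieldType) (H K : hilbertType C).

Fact hprod_complete (F : set_system (hprod H K)) :
  ProperFilter F -> cauchy F -> cvg F.
Proof.
move=> FF /cauchyP Fc.
have cF (L : hilbertType C) (f : hprod H K -> L) :
    (forall x y, `|f x - f y| <= `|x - y|) -> cvg (f @ F).
  move=> fL; apply/cauchy_cvgP/cauchy_exP => e e0; have [x Fx] := Fc e e0.
  exists (f x); apply: (@filterS _ F _ (ball x e)) => // y.
  rewrite /preimage /= -(ball_normE (V := L)) -(ball_normE (V := hprod H K)).
  exact: le_lt_trans.
have /cvg_ex[/= a Fa] : cvg ((fun x : hprod H K => x.1) @ F).
  by apply: cF => x y; exact: (hprod_norm1 (x - y)).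
have /cvg_ex[/= b Fb] : cvg ((fun x : hprod H K => x.2) @ F).
  by apply: cF => x y; exact: (hprod_norm2 (x - y)).
apply/cvg_ex; exists (a, b); apply/cvgrPdist_lt => /= e e0.
have e20 : 0 < e / 2 by rewrite divr_gt0.
move/cvgrPdist_lt : Fa => /(_ _ e20) Fa.
move/cvgrPdist_lt : Fb => /(_ _ e20) Fb.
apply: filterS2 Fa Fb => x xa xb.
by rewrite (le_lt_trans (hprod_norm_le _))// [e]splitr ltrD.
Qed.

HB.instance Definition _ :=
  Uniform_isComplete.Build (hprod H K) hprod_complete.

End HProdComplete.

#[global] Existing Instance totally_filter.

(* Unordered summation, along the filter of finite subsets of I. For the families
   occurring below (orthogonal families, T_i h_i and T_i T_i^* h for a row
   contraction) it agrees with the limit of the partial sums i <= N. *)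
Definition has_sum (C : numClosedFieldType) (V : normedModType C)
    (I : choiceType) (v : I -> V) (l : V) : Prop :=
  partial_sum v @ totally --> l.

Lemma partial_sumE (V : zmodType) (I : choiceType) (v : I -> V) (J : {fset I}) :
  partial_sum v J = \sum_(i <- J) v i.
Proof. by rewrite /partial_sum big_seq_fsetE. Qed.

Lemma cvgC_ge0 (C : numClosedFieldType) (T : Type) (F : set_system T)
    (f : T -> C) (l : C) : ProperFilter F ->
  (\forall x \near F, 0 <= f x) -> f @ F --> l -> 0 <= l.
Proof.
move=> FF f0 fl.
suff -> : l = `|l| by [].
apply: (@cvg_unique _ (@norm_hausdorff _ C^o) (f @ F)) => //.
have : `|f x| @[x --> F] --> `|l| by exact: cvg_norm.
apply: cvg_trans; apply: near_eq_cvg.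
by apply: filterS f0 => x fx; rewrite ger0_norm.
Qed.

Section AbsoluteSummability.
Variables (R : realType) (V : completeNormedModType R[i]) (I : choiceType).

Lemma abs_summable_cvg (v : I -> V) (M : R[i]) :
  (forall J : {fset I}, \sum_(i <- J) `|v i| <= M) ->
  cvg (partial_sum v @ totally).
Proof.
move=> vM; apply/cauchy_cvgP/cauchy_exP => e e0.
pose S : set R := range (fun J : {fset I} => complex.Re (\sum_(i <- J) `|v i|)).
have S0 : S !=set0.
  exists (complex.Re (\sum_(i <- fset0%fset : {fset I}) `|v i|)).
  by exists fset0%fset.
have Sub : has_ubound S.
  exists (complex.Re M) => _ [J _ <-].
  by have := vM J; rewrite lecE => /andP[].
have e0' : 0 < complex.Re e by move: e0; rewrite ltcE => /andP[].
have [_ [J0 _ <-] J0s] := sup_adherent e0' (conj S0 Sub).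
exists (partial_sum v J0); exists J0 => // J /= J0J.
rewrite /preimage/= -(ball_normE (V := V)) /= !partial_sumE distrC.
rewrite (big_fsetID _ (mem J0)) /=.
have -> : [fset x in J | x \in J0]%fset = J0.
  apply/fsetP => x; rewrite !inE /= andbC.
  by case: (boolP (x \in J0)) => //= /(fsubsetP J0J) ->.
rewrite addrC addrK (le_lt_trans (ler_norm_sum _ _ _))//.
have sJ : \sum_(i <- J) `|v i| = (\sum_(i <- J0) `|v i|
    + \sum_(i <- [fset x in J | x \notin J0]%fset) `|v i|)%R.
  rewrite (big_fsetID _ (mem J0)) /=; congr (_ + _); apply: eq_fbigl => x.
  by rewrite !inE /= andbC; case: (boolP (x \in J0)) => //= /(fsubsetP J0J) ->.
set d := (X in X < e); have d0 : 0 <= d by exact: sumr_ge0.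
have : complex.Re (\sum_(i <- J) `|v i|) <= sup S.
  by apply: ub_le_sup => //; exists J.
rewrite sJ raddfD /= -/d => Jle.
rewrite ltcE; apply/andP; split.
  move: e0 d0; rewrite ltcE lecE /= => /andP[/eqP-> _] /andP[/eqP->] _.
  by rewrite eqxx.
by rewrite -(ltrD2l (complex.Re (\sum_(i <- J0) `|v i|)))
  (le_lt_trans Jle)// -ltrBlDr.
Qed.

End AbsoluteSummability.

(* sum_i |v i|^2 < oo *)
Definition sqsummable (C : numClosedFieldType) (V : normedModType C)
    (I : choiceType) (v : I -> V) : Prop :=
  exists M : C, forall J : {fset I}, \sum_(i <- J) `|v i| ^+ 2 <= M.

Section HSum.
Variables (R : realType) (I : choiceType) (K : hilbertType R[i]).

Definition sqsum_pred : {pred (I -> K)} := fun v => `[< sqsummable v >].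

Lemma sqsum_submod : submod_closed sqsum_pred.
Proof.
split=> [|a x y].
  apply/asboolP; exists 0 => J; rewrite big1// => i _.
  by rewrite normr0 expr0n.
move=> /asboolP[M xM] /asboolP[N yN]; apply/asboolP.
exists (`|a| ^+ 2 * M *+ 2 + N *+ 2) => J.
have le2 (u v : K) : `|u + v| ^+ 2 <= `|u| ^+ 2 *+ 2 + `|v| ^+ 2 *+ 2.
  apply: (@le_trans _ _ ((`|u| + `|v|) ^+ 2)).
    by rewrite ler_pXn2r ?nnegrE ?addr_ge0// ler_normD.
  rewrite -subr_ge0 (_ : _ - _ = (`|u| - `|v|) ^+ 2); last by ring.
  by rewrite real_exprn_even_ge0// realB.
rewrite (le_trans (ler_sum _ (fun i _ => le2 _ _)))// big_split /= lerD//.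
  rewrite sumrMnl lerMn2r //=.
  under eq_bigr do rewrite normrZ exprMn.
  by rewrite -mulr_sumr ler_wpM2l// exprn_ge0.
by rewrite sumrMnl lerMn2r /=.
Qed.

HB.instance Definition _ :=
  GRing.isSubmodClosed.Build R[i] (I -> K) sqsum_pred sqsum_submod.

Record hsum := HSum {
  hsum_fun :> I -> K ;
  _ : hsum_fun \in sqsum_pred }.

HB.instance Definition _ := [isSub for hsum_fun].
HB.instance Definition _ := [Choice of hsum by <:].
HB.instance Definition _ := [SubChoice_isSubLmodule of hsum by <:].

Lemma hsumP (x : hsum) : sqsummable x.
Proof. by apply/asboolP; exact: (valP x). Qed.

Lemma hsum_inj (x y : hsum) : (forall i, x i = y i) -> x = y.
Proof. by move=> xy; apply: val_inj; apply/funext. Qed.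

Lemma hsumDE (x y : hsum) i : (x + y) i = x i + y i. Proof. by []. Qed.
Lemma hsumBE (x y : hsum) i : (x - y) i = x i - y i. Proof. by []. Qed.
Lemma hsumZE a (x : hsum) i : (a *: x) i = a *: x i. Proof. by []. Qed.

Definition hsum_dot (x y : hsum) : R[i] := sum (fun i => dot (x i) (y i)).

Lemma has_sum_dot (x y : hsum) :
  has_sum (fun i => dot (x i) (y i)) (hsum_dot x y).
Proof.
have [M xM] := hsumP x; have [N yN] := hsumP y.
suff: forall J : {fset I},
    \sum_(i <- J) `|dot (x i) (y i)| <= M + N by move/abs_summable_cvg.
move=> J.
apply: (@le_trans _ _ (\sum_(i <- J) (`|x i| ^+ 2 + `|y i| ^+ 2))); last first.
  by rewrite big_split lerD.
apply: ler_sum => i _; apply: le_trans (cauchy_schwarz _ _) _.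
have h : `|x i| * `|y i| *+ 2 <= `|x i| ^+ 2 + `|y i| ^+ 2.
  rewrite -subr_ge0 (_ : _ - _ = (`|x i| - `|y i|) ^+ 2); last by ring.
  by rewrite real_exprn_even_ge0// realB.
by apply: le_trans h; rewrite mulr2n lerDl mulr_ge0.
Qed.

Fact hsum_dotP (a : R[i]) (x y z : hsum) :
  hsum_dot (a *: x + y) z = a * hsum_dot x z + hsum_dot y z.
Proof.
apply: cvg_lim; first exact: norm_hausdorff.
rewrite (_ : partial_sum _ = (fun J =>
    a * partial_sum (fun i => dot (x i) (z i)) J +
    partial_sum (fun i => dot (y i) (z i)) J)); last first.
  apply/funext => J; rewrite /partial_sum mulr_sumr -big_split.
  by apply: eq_bigr => i _; rewrite hsumDE hsumZE dotP.
apply: cvgD; last exact: has_sum_dot.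
by apply: cvgMr; exact: has_sum_dot.
Qed.

Fact hsum_dotC (x y : hsum) : hsum_dot y x = (hsum_dot x y)^*.
Proof.
apply: cvg_lim; first exact: norm_hausdorff.
apply/cvgrPdist_lt => e e0.
have /cvgrPdist_lt/(_ e e0) := @has_sum_dot x y.
apply: filterS => J; rewrite /partial_sum -norm_conjC rmorphB/= rmorph_sum/=.
by under eq_bigr do rewrite -dotC.
Qed.

Lemma hsum_dot_sub_ge0 (x : hsum) (J : {fset I}) :
  0 <= hsum_dot x x - \sum_(i <- J) `|x i| ^+ 2.
Proof.
apply: (@cvgC_ge0 _ _ totally
  (fun L => partial_sum (fun i => dot (x i) (x i)) L
            - \sum_(i <- J) `|x i| ^+ 2)); last first.
  by apply: cvgB; [exact: has_sum_dot|exact: cvg_cst].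
exists J => // L /= JL.
rewrite partial_sumE (big_fsetID _ (mem J)) /=.
have -> : [fset i in L | i \in J]%fset = J.
  apply/fsetP => i; rewrite !inE /= andbC.
  by case: (boolP (i \in J)) => //= /(fsubsetP JL) ->.
under eq_bigr do rewrite dot_norm.
by rewrite addrC addrK sumr_ge0// => i _; rewrite dot_ge0.
Qed.

Fact hsum_dot_ge0 (x : hsum) : 0 <= hsum_dot x x.
Proof. by have := hsum_dot_sub_ge0 x fset0; rewrite big_nil subr0. Qed.

Fact hsum_dot_eq0 (x : hsum) : hsum_dot x x = 0 -> x = 0.
Proof.
move=> x0; apply: hsum_inj => i.
have := hsum_dot_sub_ge0 x [fset i]%fset.
rewrite x0 big_seq_fset1 sub0r oppr_ge0 => xi0.
have : `|x i| ^+ 2 == 0 by rewrite eq_le xi0 exprn_ge0.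
by rewrite expf_eq0 /= normr_eq0 => /eqP.
Qed.

HB.instance Definition _ := Lmodule_isPreHilbert.Build R[i] hsum
  hsum_dotP hsum_dotC hsum_dot_ge0 hsum_dot_eq0.

Lemma hsum_norm_ge (x : hsum) (J : {fset I}) :
  \sum_(i <- J) `|x i| ^+ 2 <= `|x| ^+ 2.
Proof. by rewrite -dot_norm -subr_ge0 hsum_dot_sub_ge0. Qed.

Lemma hsum_norm_le (x : hsum) (e : R[i]) : 0 <= e ->
  (forall J : {fset I}, \sum_(i <- J) `|x i| ^+ 2 <= e ^+ 2) -> `|x| <= e.
Proof.
move=> e0 xe; rewrite -(@ler_pXn2r _ 2) ?nnegrE// -dot_norm -subr_ge0.
apply: (@cvgC_ge0 _ _ totally
  (fun L => e ^+ 2 - partial_sum (fun i => dot (x i) (x i)) L)); last first.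
  by apply: cvgB; [exact: cvg_cst|exact: has_sum_dot].
apply: nearW => J; rewrite subr_ge0 partial_sumE.
by under eq_bigr do rewrite dot_norm.
Qed.

Lemma hsum_norm_coord (x : hsum) i : `|x i| <= `|x|.
Proof.
rewrite -(@ler_pXn2r _ 2) ?nnegrE//.
by have := hsum_norm_ge x [fset i]%fset; rewrite big_seq_fset1.
Qed.

Fact hsum_complete (F : set_system hsum) :
  ProperFilter F -> cauchy F -> cvg F.
Proof.
move=> FF /cauchyP Fc.
have cF i : cvg ((fun x : hsum => x i) @ F).
  apply/cauchy_cvgP/cauchy_exP => e e0; have [x Fx] := Fc e e0.
  exists (x i); apply: (@filterS _ F _ (ball x e)) => // y.
  rewrite /preimage /= -(ball_normE (V := K)) -(ball_normE (V := hsum)).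
  by apply: le_lt_trans; exact: (hsum_norm_coord (x - y)).
pose l i := lim ((fun x : hsum => x i) @ F).
have Fl (x : hsum) e : 0 < e -> F (ball x e) ->
    forall J : {fset I}, \sum_(i <- J) `|x i - l i| ^+ 2 <= e ^+ 2.
  move=> e0 Fx J; rewrite -subr_ge0.
  apply: (@cvgC_ge0 _ _ F
    (fun y : hsum => e ^+ 2 - \sum_(i <- J) `|x i - y i| ^+ 2)).
    apply: filterS Fx => y; rewrite -(ball_normE (V := hsum)) /= => xy.
    rewrite subr_ge0 (le_trans (hsum_norm_ge (x - y) J))//.
    by rewrite ler_pXn2r ?nnegrE ?(ltW e0)//; exact: ltW.
  apply: cvgB; first exact: cvg_cst.
  apply: (cvg_big add_continuous) => i _.
  under eq_fun do rewrite expr2.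
  rewrite expr2; apply: cvgM; apply: cvg_norm;
    (apply: cvgB; [exact: cvg_cst|exact: cF]).
have [x Fx] := Fc _ (@ltr01 R[i]).
have xl : sqsummable (fun i => x i - l i).
  by exists (1 ^+ 2) => J; apply: Fl.
have xl' : (fun i => x i - l i) \in sqsum_pred by apply/asboolP.
pose L := x - HSum xl'.
have Li i : L i = l i by rewrite hsumBE /= opprB addrC subrK.
apply/cvg_ex; exists L; apply/cvgrPdist_lt => /= e e0.
have e20 : 0 < e / 2 by rewrite divr_gt0.
have [z Fz] := Fc _ e20.
apply: (@filterS _ F _ (ball z (e / 2))) => // y.
rewrite -(ball_normE (V := hsum)) /= => zy.
have zL : `|z - L| <= e / 2.
  apply: hsum_norm_le; first exact: ltW.
  move=> J; rewrite (eq_bigr (fun i => `|z i - l i| ^+ 2)); first exact: Fl.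
  by move=> i _; rewrite hsumBE Li.
have -> : L - y = (z - y) - (z - L).
  by rewrite opprB [RHS]addrC addrA subrK.
by rewrite (le_lt_trans (ler_normB _ _))// [e]splitr ltr_leD.
Qed.

HB.instance Definition _ := Uniform_isComplete.Build hsum hsum_complete.

End HSum.

Lemma dot_continuous (C : numClosedFieldType) (H : preHilbertType C) (y : H) :
  continuous (fun x : H => dot x y : C^o).
Proof.
move=> x; apply/cvgrPdist_lt => /= e e0.
have y0 : 0 < `|y| + 1 by rewrite ltr_wpDl.
have d0 : 0 < e / (`|y| + 1) by rewrite divr_gt0.
near=> z.
have xz : `|x - z| < e / (`|y| + 1) by near: z; apply: cvgr_dist_lt.
rewrite -dotBl (le_lt_trans (cauchy_schwarz _ _))//.
apply: (@le_lt_trans _ _ (`|x - z| * (`|y| + 1))).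
  by rewrite ler_wpM2l// lerDl.
by rewrite -ltr_pdivlMr.
Unshelve. all: by end_near. Qed.

Section Ortho.
Variables (C : numClosedFieldType) (H : preHilbertType C) (S : set H).

Definition ortho_set : set H := [set x | forall y, S y -> dot x y = 0].

Fact ortho0 : ortho_set 0.
Proof. by move=> y _; exact: dot0l. Qed.

Fact orthoP (a : C) (x y : H) :
  ortho_set x -> ortho_set y -> ortho_set (a *: x + y).
Proof. by move=> Sx Sy z Sz; rewrite dotP Sx// Sy// mulr0 addr0. Qed.

Fact ortho_closed : closed ortho_set.
Proof.
have -> : ortho_set = \bigcap_(y in S) ((fun x : H => dot x y : C^o) @^-1` [set 0]).
  by apply/seteqP; split.
apply: closed_bigI => y _; apply: closed_comp.
  by move=> x _; exact: dot_continuous.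
exact/accessible_closed_set1/hausdorff_accessible/norm_hausdorff.
Qed.

Definition ortho : csub H := CSub ortho0 orthoP ortho_closed.

End Ortho.

Record bop (C : numClosedFieldType) (H K : hilbertType C) := Bop {
  bop_lin :> {linear H -> K} ;
  bop_continuous : continuous bop_lin }.

Section BoundedOperators.
Variable C : numClosedFieldType.
Implicit Types H K L : hilbertType C.

HB.instance Definition _ H K := gen_eqMixin (bop H K).
HB.instance Definition _ H K := gen_choiceMixin (bop H K).

Definition bop_id H : bop H H := @Bop C H H idfun (fun x => @cvg_id _ (nbhs x)).

Fact bop0_continuous H K : continuous (\0 : {linear H -> K}).
Proof. by move=> x; exact: cvg_cst. Qed.

Definition bop0 H K : bop H K := Bop (@bop0_continuous H K).

Fact bop_comp_continuous H K L (A : bop K L) (B : bop H K) :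
  continuous (A \o B : {linear H -> L}).
Proof.
by move=> x; apply: continuous_comp; exact: bop_continuous.
Qed.

Definition bop_comp H K L (A : bop K L) (B : bop H K) : bop H L :=
  Bop (@bop_comp_continuous H K L A B).

Fact bop_sub_continuous H K (A B : bop H K) :
  continuous (A \- B : {linear H -> K}).
Proof. by move=> x; apply: cvgB; exact: bop_continuous. Qed.

Definition bop_sub H K (A B : bop H K) : bop H K := Bop (@bop_sub_continuous H K A B).

Fact incl_continuous H (M : csub H) :
  continuous (\val : {linear subspace M -> H}).
Proof.
apply/linear_bounded_continuous/bounded_funP => r; exists r => y.
by rewrite subspace_norm.
Qed.

Definition incl H (M : csub H) : bop M H := @Bop C M H _ (@incl_continuous H M).

(* The operator specified by P. The sets P used below have at most one element,
   and exactly one as soon as the operator in question is defined in the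
   mathematical sense; the default value 0 is returned otherwise. *)
Definition the_bop H K (P : set (bop H K)) : bop H K := xget (bop0 H K) P.

Definition adj H K (A : bop H K) : bop K H :=
  the_bop [set B | forall x y, dot (A x) y = dot x (B y)].

(* The order of C only compares numbers differing by a real, so bop_le A B says
   that B - A is positive, in particular self-adjoint. *)
Definition bop_le H (A B : bop H H) : Prop :=
  forall x, dot (A x) x <= dot (B x) x.

Definition bop_sqrt H (A : bop H H) : bop H H :=
  the_bop [set B | bop_le (bop0 H H) B /\ forall x, B (B x) = A x].

Definition contractive H K (A : bop H K) : Prop := forall x, `|A x| <= `|x|.

Definition unitary H K (A : bop H K) : Prop :=
  (forall x y, dot (A x) (A y) = dot x y) /\ (forall y, exists x, A x = y).

(* (I - A^* A)^{1/2} *)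
Definition defect H K (A : bop H K) : bop H H :=
  bop_sqrt (bop_sub (bop_id H) (bop_comp (adj A) A)).

Fact crange0 H K (A : bop H K) : closure (range A) 0.
Proof. by apply: subset_closure; exists 0 => //; rewrite raddf0. Qed.

Fact crangeP H K (A : bop H K) (a : C) (x y : K) :
  closure (range A) x -> closure (range A) y ->
  closure (range A) (a *: x + y).
Proof.
move=> Ax Ay B Bxy.
have : (fun z : K * K => a *: z.1 + z.2) z @[z --> (x, y)] --> a *: x + y.
  by apply: cvgD; [apply: cvgZr; exact: cvg_fst|exact: cvg_snd].
move=> /(_ _ Bxy) [[P Q] /= [Px Qy] PQB].
have [_ [[u _ <-] Pu]] := Ax _ Px.
have [_ [[v _ <-] Qv]] := Ay _ Qy.
exists (A (a *: u + v)); split; first by exists (a *: u + v).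
by rewrite linearP; exact: (PQB (A u, A v)).
Qed.

Definition crange H K (A : bop H K) : csub K :=
  CSub (crange0 A) (@crangeP H K A) (@closed_closure _ (range A)).

Fact to_crange_subproof H K (A : bop H K) (x : H) :
  A x \in csub_pred (crange A).
Proof. by apply/mem_set; apply: subset_closure; exists x. Qed.

Definition to_crange H K (A : bop H K) (x : H) : crange A :=
  Subspace (to_crange_subproof A x).

Definition ominus H (M N : set H) : set H := M `&` csub_set (ortho N).

End BoundedOperators.

Section Single.
Variables (R : realType) (I : choiceType) (K : hilbertType R[i]).

Fact single_subproof (i : I) (k : K) :
  (fun j => if j == i then k else 0) \in @sqsum_pred R I K.
Proof.
apply/asboolP; exists (`|k| ^+ 2) => J.
have [iJ|iJ] := boolP (i \in J).
  rewrite (bigD1_seq i) ?fset_uniq//= eqxx big1 ?addr0// => j /negbTE ->.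
  by rewrite normr0 expr0n.
rewrite big_seq big1 ?exprn_ge0// => j jJ; case: eqP => [ji|_].
  by rewrite -ji jJ in iJ.
by rewrite normr0 expr0n.
Qed.

Definition single (i : I) (k : K) : hsum I K := HSum (single_subproof i k).

Lemma dot_single (i j : I) (h k : K) :
  dot (single i h) (single j k) = if i == j then dot h k else 0.
Proof.
have -> : dot (single i h) (single j k) =
    sum (fun m => dot (single i h m) (single j k m)) by [].
apply: cvg_lim; first exact: norm_hausdorff.
apply: cvg_near_cst; exists [fset i]%fset => // J /=.
rewrite fsub1set => iJ; rewrite partial_sumE (bigD1_seq i) ?fset_uniq//=.
rewrite eqxx big1 ?addr0 => [|m /negbTE ->]; last by rewrite dot0l.
by case: eqP => // _; rewrite dot0r.
Qed.

End Single.

Section Fock.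
Variables (R : realType) (I : choiceType).
Implicit Types K L : hilbertType R[i].

(* F^2(H_n) (x) K, realised as l^2 over the free semigroup of words in I: the
   elementary tensor e_alpha (x) k is the family supported at the word alpha
   with value k, the unit of the semigroup being the empty word. *)
Definition fock K : hilbertType R[i] := hsum (seq I) K.

Definition etens K (alpha : seq I) (k : K) : fock K := single alpha k.

(* S_i (x) I_K, i.e. e_alpha (x) k |-> (e_i (x) e_alpha) (x) k *)
Definition creation K (i : I) : bop (fock K) (fock K) :=
  the_bop [set S | forall alpha k, S (etens alpha k) = etens (i :: alpha) k].

(* I (x) W *)
Definition ampl K L (W : bop K L) : bop (fock K) (fock L) :=
  the_bop [set A | forall alpha k, A (etens alpha k) = etens alpha (W k)].

Definition multi_analytic K L (A : bop (fock K) (fock L)) : Prop :=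
  forall i x, A (creation K i x) = creation L i (A x).

Definition coincide K K' L L' (A : bop (fock K) (fock L))
    (A' : bop (fock K') (fock L')) : Prop :=
  exists (W : bop K K') (Ws : bop L L'),
    [/\ unitary W, unitary Ws &
     forall x, ampl Ws (A x) = A' (ampl W x)].

End Fock.

Section RowContractions.
Variables (R : realType) (I : choiceType) (H : hilbertType R[i]).
Variable T : I -> bop H H.

(* Q = sum_i T_i T_i^*, the sum being strongly convergent *)
Definition row_square (Q : bop H H) : Prop :=
  forall h, has_sum (fun i => T i (adj (T i) h)) (Q h).

Definition row_contraction : Prop :=
  exists2 Q, row_square Q & bop_le Q (bop_id H).

Definition word_op (alpha : seq I) : bop H H :=
  foldr (fun i A => bop_comp (T i) A) (bop_id H) alpha.

Definition cnc : Prop := forall h : H,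
  (forall k : nat, (0 < k)%N ->
    has_sum (fun alpha : k.-tuple I => `|adj (word_op alpha) h| ^+ 2 : R[i])
            (`|h| ^+ 2)) ->
  h = 0.

Definition row_op : bop (hsum I H) H :=
  the_bop [set A | forall h : hsum I H, has_sum (fun i => T i (h i)) (A h)].

Definition defect_star : bop H H :=
  bop_sqrt (bop_sub (bop_id H) (the_bop row_square)).

Definition defect_row : bop (hsum I H) (hsum I H) := defect row_op.

Definition Dstar : hilbertType R[i] := crange defect_star.

Definition Drow : hilbertType R[i] := crange defect_row.

(* The symbol takes its values in F^2 (x) D_*; it is written in the larger
   space F^2 (x) H. *)
Definition charfun_symbol (h : Drow) : fock I H :=
  - etens [::] (sum (fun i => T i (subspace_val h i))) +
  sum (fun i => creation H i
    (sum (fun alpha : seq I => etens alpha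
      (defect_star (adj (word_op alpha) (defect_row (subspace_val h) i)))))).

Definition charfun : bop (fock I Drow) (fock I Dstar) :=
  the_bop [set Theta | multi_analytic Theta /\
    forall h, ampl I (incl (crange defect_star)) (Theta (etens [::] h))
              = charfun_symbol h].

End RowContractions.

Section Factorizations.
Variables (R : realType) (I : choiceType).
Implicit Types E F Es : hilbertType R[i].

Definition defect_space E F (Theta : bop (fock I E) (fock I F)) :
  hilbertType R[i] := crange (defect Theta).

Definition factor_map E F Es (Theta : bop (fock I E) (fock I Es))
    (Theta1 : bop (fock I E) (fock I F)) (Theta2 : bop (fock I F) (fock I Es)) :
    bop (defect_space Theta) (hprod (defect_space Theta2) (defect_space Theta1)) :=
  the_bop [set X | forall f, X (to_crange (defect Theta) f) =
    hpair (to_crange (defect Theta2) (Theta1 f)) (to_crange (defect Theta1) f)].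

Definition regular_factorization E F Es (Theta : bop (fock I E) (fock I Es))
    (Theta1 : bop (fock I E) (fock I F)) (Theta2 : bop (fock I F) (fock I Es)) :
    Prop :=
  [/\ multi_analytic Theta1 /\ contractive Theta1,
      multi_analytic Theta2 /\ contractive Theta2,
      forall f, Theta f = Theta2 (Theta1 f) &
      unitary (factor_map Theta Theta1 Theta2)].

(* The isometry Delta_Theta f |-> Delta_Theta (S_i (x) I) f *)
Definition defect_shift E F (Theta : bop (fock I E) (fock I F)) (i : I) :
    bop (defect_space Theta) (defect_space Theta) :=
  the_bop [set V | forall f, V (to_crange (defect Theta) f) =
    to_crange (defect Theta) (creation E i f)].

Section Model.
Variables (E F Es : hilbertType R[i]).
Variables (Theta1 : bop (fock I E) (fock I F)).
Variables (Theta2 : bop (fock I F) (fock I Es)).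

Definition model_dilation : hilbertType R[i] :=
  hprod (hprod (fock I Es) (defect_space Theta2)) (defect_space Theta1).

Definition triple (f : fock I Es) (phi : defect_space Theta2)
    (psi : defect_space Theta1) : model_dilation := hpair (hpair f phi) psi.

Definition model_graph : set model_dilation :=
  [set triple (Theta2 (Theta1 f)) (to_crange (defect Theta2) (Theta1 f))
              (to_crange (defect Theta1) f) | f in setT].

Definition model_space : csub model_dilation := ortho model_graph.

Definition model_H1 : set model_dilation :=
  ominus [set x | exists f g,
            x = triple (Theta2 f) (to_crange (defect Theta2) f) g]
         model_graph.

Definition model_H2 : set model_dilation :=
  ominus [set x | exists f phi, x = triple f phi 0]
         [set triple (Theta2 f) (to_crange (defect Theta2) f) 0 | f in setT].

Definition is_model_row (TT : I -> bop model_space model_space) : Prop :=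
  forall i (f : fock I Es) (phi : defect_space Theta2)
    (psi : defect_space Theta1) (x : model_space),
  subspace_val x = triple f phi psi ->
  subspace_val (adj (TT i) x) = triple (adj (creation Es i) f)
    (adj (defect_shift Theta2 i) phi) (adj (defect_shift Theta1 i) psi).

End Model.
End Factorizations.

Arguments model_graph {R I E F Es} Theta1 Theta2 _.
Arguments model_H1 {R I E F Es} Theta1 Theta2 _.
Arguments model_H2 {R I E F Es} Theta1 Theta2 _.

Definition unitary_equivalence (R : realType) (I : choiceType)
    (H K : hilbertType R[i]) (T : I -> bop H H) (TT : I -> bop K K)
    (U : bop H K) : Prop :=
  unitary U /\ forall i h, U (T i h) = TT i (U h).

Definition invariant_under (R : realType) (I : choiceType)
    (H : hilbertType R[i]) (T : I -> bop H H) (M : set H) : Prop :=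
  forall i h, M h -> M (T i h).

(* n = Some m is the finite value m and n = None is infinity *)
Definition gens (n : option nat) : choiceType :=
  if n is Some m then 'I_m : choiceType else nat : choiceType.

(* Main.v *)
Require Import Defs.
From HB Require Import structures.
From mathcomp Require Import all_boot all_order all_algebra finmap complex.
From mathcomp Require Import all_classical all_reals.
From mathcomp Require Import topology normedtype ring lra.
From mathcomp.analysis Require Import showcase.summability.

Set Implicit Arguments.
Unset Strict Implicit.
Unset Printing Implicit Defensive.

Import Order.TTheory GRing.Theory Num.Theory.
Import numFieldNormedType.Exports.

Local Open Scope classical_set_scope.
Local Open Scope ring_scope.

(** A row contraction T on H is dilated to a row isometry V on a space K that is
   the orthogonal sum of H and a V-invariant copy J of F^2 (x) E, with
   V_i^* = T_i^* on H. The wandering subspace of V is a copy of E_*, and the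
   resulting Fourier transform from K to F^2 (x) E_* restricts to the
   characteristic function on F^2 (x) E: its value at a vector is obtained by
   applying the words of V^* and projecting on the wandering subspace, which is
   the formula for the symbol ([charfun_fourier]). The dilation is written down
   explicitly; what makes it work is T Delta_T = Delta_* T, a property of positive
   square roots ([bop_sqrt_intertwine]). For completely non-coisometric T no
   nonzero vector of K is orthogonal both to F^2 (x) E and to the range of G, the
   isometry adjoint to the Fourier transform ([dilation_total]).

   The functional model then comes from comparing Gram matrices. Two families with
   the same Gram matrix are related by a unique isometry, which is unitary if both
   families are total ([isometric_extension]). In K take the vectors G f and J f,
   in the dilation space of the model the vectors (f, 0, 0) and
   (Theta_2 Theta_1 f, Delta_2 Theta_1 f, Delta_1 f): both Gram matrices only
   involve Theta = Theta_2 Theta_1. The first family is total by complete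
   non-coisometry, the second one precisely because the factorization is regular
   ([regular_unitary]). The unitary so obtained takes H, the complement of J, to
   the complement of the graph, and V to the row isometry of the model
   ([model_equivalence]). That H1 and H2 are complementary and that H1 is
   invariant is geometry inside the model ([model_H2_complement],
   [model_H1_invariant]).

   Given a T-invariant H1, the subspace M = H1 (+) F^2 (x) E of K is V-invariant.
   Its own wandering subspace is the space F; if D : F^2 (x) F -> M is the Wold
   embedding of its shift part, then Theta_1 = D^* J and Theta_2 = G^* D. The
   product is Theta since the residual part of M lies in the residual part of K,
   where the Fourier transform vanishes ([shift_part_vanish]). Adding the vectors
   D f in K and (Theta_2 f, Delta_2 f, 0) in the model to the two families above
   makes the second one total without any assumption, so the same comparison
   yields the unitary, then the regularity of the factorization
   ([lifted_regular]), and the images of H1 and H2 ([lifted_H2]). *)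

(** * Operators on Hilbert spaces *)

Section Basics.
Variable R : realType.
Local Notation C := R[i].
Implicit Types H K L : hilbertType C.

Lemma dot_sumr H (I : Type) (s : seq I) (v : I -> H) x :
  dot x (\sum_(i <- s) v i) = \sum_(i <- s) dot x (v i).
Proof.
by elim: s => [|i s IH]; rewrite ?big_nil ?dot0r// !big_cons dotDr IH.
Qed.

Lemma dotBr H (x y z : H) : dot x (y - z) = dot x y - dot x z.
Proof. by rewrite -[- z]scaleN1r dotDr dotZr rmorphN1 mulN1r. Qed.

Lemma dotNl H (x y : H) : dot (- x) y = - dot x y.
Proof. by rewrite -(sub0r x) dotBl dot0l sub0r. Qed.

Lemma dotNr H (x y : H) : dot x (- y) = - dot x y.
Proof. by rewrite -(sub0r y) dotBr dot0r sub0r. Qed.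

Lemma dot_extr H (x y : H) : (forall z, dot z x = dot z y) -> x = y.
Proof.
move=> xy; apply/eqP; rewrite -subr_eq0; apply/eqP/dot_eq0.
by rewrite dotBr xy subrr.
Qed.

Lemma dot_extl H (x y : H) : (forall z, dot x z = dot y z) -> x = y.
Proof. by move=> xy; apply: dot_extr => z; rewrite dotC xy -dotC. Qed.

Lemma dot_flip H (x y : H) : dot x y = 0 -> dot y x = 0.
Proof. by move=> xy; rewrite dotC xy rmorph0. Qed.

Lemma dot_subspace H (M : csub H) (x y : M) :
  dot x y = dot (subspace_val x) (subspace_val y).
Proof. by []. Qed.

Lemma dot_hprod H K (x y : hprod H K) : dot x y = dot x.1 y.1 + dot x.2 y.2.
Proof. by []. Qed.

Lemma bopD H K (A : bop H K) x y : A (x + y) = A x + A y.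
Proof. exact: raddfD. Qed.

Lemma bopB H K (A : bop H K) x y : A (x - y) = A x - A y.
Proof. exact: raddfB. Qed.

Lemma bopN H K (A : bop H K) x : A (- x) = - A x.
Proof. exact: raddfN. Qed.

Lemma bop_0 H K (A : bop H K) : A 0 = 0.
Proof. exact: raddf0. Qed.

Lemma bopZ H K (A : bop H K) a x : A (a *: x) = a *: A x.
Proof. exact: linearZ. Qed.

Lemma norm_of_dot H K (x : H) (y : K) : dot x x = dot y y -> `|x| = `|y|.
Proof.
by rewrite !dot_norm => /eqP; rewrite eqrXn2// => /eqP.
Qed.

Lemma bop_bound H K (A : bop H K) :
  exists2 c : C, 0 <= c & forall x, `|A x| <= c * `|x|.
Proof.
have /linear_bounded_continuous/linear_boundedP := @bop_continuous _ _ _ A.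
by move=> /pinfty_ex_gt0[c c0 Ac]; exists c => //; exact: ltW.
Qed.

Lemma bop_of_bounded H K (f : H -> K) (c : C) :
  (forall a x y, f (a *: x + y) = a *: f x + f y) ->
  (forall x, `|f x| <= c * `|x|) ->
  exists B : bop H K, forall x, B x = f x.
Proof.
move=> fl fc.
pose fL := HB.pack f (GRing.isLinear.Build C H K *:%R f fl) : {linear H -> K}.
have cf : continuous (fL : {linear H -> K}).
  apply/linear_bounded_continuous/bounded_funP => r; exists (`|c| * `|r|) => x xr.
  have r0 : 0 <= r by apply: le_trans xr.
  have c0 : c * `|x| = `|c| * `|x|.
    by rewrite -{2}[ `|x|]normr_id -normrM ger0_norm// (le_trans _ (fc x)).
  rewrite (le_trans (fc x))// c0 ler_wpM2l// (le_trans xr)//.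
  by rewrite ger0_norm.
by exists (Bop cf).
Qed.

Lemma near0_eq0 (c d : C) : (forall e : C, 0 < e -> `|c| <= e * d) -> c = 0.
Proof.
move=> ce; apply/eqP/negPn/negP => c0.
have cp : 0 < `|c| by rewrite normr_gt0.
have d0 : 0 < d.
  by have := lt_le_trans cp (ce 1 ltr01); rewrite mul1r.
have := ce (`|c| / (d + d)) (divr_gt0 cp (addr_gt0 d0 d0)).
have -> : `|c| / (d + d) * d = `|c| / 2.
  have d0' : d != 0 by rewrite gt_eqF.
  by field; rewrite /= -mulr2n mulrn_eq0.
by rewrite ler_pMr// invf_ge1// -[X in _ <= X]/(1%:R) ler_nat.
Qed.

(** The representing vector minimises g x = |x|^2 - 2 Re (f x): by the
   parallelogram law a minimising filter is Cauchy, and comparing g x with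
   g (x + t a) shows that <a, x> is close to f a once g x is close to its
   infimum. *)
Lemma riesz H (f : H -> C) (c : C) :
  (forall a x y, f (a *: x + y) = a * f x + f y) ->
  (forall x, `|f x| <= c * `|x|) ->
  exists z, forall x, f x = dot x z.
Proof.
move=> fl fc.
have fD x y : f (x + y) = f x + f y by rewrite -[x]scale1r fl mul1r scale1r.
have f0 : f 0 = 0 by apply: (@addrI _ (f 0)); rewrite -fD !addr0.
have fZ a x : f (a *: x) = a * f x by rewrite -[a *: x]addr0 fl f0 addr0.
pose g x : C := dot x x - (f x + (f x)^*).
have gR x : g x = (complex.Re (g x))%:C%C.
  have : (g x)^* = g x.
    rewrite /g !(rmorphB, rmorphD)/= conjCK -dotC; congr (_ - _).
    by rewrite addrC.
  by move/CrealP/RRe_real.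
have glb x : - (`|c| ^+ 2) <= g x.
  have h1 : f x + (f x)^* <= (`|c| * `|x|) *+ 2.
    have fr : f x + (f x)^* \is Num.real.
      by apply/CrealP; rewrite rmorphD/= conjCK addrC.
    rewrite (le_trans (real_ler_norm fr))// (le_trans (ler_normD _ _))//.
    rewrite norm_conjC -mulr2n lerMn2r/= (le_trans (fc x))//.
    have c0 : c * `|x| = `|c| * `|x|.
      by rewrite -{2}[ `|x|]normr_id -normrM ger0_norm// (le_trans _ (fc x)).
    by rewrite c0.
  have h2 : 0 <= (`|x| - `|c|) ^+ 2 by rewrite real_exprn_even_ge0// realB.
  rewrite /g dot_norm lerBrDr -lerBrDl opprK (le_trans h1)//.
  rewrite -subr_ge0 (_ : _ - _ = (`|x| - `|c|) ^+ 2)//.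
  by rewrite sqrrB mulrC addrAC.
pose d := inf (range (fun x => complex.Re (g x))).
have hi : has_inf (range (fun x => complex.Re (g x))).
  split; first by exists (complex.Re (g 0)); exists 0.
  exists (complex.Re (- `|c| ^+ 2)) => _ [x _ <-].
  by have := glb x; rewrite lecE => /andP[].
have dle x : d%:C%C <= g x.
  rewrite gR lecR; apply: ge_inf; first by case: hi.
  by exists x.
pose A (e : C) := [set x | g x < d%:C%C + e].
have A0 (e : C) : 0 < e -> A e !=set0.
  move=> e0; have eE : e = (complex.Re e)%:C%C by rewrite RRe_real// gtr0_real.
  have e0' : 0 < complex.Re e by rewrite -ltcR -eE.
  have [_ [x _ <-] xe] := inf_adherent e0' hi.
  by exists x; rewrite /A /= gR eE -rmorphD ltcR.
have gD x a t : g (x + t *: a) =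
    g x + (t * (dot a x - f a) + (t * (dot a x - f a))^*) + t * t^* * dot a a.
  rewrite /g !(dotDl, dotDr, dotZl, dotZr) (dotC a x) fD fZ.
  rewrite !(rmorphD, rmorphM, rmorphB)/=; ring.
have key (e : C) x a : 0 < e -> A e x -> `|dot a x - f a| ^+ 2 <= e * dot a a.
  move=> e0 Ax; set w := _ - f a.
  have [/dot_eq0 a0|a0] := eqVneq (dot a a) 0.
    by rewrite a0 dot0l mulr0 /w a0 dot0l f0 subrr normr0 expr0n.
  have ap : 0 < dot a a by rewrite lt_def a0 dot_ge0.
  have := dle (x + (- w^* / dot a a) *: a).
  have aR : (dot a a)^* = dot a a by rewrite -dotC.
  have tE : (- w^* / dot a a * w + (- w^* / dot a a * w)^*) +
      - w^* / dot a a * (- w^* / dot a a)^* * dot a a = - (`|w| ^+ 2 / dot a a).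
    by rewrite normCK !(rmorphM, rmorphN, fmorphV)/= conjCK aR; field.
  rewrite gD -/w -[X in _ <= X -> _]addrA tE => h.
  have := le_lt_trans h (_ : _ < d%:C%C + e - `|w| ^+ 2 / dot a a).
  by rewrite ltrD2r -addrA ltrDl subr_gt0 => /(_ Ax)/ltW; rewrite ler_pdivrMr.
have par (e : C) x y : A e x -> A e y -> `|x - y| ^+ 2 <= 4 * e.
  move=> Ax Ay.
  have h := dle (x + 2^-1 *: (y - x)).
  have gE : g (x + 2^-1 *: (y - x)) *+ 4 = (g x + g y) *+ 2 - `|x - y| ^+ 2.
    rewrite -dot_norm /g fD fZ fD -[- x]scaleN1r fZ.
    rewrite !(dotDl, dotDr, dotZl, dotZr, dotNl, dotNr) (dotC x y).
    rewrite !(rmorphD, rmorphB, rmorphM, fmorphV, rmorph_nat, rmorphN, rmorph1)/=.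
    by field.
  have Axy : (g x + g y) *+ 2 < (d%:C%C *+ 2 + e *+ 2) *+ 2.
    by rewrite ltr_pMn2r// -mulrnDl mulr2n ltrD.
  have : d%:C%C *+ 4 <= g (x + 2^-1 *: (y - x)) *+ 4 by rewrite lerMn2r.
  rewrite gE => h4.
  have := le_lt_trans h4 (_ : _ < (d%:C%C *+ 2 + e *+ 2) *+ 2 - `|x - y| ^+ 2).
  rewrite ltrD2r => /(_ Axy).
  rewrite mulrnDl -!mulrnA -addrA ltrDl subr_gt0 => /ltW.
  by rewrite mulr_natl.
pose F := filter_from [set e : C | 0 < e] A.
have FF : ProperFilter F.
  apply: filter_from_proper => //; apply: filter_from_filter; first by exists 1 => /=.
  move=> e1 e2 /= e10 e20.
  have [e12|e21] := real_leP (gtr0_real e10) (gtr0_real e20).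
    exists e1 => // x Ax; split => //.
    by rewrite /A /= (lt_le_trans Ax)// lerD2l.
  exists e2 => // x Ax; split => //.
  by rewrite /A /= (lt_le_trans Ax)// lerD2l ltW.
have [l Fl] : exists l : H, F --> l.
  apply/cvg_ex/cauchy_cvgP/cauchy_exP => e e0.
  have e40 : 0 < e ^+ 2 / 8 by rewrite divr_gt0// exprn_gt0.
  have [x Ax] := A0 _ e40; exists x.
  exists (e ^+ 2 / 8) => // y Ay; rewrite -ball_normE/=.
  rewrite -(@ltr_pXn2r _ 2) ?nnegrE ?(ltW e0)//.
  rewrite (le_lt_trans (par _ _ _ Ax Ay))//.
  rewrite (_ : 4 * _ = e ^+ 2 / 2); last by field.
  by rewrite ltr_pdivrMr// ltr_pMr ?exprn_gt0// ltr1n.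
exists l => a; apply/eqP; rewrite eq_sym -subr_eq0; apply/eqP.
apply: (@near0_eq0 _ (`|a| *+ 2)) => e e0.
have Fe : F (A (e ^+ 2)) by exists (e ^+ 2) => //=; rewrite exprn_gt0.
have Fb : F (ball l e) by apply: Fl; exact: nbhsx_ballx.
have [x [Ax]] := filter_ex (filterI Fe Fb).
rewrite -ball_normE /= => lx.
have -> : dot a l - f a = dot a (l - x) + (dot a x - f a).
  by rewrite dotBr addrA subrK.
rewrite (le_trans (ler_normD _ _))// mulr2n mulrDr lerD//.
  rewrite (le_trans (cauchy_schwarz _ _))// mulrC ler_wpM2r// ltW//.
rewrite -(@ler_pXn2r _ 2) ?nnegrE ?mulr_ge0// ?(ltW e0)//.
rewrite exprMn -dot_norm; apply: key => //.
by rewrite exprn_gt0.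
Qed.

Lemma the_bopP H K (P : set (bop H K)) : (exists B, P B) -> P (the_bop P).
Proof. by move=> [B PB]; exact: (xgetPex (bop0 H K) (ex_intro _ B PB)). Qed.

Lemma adjE H K (A : bop H K) x y : dot (A x) y = dot x (adj A y).
Proof.
suff : exists B : bop K H, forall x y, dot (A x) y = dot x (B y).
  by move=> /the_bopP; exact.
have [c c0 Ac] := bop_bound A.
have /choice[B BE] : forall y, exists z, forall x, dot (A x) y = dot x z.
  move=> y'; apply: (@riesz _ _ (c * `|y'|)) => [a u v|u].
    by rewrite linearP dotP.
  by rewrite (le_trans (cauchy_schwarz _ _))// mulrAC ler_wpM2r// Ac.
have [] := @bop_of_bounded _ _ B c; last by move=> B' B'E; exists B' => u v; rewrite B'E.
  move=> a u v; apply: dot_extr => w.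
  by rewrite -BE dotDr dotZr !BE dotDr dotZr.
move=> u; have [->|u0] := eqVneq (B u) 0; first by rewrite normr0 mulr_ge0.
have n0 : 0 < `|B u| by rewrite normr_gt0.
rewrite -(ler_pM2r n0) -expr2 -dot_norm -BE.
rewrite -[leLHS]ger0_norm; last by rewrite BE dot_ge0.
by rewrite (le_trans (cauchy_schwarz _ _))// mulrAC ler_wpM2r.
Qed.

Lemma adjEr H K (A : bop H K) x y : dot x (A y) = dot (adj A x) y.
Proof. by rewrite dotC adjE -dotC. Qed.

Lemma adj_unique H K (A : bop H K) (B : K -> H) :
  (forall x y, dot (A x) y = dot x (B y)) -> forall y, adj A y = B y.
Proof. by move=> AB y; apply: dot_extr => x; rewrite -adjE AB. Qed.

Lemma adj_comp H K L (A : bop K L) (B : bop H K) y :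
  adj (bop_comp A B) y = adj B (adj A y).
Proof. by apply: (adj_unique (B := adj B \o adj A)) => u v /=; rewrite !adjE. Qed.

(** Families with trivial orthogonal complement stand in for dense subspaces:
   with adjoints at hand, density arguments need no limits. *)
Definition total_family H (X : Type) (a : X -> H) : Prop :=
  forall y, (forall x, dot (a x) y = 0) -> y = 0.

Lemma bop_ext_total H K (X : Type) (a : X -> H) (A B : bop H K) :
  total_family a -> (forall x, A (a x) = B (a x)) -> forall y, A y = B y.
Proof.
move=> ta AB y; apply: dot_extl => z; rewrite !adjE; apply/eqP.
rewrite -subr_eq0 -dotBr; apply/eqP; suff -> : adj A z - adj B z = 0 by rewrite dot0r.
by apply: ta => x; rewrite dotBr -!adjE AB subrr.
Qed.

(** The orthogonal projection is the adjoint of the inclusion. *)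
Lemma proj_ex H (M : csub H) x :
  exists2 p, csub_set M p & forall m, csub_set M m -> dot (x - p) m = 0.
Proof.
exists (subspace_val (adj (Defs.incl M) x)); first exact: subspaceP.
move=> m Mm; have Mm' : m \in csub_pred M by exact/mem_set.
have := adjE (Defs.incl M) (Subspace Mm' : M) x => /= h.
apply: dot_flip; rewrite dotBr h; apply/eqP; rewrite subr_eq0; apply/eqP.
by [].
Qed.

Lemma ortho2 H (M : csub H) x :
  (forall y, csub_set (Defs.ortho (csub_set M)) y -> dot x y = 0) -> csub_set M x.
Proof.
move=> xM; have [p Mp px] := proj_ex M x.
suff /eqP : x - p = 0 by rewrite subr_eq0 => /eqP ->.
apply: dot_eq0; rewrite dotBr (px p)// subr0; apply: dot_flip; exact: xM.
Qed.

Definition isometric H K (W : bop H K) := forall x y, dot (W x) (W y) = dot x y.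

(** An isometry is determined by, and exists for, two families with the same Gram
   matrix. The closed span G of the pairs (a x, b x) has projections p to H and q
   to K, and <p u, p v> = <q u, q v> = <u, v> / 2 on G because this holds on the
   pairs. Hence p^* p = 1 / 2, p is onto since a is total, and the extension is
   2 q p^*. *)
Section IsometricExtension.
Variables (X : Type) (H K : hilbertType C) (a : X -> H) (b : X -> K).
Hypothesis gram : forall x y, dot (a x) (a y) = dot (b x) (b y).
Hypothesis ta : total_family a.

Let S : set (hprod H K) := [set hpair (a x) (b x) | x in setT].
Let G : csub (hprod H K) := Defs.ortho (csub_set (Defs.ortho S)).

Let sG x : hpair (a x) (b x) \in csub_pred G.
Proof. by apply/mem_set => y Sy; apply: dot_flip; apply: Sy; exists x. Qed.
Let s x : G := Subspace (sG x).

Let s_total : total_family s.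
Proof.
move=> w sw; apply: dot_eq0; rewrite dot_subspace.
apply: (subspaceP w) => _ [x _ <-].
by have := sw x; rewrite dot_subspace; exact: dot_flip.
Qed.

Lemma isometric_extension :
  exists2 W : bop H K, isometric W & forall x, W (a x) = b x.
Proof.
have [p pE] : exists p : bop G H, forall w, p w = (subspace_val w).1.
  apply: (@bop_of_bounded _ _ _ 1) => // w; rewrite mul1r subspace_norm.
  exact: hprod_norm1.
have [q qE] : exists q : bop G K, forall w, q w = (subspace_val w).2.
  apply: (@bop_of_bounded _ _ _ 1) => // w; rewrite mul1r subspace_norm.
  exact: hprod_norm2.
have pq x y : dot (p x) (p y) = dot (q x) (q y).
  have e1 x' w : dot (p w) (p (s x')) = dot (q w) (q (s x')).
    rewrite !adjE; congr dot; apply/eqP; rewrite -subr_eq0; apply/eqP.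
    by apply: s_total => y'; rewrite dotBr -!adjE !pE !qE /= gram subrr.
  rewrite !adjEr; congr dot; apply/eqP; rewrite -subr_eq0; apply/eqP.
  by apply: s_total => y'; apply: dot_flip; rewrite dotBl -!adjEr e1 subrr.
have dotG x y : dot x y = dot (p x) (p y) *+ 2.
  by rewrite mulr2n {2}pq !pE !qE.
have pp w : adj p (p w) = 2^-1 *: w.
  apply: dot_extr => z; rewrite -adjE dotZr fmorphV rmorph_nat dotG.
  by field.
have ponto y : p (2 *: adj p y) = y.
  apply/eqP; rewrite -subr_eq0; apply/eqP; apply: ta => x.
  have -> : a x = p (s x) by rewrite pE.
  rewrite adjE bopB /= pp scalerA mulVf ?pnatr_eq0//.
  by rewrite scale1r subrr dot0r.
have fi y z : dot (q (2 *: adj p y)) (q (2 *: adj p z)) = dot y z.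
  by rewrite -pq !ponto.
have [W WE] : exists W : bop H K, forall y, W y = q (2 *: adj p y).
  apply: (@bop_of_bounded _ _ _ 1) => [c x y|x].
    by rewrite (bopD (adj p)) !bopZ !bopD !bopZ scalerDr !scalerA mulrC.
  by rewrite mul1r (norm_of_dot (fi x x)).
exists W => [x y|x]; first by rewrite !WE.
have -> : b x = q (s x) by rewrite qE.
rewrite WE; congr (q _).
have -> : a x = p (s x) by rewrite pE.
by rewrite pp scalerA divff ?pnatr_eq0// scale1r.
Qed.

End IsometricExtension.

Section Isometries.
Variables (H K : hilbertType C) (W : bop H K).

Lemma isometric_norm : isometric W -> forall x, `|W x| = `|x|.
Proof. by move=> iW x; apply: norm_of_dot; rewrite iW. Qed.

Lemma isometric_adjK : isometric W -> forall x, adj W (W x) = x.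
Proof. by move=> iW x; apply: dot_extr => y; rewrite -adjE iW. Qed.

Lemma isometric_unitary :
  isometric W -> (forall y, adj W y = 0 -> y = 0) -> unitary W.
Proof.
move=> iW i0; split => // y; exists (adj W y); apply/eqP.
rewrite -subr_eq0; apply/eqP/i0.
by rewrite bopB/= isometric_adjK// subrr.
Qed.

Lemma contractive_adj (A : bop H K) : contractive A -> contractive (adj A).
Proof.
move=> cA y; have [->|u0] := eqVneq (adj A y) 0; first by rewrite normr0.
have n0 : 0 < `|adj A y| by rewrite normr_gt0.
rewrite -(ler_pM2r n0) -expr2 -dot_norm -adjEr.
rewrite -[leLHS]ger0_norm; last by rewrite adjEr dot_ge0.
by rewrite (le_trans (cauchy_schwarz _ _))// ler_wpM2l//; exact: cA.
Qed.

End Isometries.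

End Basics.

(** * Positive square roots and defect operators *)

Section SquareRoot.
Variable R : realType.
Local Notation C := R[i].
Implicit Types H K L : hilbertType C.

(** Polarization of the real form <B x, x>. *)
Lemma positive_selfadjoint H (B : bop H H) :
  bop_le (bop0 H H) B -> forall x y, dot (B x) y = dot x (B y).
Proof.
move=> B0; pose s x y := dot (B x) y - dot x (B y).
have sE x : s x x = 0.
  have /= := B0 x; rewrite dot0l => h; rewrite /s (dotC (B x) x).
  by apply/eqP; rewrite subr_eq0 eq_sym; apply/eqP/CrealP/ger0_real.
have sD a x y : s (x + a *: y) (x + a *: y) = s x x + a * s y x + a^* * s x y
   + a * a^* * s y y.
  by rewrite /s !(bopD, bopZ, dotDl, dotDr, dotZl, dotZr); ring.
move=> x y; have := sD 1 x y; have := sD 'i x y.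
rewrite !sE rmorph1 conjCi !add0r !mul1r !mulr0 !addr0 => h1 h2.
have h3 : s y x = - s x y by apply/eqP; rewrite -addr_eq0 -h2.
move: h1; rewrite h3 mulrN mulNr -opprD => /eqP.
rewrite eq_sym oppr_eq0 -mulr2n mulrn_eq0 /= mulf_eq0.
by rewrite (negbTE (neq0Ci _)) /= subr_eq0 => /eqP.
Qed.

(** The form <B x, x> is nonnegative at y - t B y for small t > 0, where its
   leading term is - 2 t |B y|^2. *)
Lemma positive_null H (B : bop H H) y :
  bop_le (bop0 H H) B -> dot (B y) y = 0 -> B y = 0.
Proof.
move=> B0 By0; have sa := positive_selfadjoint B0.
pose b := dot (B y) (B y); pose c := dot (B (B y)) (B y).
have c0 : 0 <= c by have /= := B0 (B y); rewrite dot0l.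
have b0 : 0 <= b by exact: dot_ge0.
have c10 : 0 < c + 1 by rewrite ltr_wpDl.
have cr : c^* = c by apply/CrealP/ger0_real.
have br : b^* = b by apply/CrealP/ger0_real.
have := B0 (y + (- b / (c + 1)) *: B y).
rewrite /= dot0l bopD bopZ !(dotDl, dotDr, dotZl, dotZr) By0 (sa (B y) y) -/b -/c.
rewrite !(rmorphM, rmorphN, fmorphV, rmorphD, rmorph1) /= cr br.
set w := (X in 0 <= X -> _).
have -> : w = - (b ^+ 2 * (c + 2) / (c + 1) ^+ 2).
  by rewrite /w; field; rewrite gt_eqF.
rewrite oppr_ge0 pmulr_lle0 ?invr_gt0 ?exprn_gt0//.
rewrite pmulr_lle0; last by rewrite ltr_wpDl.
move=> b2; apply: dot_eq0; rewrite -/b.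
have : b ^+ 2 == 0 by rewrite eq_le b2 exprn_ge0.
by rewrite sqrf_eq0 => /eqP.
Qed.

(** The scalar iteration q' = (1 + q^2) / 2; its increments majorise those of the
   operator iteration Y' = (N + Y^2) / 2, whose limit Y satisfies
   (1 - Y)^2 = 1 - N. *)
Fixpoint sqrt_coef (n : nat) : R :=
  if n is m.+1 then 2^-1 * (1 + sqrt_coef m ^+ 2) else 0.

Definition sqrt_gap (n : nat) : C := (1 - sqrt_coef n)%:C%C.

(** With e = 1 - q the iteration reads e' = e - e^2 / 2, hence the explicit rate. *)
Lemma sqrt_coef_bound n : 0 <= 1 - sqrt_coef n <= 2 / n.+2%:R.
Proof.
elim: n => [|n /andP[IH0 IH1]] /=; first by rewrite subr0 ler01 divff ?pnatr_eq0/=.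
have n0 : (0 : R) < n.+2%:R by rewrite ltr0n.
have n30 : (0 : R) < n.+3%:R by rewrite ltr0n.
set q := sqrt_coef n in IH0 IH1 *; set e := 1 - q in IH0 IH1.
have -> : 1 - 2^-1 * (1 + q ^+ 2) = e - e ^+ 2 / 2 by rewrite /e; field.
set a := 2 / _ in IH1; have a1 : a <= 1.
  by rewrite ler_pdivrMr// mul1r ler_nat.
have e2 : e - e ^+ 2 / 2 <= a - a ^+ 2 / 2 by nra.
apply/andP; split; first by nra.
apply: (le_trans e2); have -> : (n.+3%:R : R) = n.+2%:R + 1 by rewrite -natr1.
rewrite ler_pdivlMr ?addr_gt0// /a.
move: n0; move: (n.+2%:R : R) => m m0.
rewrite (_ : _ * _ = 2 - 2 / m ^+ 2); last by field; rewrite gt_eqF.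
by rewrite gerBl divr_ge0// exprn_ge0// ltW.
Qed.

Lemma sqrt_gap_small (e : C) : 0 < e -> exists n, sqrt_gap n <= e.
Proof.
move=> e0; have eE : e = (complex.Re e)%:C%C by rewrite RRe_real// gtr0_real.
have e0' : 0 < complex.Re e by rewrite -ltcR -eE.
pose n := Num.truncn (2 / complex.Re e).
exists n; rewrite eE lecR; have /andP[_ /le_trans] := sqrt_coef_bound n; apply.
rewrite ler_pdivrMr// -ler_pdivrMl// mulrC.
have := truncnS_gt (2 / complex.Re e) => /ltW/le_trans; apply.
by rewrite ler_nat.
Qed.

Lemma sqrt_gap_eq0 H (v : H) (d : C) : (forall n, `|v| <= sqrt_gap n * d) -> v = 0.
Proof.
move=> vd; apply/eqP; rewrite -normr_eq0; apply/eqP.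
have d0 : 0 <= d.
  by have := vd 0; rewrite /sqrt_gap /= subr0 mul1r; exact: le_trans.
apply: (@near0_eq0 _ _ d) => e e0; have [n ne] := sqrt_gap_small e0.
by rewrite normr_id (le_trans (vd n))// ler_wpM2r.
Qed.

(** Keeping the factor sqrt_gap n in the limit estimate makes the case n = 0 say
   that the limit is a contraction. *)
Lemma sqrt_gap_lim H (u : nat -> H) (d : C) : 0 <= d ->
  (forall n m, (n <= m)%N -> `|u m - u n| <= (sqrt_gap n - sqrt_gap m) * d) ->
  exists y, forall n, `|y - u n| <= sqrt_gap n * d.
Proof.
move=> d0 ud.
have ug n m : (n <= m)%N -> `|u m - u n| <= sqrt_gap n * d.
  move=> /ud /le_trans; apply; rewrite ler_wpM2r// gerBl lecR.
  by have /andP[] := sqrt_coef_bound m.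
have /cvg_ex[y uy] : cvg (u @ \oo).
  apply/cauchy_cvgP/cauchy_exP => e e0.
  have [n ne] : exists n, sqrt_gap n * d < e.
    have [n ne] := sqrt_gap_small (divr_gt0 e0 (ltr_wpDl d0 ltr01)).
    exists n; rewrite (le_lt_trans (ler_wpM2r d0 ne))// -mulrA.
    rewrite gtr_pMr// ltr_pdivrMl ?ltr_wpDl// mulr1 ltrDl//.
  exists (u n); exists n => // m /= nm; rewrite -ball_normE /= distrC.
  exact: le_lt_trans (ug _ _ nm) ne.
exists y => n; apply/ler_addgt0Pr => e e0.
move/cvgrPdist_lt : uy => /(_ e e0) [N _ Nu].
have := Nu (maxn n N) (leq_maxr _ _) => /= h.
rewrite -(subrK (u (maxn n N)) y) -addrA (le_trans (ler_normD _ _))//.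
rewrite [leRHS]addrC lerD ?(ltW h)//.
by apply: ug; exact: leq_maxl.
Qed.

Lemma sqrt_gap_ge0 n : 0 <= sqrt_gap n.
Proof. by rewrite lecR; have /andP[] := sqrt_coef_bound n. Qed.

Lemma sqrt_gapE m : 1 - sqrt_gap m = (sqrt_coef m)%:C%C.
Proof. by rewrite /sqrt_gap rmorphB /= rmorph1 opprB addrC subrK. Qed.

Lemma sqrt_gap_le1 m : 0 <= 1 - sqrt_gap m.
Proof.
rewrite sqrt_gapE lecR; elim: m => //= m _.
by rewrite mulr_ge0 ?addr_ge0// ?exprn_even_ge0// invr_ge0.
Qed.

Lemma sqrt_gap_rec m : sqrt_gap m.+1 = 1 - 2^-1 * (1 + (1 - sqrt_gap m) ^+ 2).
Proof.
by rewrite sqrt_gapE /sqrt_gap /=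
  !(rmorphB, rmorphM, rmorphD, rmorph1, rmorphXn, fmorphV, rmorph_nat).
Qed.

Lemma sqrt_gapS m : sqrt_gap m.+1 <= sqrt_gap m.
Proof.
rewrite lecR /= lerB// -subr_ge0.
set q := sqrt_coef m; rewrite (_ : _ - _ = (1 - q) ^+ 2 / 2); last by field.
by rewrite divr_ge0// exprn_even_ge0.
Qed.

Fixpoint sqrt_iter H (N : bop H H) (n : nat) (x : H) : H :=
  if n is m.+1 then 2^-1 *: (N x + sqrt_iter N m (sqrt_iter N m x)) else 0.

Section Iteration.
Variables (H : hilbertType C) (N : bop H H).
Hypothesis cN : contractive N.

Lemma sqrt_iterP n a x y :
  sqrt_iter N n (a *: x + y) = a *: sqrt_iter N n x + sqrt_iter N n y.
Proof.
elim: n a x y => [|n IH] a x y /=; first by rewrite scaler0 addr0.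
rewrite !IH bopD bopZ addrACA -scalerDr [LHS]scalerDr !scalerA.
by rewrite mulrC.
Qed.

Lemma sqrt_iterB n x y :
  sqrt_iter N n (x - y) = sqrt_iter N n x - sqrt_iter N n y.
Proof.
by rewrite -[- y]scaleN1r addrC sqrt_iterP scaleN1r addrC.
Qed.

Lemma sqrt_iter_norm n x : `|sqrt_iter N n x| <= (1 - sqrt_gap n) * `|x|.
Proof.
have q0 m : 0 <= (sqrt_coef m)%:C%C :> C by rewrite -sqrt_gapE sqrt_gap_le1.
rewrite sqrt_gapE; elim: n x => [|n IH] x /=; first by rewrite normr0 mul0r.
rewrite normrZ ger0_norm ?invr_ge0// rmorphM /= fmorphV rmorph_nat -mulrA.
rewrite ler_wpM2l ?invr_ge0// rmorphD rmorph1 rmorphXn /= mulrDl mul1r.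
rewrite (le_trans (ler_normD _ _))// lerD ?cN// (le_trans (IH _))//.
by rewrite expr2 -mulrA ler_wpM2l.
Qed.

(** Z^2 - Y^2 = Z (Z - Y) + (Z - Y) Y holds without commutativity, and is the
   scalar recursion for the gaps when norms are taken. *)
Lemma sqrt_iter_step n x :
  `|sqrt_iter N n.+1 x - sqrt_iter N n x| <=
  (sqrt_gap n - sqrt_gap n.+1) * `|x|.
Proof.
elim: n x => [|n IH] x.
  rewrite /= subr0 addr0 normrZ ger0_norm ?invr_ge0// sqrt_gap_rec.
  rewrite /sqrt_gap /= subr0 subrr expr0n /= addr0 mulr1 opprB addrC subrK.
  by rewrite ler_wpM2l ?invr_ge0.
set Y := sqrt_iter N n in IH *; set Z := sqrt_iter N n.+1 in IH *.
have -> : sqrt_iter N n.+2 x - Z x = 2^-1 *: ((Z (Z x - Y x)) + (Z (Y x) - Y (Y x))).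
  rewrite /Z sqrt_iterB -/Z addrA subrK.
  rewrite -[Z x]/(2^-1 *: (N x + Y (Y x))) -[sqrt_iter N n.+2 x]/(2^-1 *: (N x + Z (Z x))).
  by rewrite -scalerBr opprD addrACA subrr add0r.
rewrite normrZ ger0_norm ?invr_ge0//.
have -> : sqrt_gap n.+1 - sqrt_gap n.+2 =
    2^-1 * ((1 - sqrt_gap n.+1) * (sqrt_gap n - sqrt_gap n.+1)
            + (sqrt_gap n - sqrt_gap n.+1) * (1 - sqrt_gap n)).
  rewrite (sqrt_gap_rec n.+1) {1}(sqrt_gap_rec n); ring.
rewrite -mulrA ler_wpM2l ?invr_ge0// (le_trans (ler_normD _ _))// mulrDl lerD//.
  rewrite (le_trans (sqrt_iter_norm _ _))// -mulrA ler_wpM2l ?IH//.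
  exact: sqrt_gap_le1.
rewrite (le_trans (IH _))// -mulrA ler_wpM2l ?sqrt_iter_norm//.
by rewrite subr_ge0 sqrt_gapS.
Qed.

Lemma sqrt_iter_cauchy x n m : (n <= m)%N ->
  `|sqrt_iter N m x - sqrt_iter N n x| <= (sqrt_gap n - sqrt_gap m) * `|x|.
Proof.
elim: m => [|m IH]; first by rewrite leqn0 => /eqP->; rewrite !subrr normr0 mul0r.
rewrite leq_eqVlt => /orP[/eqP->|]; first by rewrite !subrr normr0 mul0r.
rewrite ltnS => /IH h.
rewrite -(subrK (sqrt_iter N m x) (sqrt_iter N m.+1 x)) -addrA.
rewrite (le_trans (ler_normD _ _))//.
rewrite -(subrK (sqrt_gap m) (sqrt_gap n)) -addrA mulrDl [leRHS]addrC lerD//.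
exact: sqrt_iter_step.
Qed.

Lemma sqrt_limit : exists Y : bop H H,
  forall x n, `|Y x - sqrt_iter N n x| <= sqrt_gap n * `|x|.
Proof.
have /choice[Y YE] : forall x, exists y, forall n,
    `|y - sqrt_iter N n x| <= sqrt_gap n * `|x|.
  by move=> x; apply: sqrt_gap_lim => // n m; exact: sqrt_iter_cauchy.
have [|x|Y' Y'E] := @bop_of_bounded _ _ _ Y 1.
- move=> a x y; apply/eqP; rewrite -subr_eq0; apply/eqP.
  apply: (@sqrt_gap_eq0 _ _ (`|a *: x + y| + (`|a| * `|x| + `|y|))) => n.
  have -> : Y (a *: x + y) - (a *: Y x + Y y) =
      (Y (a *: x + y) - sqrt_iter N n (a *: x + y))
      - (a *: (Y x - sqrt_iter N n x) + (Y y - sqrt_iter N n y)).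
    rewrite sqrt_iterP scalerBr [X in _ = _ - X]addrACA -opprD.
    by rewrite opprB addrA subrK.
  rewrite (le_trans (ler_normB _ _))// mulrDr lerD//.
  rewrite (le_trans (ler_normD _ _))// mulrDr lerD// normrZ mulrCA.
  by rewrite ler_wpM2l.
- by have := YE x 0%N; rewrite /sqrt_gap /= !subr0 mul1r.
by exists Y' => x n; rewrite Y'E.
Qed.

End Iteration.

Lemma sqrt_iter_intertwine H K (N : bop H H) (M : bop K K) (X : bop K H) n x :
  (forall y, N (X y) = X (M y)) ->
  sqrt_iter N n (X x) = X (sqrt_iter M n x).
Proof.
move=> NX; elim: n x => [|n IH] x /=; first by rewrite bop_0.
by rewrite NX !IH -bopD -bopZ.
Qed.

Lemma sqrt_iter_sym H (N : bop H H) n x y :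
  (forall x y, dot (N x) y = dot x (N y)) ->
  dot (sqrt_iter N n x) y = dot x (sqrt_iter N n y).
Proof.
move=> Ns; elim: n x y => [|n IH] x y /=; first by rewrite dot0l dot0r.
by rewrite dotZl dotZr fmorphV rmorph_nat dotDl dotDr Ns !IH.
Qed.

Section Root.
Variables (H : hilbertType C) (N Y : bop H H).
Hypothesis cN : contractive N.
Hypothesis sN : forall x y, dot (N x) y = dot x (N y).
Hypothesis YE : forall x n, `|Y x - sqrt_iter N n x| <= sqrt_gap n * `|x|.

Lemma sqrt_limit_contractive : contractive Y.
Proof.
by move=> x; have := YE x 0%N; rewrite /sqrt_gap /= !subr0 mul1r.
Qed.

Lemma sqrt_limit_fix x : Y x = 2^-1 *: (N x + Y (Y x)).
Proof.
apply/eqP; rewrite -subr_eq0; apply/eqP.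
apply: (@sqrt_gap_eq0 _ _ (`|x| *+ 2)) => n.
have h1 := YE x n.+1.
have h2 := YE (Y x) n.
have h3 : `|sqrt_iter N n (Y x - sqrt_iter N n x)| <= sqrt_gap n * `|x|.
  rewrite (le_trans (sqrt_iter_norm cN _ _))// (le_trans _ (YE x n))//.
  by rewrite ler_piMl// gerBl sqrt_gap_ge0.
have -> : Y x - 2^-1 *: (N x + Y (Y x)) = (Y x - sqrt_iter N n.+1 x)
   - 2^-1 *: ((Y (Y x) - sqrt_iter N n (Y x))
     + sqrt_iter N n (Y x - sqrt_iter N n x)).
  rewrite sqrt_iterB// addrA subrK /= -addrA -opprD -scalerDr.
  by rewrite addrACA subrr addr0.
rewrite (le_trans (ler_normB _ _))// [X in _ <= _ * X]mulr2n mulrDr lerD//.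
  by rewrite (le_trans h1)// ler_wpM2r ?sqrt_gapS.
rewrite normrZ ger0_norm ?invr_ge0// ler_pdivrMl// (le_trans (ler_normD _ _))//.
rewrite mulr_natl mulr2n lerD// (le_trans h2)// ler_wpM2l ?sqrt_gap_ge0//.
exact: sqrt_limit_contractive.
Qed.

Lemma sqrt_limit_sym x y : dot (Y x) y = dot x (Y y).
Proof.
apply/eqP; rewrite -subr_eq0; apply/eqP.
apply: (@near0_eq0 _ _ (`|x| * `|y| *+ 2)) => e e0.
have [n ne] := sqrt_gap_small e0.
have -> : dot (Y x) y - dot x (Y y) =
    dot (Y x - sqrt_iter N n x) y - dot x (Y y - sqrt_iter N n y).
  by rewrite dotBl dotBr (sqrt_iter_sym _ _ _ sN) opprB addrA subrK.
rewrite (le_trans (ler_normB _ _))// mulr2n mulrDr lerD//.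
  rewrite (le_trans (cauchy_schwarz _ _))// mulrA ler_wpM2r//.
  by rewrite (le_trans (YE x n))// ler_wpM2r.
rewrite (le_trans (cauchy_schwarz _ _))// mulrCA ler_wpM2l//.
by rewrite (le_trans (YE y n))// ler_wpM2r.
Qed.

Lemma sqrt_root_pos : bop_le (bop0 H H) (bop_sub (bop_id H) Y).
Proof.
move=> x /=; rewrite dot0l dotBl.
have xr : dot (Y x) x \is Num.real.
  by apply/CrealP; rewrite -dotC -sqrt_limit_sym.
rewrite subr_ge0 (le_trans (real_ler_norm xr))//.
rewrite (le_trans (cauchy_schwarz _ _))// dot_norm expr2 ler_wpM2r//.
exact: sqrt_limit_contractive.
Qed.

Lemma sqrt_root_sq x :
  bop_sub (bop_id H) Y (bop_sub (bop_id H) Y x) = x - N x.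
Proof.
rewrite /= bopB; have e : Y x *+ 2 = N x + Y (Y x).
  by rewrite {1}sqrt_limit_fix -scaler_nat scalerA divff ?pnatr_eq0// scale1r.
have -> : N x = Y x *+ 2 - Y (Y x) by rewrite e addrK.
by rewrite -addrA -opprD mulr2n addrA.
Qed.

End Root.

(** An operator that intertwines N and M intertwines all iterates, hence the
   limits. This gives both the uniqueness of the square root and the relation
   between the two defect operators of a row contraction. *)
Lemma sqrt_limit_intertwine H K (N Y : bop H H) (M Z : bop K K) (X : bop K H) x :
  (forall x n, `|Y x - sqrt_iter N n x| <= sqrt_gap n * `|x|) ->
  (forall x n, `|Z x - sqrt_iter M n x| <= sqrt_gap n * `|x|) ->
  (forall y, N (X y) = X (M y)) ->
  Y (X x) = X (Z x).
Proof.
move=> YE ZE NX; apply/eqP; rewrite -subr_eq0; apply/eqP.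
have [c c0 Xc] := bop_bound X.
apply: (@sqrt_gap_eq0 _ _ (`|X x| + c * `|x|)) => n.
have -> : Y (X x) - X (Z x) = (Y (X x) - sqrt_iter N n (X x))
   - X (Z x - sqrt_iter M n x).
  by rewrite bopB (sqrt_iter_intertwine n x NX) opprB addrA subrK.
rewrite (le_trans (ler_normB _ _))// mulrDr lerD//.
by rewrite (le_trans (Xc _))// mulrCA ler_wpM2l.
Qed.

(** Any positive root B of 1 - N commutes with N, hence with the root 1 - Y built
   above. For commuting positive roots B and D and y = (B - D) x one has
   <B y, y> + <D y, y> = <(B^2 - D^2) x, y> = 0, so B y = D y = 0 and
   |y|^2 = <x, (B - D) y> = 0. *)
Lemma bop_sqrtE H (A N Y : bop H H) :
  contractive N -> (forall x y, dot (N x) y = dot x (N y)) ->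
  (forall x, A x = x - N x) ->
  (forall x n, `|Y x - sqrt_iter N n x| <= sqrt_gap n * `|x|) ->
  forall x, bop_sqrt A x = x - Y x.
Proof.
move=> cN sN AN YE.
have Cpos := sqrt_root_pos sN YE; set Cr := bop_sub _ _ in Cpos.
have Csq x : Cr (Cr x) = x - N x by exact: sqrt_root_sq.
have [Bpos Bsq] : (bop_le (bop0 H H) (bop_sqrt A)) /\
    forall x, bop_sqrt A (bop_sqrt A x) = A x.
  apply: (@the_bopP R _ _ [set B | bop_le (bop0 H H) B /\ forall x, B (B x) = A x]).
  by exists Cr; split => // x; rewrite Csq AN.
set B := bop_sqrt A in Bpos Bsq *.
have NB x : N (B x) = B (N x).
  have h : N = bop_sub (bop_id H) (bop_comp B B) :> (H -> H).
    by apply/funext => z /=; rewrite Bsq AN opprB addrC subrK.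
  by rewrite h /= bopB.
have YB x : Y (B x) = B (Y x) by exact: (sqrt_limit_intertwine _ YE YE NB).
have CB x : Cr (B x) = B (Cr x) by rewrite /= YB bopB.
move=> x; apply/eqP; rewrite -subr_eq0; apply/eqP; rewrite -[x - Y x]/(Cr x).
set y := B x - Cr x.
have e : B y + Cr y = 0.
  by rewrite /y (bopB B) (bopB Cr) CB Bsq Csq AN addrACA -opprD [X in _ - X]addrC subrr.
have : dot (B y) y + dot (Cr y) y = 0 by rewrite -dotDl e dot0l.
have Bg : 0 <= dot (B y) y by have := Bpos y; rewrite /= dot0l.
have Cg : 0 <= dot (Cr y) y by have := Cpos y; rewrite /= dot0l.
move/eqP; rewrite paddr_eq0// => /andP[/eqP By0 /eqP Cy0].
apply: dot_eq0; rewrite {1}/y dotBl.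
rewrite (positive_selfadjoint Bpos) (positive_selfadjoint Cpos).
by rewrite (positive_null Bpos By0) (positive_null Cpos Cy0) dot0r subrr.
Qed.

Lemma bop_sqrtP H (A N : bop H H) :
  contractive N -> (forall x y, dot (N x) y = dot x (N y)) ->
  (forall x, A x = x - N x) ->
  (forall x, bop_sqrt A (bop_sqrt A x) = A x) /\
  (forall x y, dot (bop_sqrt A x) y = dot x (bop_sqrt A y)).
Proof.
move=> cN sN AN; have [Y YE] := sqrt_limit cN.
have bE := bop_sqrtE cN sN AN YE; split=> [x|x y].
  by rewrite !bE AN -(sqrt_root_sq cN YE).
by rewrite !bE dotBl dotBr (sqrt_limit_sym _ YE).
Qed.

Lemma bop_sqrt_intertwine H K (A N : bop H H) (B M : bop K K) (X : bop K H) :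
  contractive N -> (forall x y, dot (N x) y = dot x (N y)) ->
  contractive M -> (forall x y, dot (M x) y = dot x (M y)) ->
  (forall x, A x = x - N x) -> (forall x, B x = x - M x) ->
  (forall x, N (X x) = X (M x)) ->
  forall x, bop_sqrt A (X x) = X (bop_sqrt B x).
Proof.
move=> cN sN cM sM AN BM NX x.
have [Y YE] := sqrt_limit cN; have [Z ZE] := sqrt_limit cM.
rewrite (bop_sqrtE cN sN AN YE) (bop_sqrtE cM sM BM ZE) bopB.
by rewrite (sqrt_limit_intertwine _ YE ZE NX).
Qed.

Section Defect.
Variables (H K : hilbertType C) (A : bop H K).
Hypothesis cA : contractive A.

Lemma contractive_comp_adj : contractive (bop_comp (adj A) A).
Proof.
by move=> x; rewrite (le_trans (contractive_adj cA _))//; exact: cA.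
Qed.

Lemma comp_adj_sym x y :
  dot (bop_comp (adj A) A x) y = dot x (bop_comp (adj A) A y).
Proof. by rewrite /= -adjE -adjEr. Qed.

Lemma defect_sq x : defect A (defect A x) = x - adj A (A x).
Proof.
by have [] := bop_sqrtP contractive_comp_adj comp_adj_sym
  (fun x => erefl : bop_sub (bop_id H) (bop_comp (adj A) A) x = _).
Qed.

Lemma defect_sym x y : dot (defect A x) y = dot x (defect A y).
Proof.
by have [] := bop_sqrtP contractive_comp_adj comp_adj_sym
  (fun x => erefl : bop_sub (bop_id H) (bop_comp (adj A) A) x = _).
Qed.

Lemma dot_defect x y :
  dot (defect A x) (defect A y) = dot x y - dot (A x) (A y).
Proof. by rewrite defect_sym defect_sq dotBr -adjE. Qed.

End Defect.

End SquareRoot.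

(** * Square summable families and row isometries *)

Section SquareSummable.
Variable R : realType.
Local Notation C := R[i].
Implicit Types (I : choiceType) (H K L : hilbertType C).

Lemma has_sumE H I (v : I -> H) l : has_sum v l -> sum v = l.
Proof. by move=> vl; apply: cvg_lim => //; exact: norm_hausdorff. Qed.

Lemma has_sum_unique H I (v : I -> H) l m : has_sum v l -> has_sum v m -> l = m.
Proof. by move=> /has_sumE<- /has_sumE<-. Qed.

Lemma has_sum_bop H K I (A : bop H K) (v : I -> H) l :
  has_sum v l -> has_sum (A \o v) (A l).
Proof.
move=> vl; rewrite /has_sum; have -> : partial_sum (A \o v) = A \o partial_sum v.
  by apply/funext => J /=; rewrite !partial_sumE raddf_sum.
by apply: cvg_comp vl _; exact: bop_continuous.
Qed.

Lemma dot_singler I K (x : hsum I K) i k : dot x (single i k) = dot (x i) k.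
Proof.
have -> : dot x (single i k) = sum (fun m => dot (x m) (single i k m)) by [].
apply: cvg_lim; first exact: norm_hausdorff.
apply: cvg_near_cst; exists [fset i]%fset => // J /=.
rewrite fsub1set => iJ; rewrite partial_sumE (bigD1_seq i) ?fset_uniq//=.
rewrite eqxx big1 ?addr0 => [//|m /negbTE ->]; last by rewrite dot0r.
Qed.

Lemma dot_singlel I K (x : hsum I K) i k : dot (single i k) x = dot k (x i).
Proof. by rewrite dotC dot_singler -dotC. Qed.

Lemma single_total I K : total_family (fun p : I * K => single p.1 p.2).
Proof.
move=> y ty; apply: hsum_inj => i; apply: dot_eq0.
by rewrite -dot_singlel; exact: (ty (i, y i)).
Qed.

Lemma hsum_dot0 I K (x y : hsum I K) :
  (forall i, dot (x i) (y i) = 0) -> dot x y = 0.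
Proof.
move=> xy; have -> : dot x y = sum (fun m => dot (x m) (y m)) by [].
apply: cvg_lim; first exact: norm_hausdorff.
apply: cvg_near_cst; apply: nearW => J.
by rewrite partial_sumE big1.
Qed.

(** The square of the distance to a partial sum is the tail of the sum of the
   squared norms. *)
Lemma has_sum_single I K (x : hsum I K) : has_sum (fun i => single i (x i)) x.
Proof.
apply/cvgrPdist_lt => e e0.
have e20 : 0 < e ^+ 2 by rewrite exprn_gt0.
have /cvgrPdist_lt/(_ _ e20) := @has_sum_dot R I K x x.
apply: filterS => J; rewrite !partial_sumE.
have -> : `|hsum_dot x x - \sum_(i <- J) dot (x i) (x i)| =
    `|x - \sum_(i <- J) single i (x i)| ^+ 2.
  set s := \sum_(i <- J) single i _.
  set S := \sum_(i <- J) dot _ _.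
  have xs : dot x s = S.
    by rewrite dot_sumr; apply: eq_bigr => i _; rewrite dot_singler.
  have ss : dot s s = S.
    rewrite {2}/s dot_sumr /S big_seq [RHS]big_seq; apply: eq_bigr => i iJ.
    rewrite dotC dot_sumr (bigD1_seq i) ?fset_uniq//= dot_single eqxx.
    rewrite big1 ?addr0 => [|j /negbTE ji]; first by rewrite -dotC.
    by rewrite dot_single eq_sym ji.
  have sx : dot s x = S by rewrite dotC xs -ss -dotC.
  have <- : hsum_dot x x - S = `|x - s| ^+ 2.
    by rewrite -dot_norm dotBl !dotBr xs sx ss subrr subr0.
  rewrite ger0_norm//.
  have -> : hsum_dot x x - S = dot (x - s) (x - s).
    by rewrite dotBl !dotBr xs sx ss subrr subr0.
  exact: dot_ge0.
by rewrite ltr_pXn2r ?nnegrE ?(ltW e0).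
Qed.

Section RowIsometry.
Variables (I : choiceType) (H K : hilbertType C) (W : I -> bop H K).
Hypothesis gram : forall i j x y,
  dot (W i x) (W j y) = if i == j then dot x y else 0.

Lemma row_isometry : exists2 V : bop (hsum I H) K,
  isometric V & forall i x, V (single i x) = W i x.
Proof.
have [||V iV VE] := @isometric_extension R (I * H) _ _
    (fun p => single p.1 p.2) (fun p => W p.1 p.2).
- by move=> p q; rewrite dot_single gram.
- exact: single_total.
by exists V => // i x; rewrite -(VE (i, x)).
Qed.

End RowIsometry.

Lemma row_adjE I H K (W : I -> bop H K) (V : bop (hsum I H) K) x i :
  (forall i x, V (single i x) = W i x) -> (adj V x) i = adj (W i) x.
Proof.
move=> VW; apply: dot_extr => y.
by rewrite -dot_singlel -[LHS]adjE VW adjE.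
Qed.

Lemma row_has_sum I H K (W : I -> bop H K) (V : bop (hsum I H) K) (x : hsum I H) :
  (forall i x, V (single i x) = W i x) -> has_sum (fun i => W i (x i)) (V x).
Proof.
move=> VW; have := @has_sum_bop _ _ _ V _ _ (@has_sum_single I H x).
by congr has_sum; apply/funext => i /=; rewrite VW.
Qed.

End SquareSummable.

(** * Operators on the Fock space *)

Section FockOperators.
Variables (R : realType) (I : choiceType).
Local Notation C := R[i].
Local Notation etens := (@etens R I _).
Local Notation creation := (@creation R I).
Local Notation ampl W := (@ampl R I _ _ W).
Implicit Types (H K L : hilbertType C).

Lemma dot_etensr K (x : fock I K) a k : dot x (etens a k) = dot (x a) k.
Proof. exact: dot_singler. Qed.

Lemma dot_etensl K (x : fock I K) a k : dot (etens a k) x = dot k (x a).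
Proof. exact: dot_singlel. Qed.

Lemma dot_etens K (a b : seq I) (h k : K) :
  dot (etens a h) (etens b k) = if a == b then dot h k else 0.
Proof. exact: dot_single. Qed.

Lemma etens_total K : total_family (fun p : seq I * K => etens p.1 p.2).
Proof. exact: single_total. Qed.

Lemma fock_ext K (x y : fock I K) : (forall a, x a = y a) -> x = y.
Proof. exact: hsum_inj. Qed.

Lemma etens_bop K (a : seq I) : exists2 A : bop K (fock I K),
  isometric A & forall k, A k = etens a k.
Proof.
have iA (k l : K) : dot (etens a k) (etens a l) = dot k l by rewrite dot_etens eqxx.
have [|k|A AE] := @bop_of_bounded _ _ _ (etens a : K -> _) 1.
- move=> c x y; apply: fock_ext => b; rewrite hsumDE hsumZE /etens /=.
  by case: eqP => // _; rewrite scaler0 addr0.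
- by rewrite mul1r (norm_of_dot (iA k k)).
by exists A => // x y; rewrite !AE.
Qed.

Lemma etens0 K (a : seq I) : etens a (0 : K) = 0.
Proof. by have [A _ AE] := etens_bop K a; rewrite -!AE bop_0. Qed.

Lemma creation_spec K i :
  isometric (creation K i) /\
  forall a (k : K), creation K i (etens a k) = etens (i :: a) k.
Proof.
pose P := [set S : bop (fock I K) (fock I K) |
  forall a (k : K), S (etens a k) = etens (i :: a) k].
have [||V iV VE] := @isometric_extension R (seq I * K) _ _
    (fun p => etens p.1 p.2) (fun p => etens (i :: p.1) p.2 : fock I K).
- by move=> p q; rewrite !dot_etens eqseq_cons eqxx.
- exact: etens_total.
have PV : P V by move=> a k; rewrite -(VE (a, k)).
have cE : forall a (k : K), creation K i (etens a k) = etens (i :: a) k.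
  by apply: (@the_bopP _ _ _ P); exists V.
split=> // x y; rewrite -(iV x y).
by rewrite !(bop_ext_total (@etens_total K) (fun p => etrans (cE _ _) (esym (VE p)))).
Qed.

Lemma creationE K i a (k : K) : creation K i (etens a k) = etens (i :: a) k.
Proof. by have [] := creation_spec K i. Qed.

Lemma creation_isometric K i : isometric (creation K i).
Proof. by have [] := creation_spec K i. Qed.

Lemma adj_creationE K i x a : (adj (creation K i) x) a = x (i :: a).
Proof.
by apply: dot_extr => k; rewrite -!dot_etensl -adjE creationE.
Qed.

Lemma creation_ortho K i j x y :
  dot (creation K i x) (creation K j y) = if i == j then dot x y else 0.
Proof.
case: eqP => [->|/eqP ij]; first exact: creation_isometric.
rewrite adjE; suff -> : adj (creation K i) (creation K j y) = 0 by rewrite dot0r.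
have := @bop_ext_total R _ _ _ _ (bop_comp (adj (creation K i)) (creation K j))
  (bop0 _ _) (@etens_total K).
apply=> -[b k]; rewrite [LHS]/= creationE; apply: fock_ext => a.
by rewrite adj_creationE /= eqseq_cons (negbTE ij).
Qed.

Lemma creation_nil K i x : (creation K i x) [::] = 0.
Proof.
apply: dot_extr => k; rewrite dot0r -dot_etensl adjEr.
suff -> : adj (creation K i) (etens [::] k) = 0 by rewrite dot0l.
by apply: fock_ext => a; rewrite adj_creationE.
Qed.

Lemma ampl_spec K L (W : bop K L) : isometric W ->
  isometric (ampl W) /\ forall a k, ampl W (etens a k) = etens a (W k).
Proof.
move=> iW; pose P := [set S : bop (fock I K) (fock I L) |
  forall a k, S (etens a k) = etens a (W k)].
have [||V iV VE] := @isometric_extension R (seq I * K) _ _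
    (fun p => etens p.1 p.2) (fun p => etens p.1 (W p.2) : fock I L).
- by move=> p q; rewrite !dot_etens iW.
- exact: etens_total.
have PV : P V by move=> a k; rewrite -(VE (a, k)).
have aE : forall a k, ampl W (etens a k) = etens a (W k).
  by apply: (@the_bopP _ _ _ P); exists V.
split=> // x y; rewrite -(iV x y).
by rewrite !(bop_ext_total (@etens_total K) (fun p => etrans (aE _ _) (esym (VE p)))).
Qed.

Lemma amplE K L (W : bop K L) x a : isometric W -> (ampl W x) a = W (x a).
Proof.
move=> iW; apply: dot_extr => k; rewrite -dot_etensl adjEr.
have -> : adj (ampl W) (etens a k) = etens a (adj W k).
  apply: fock_ext => b; apply: dot_extr => l.
  rewrite -dot_etensl -adjE (ampl_spec iW).2 -dot_etensl !dot_etens.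
  by case: eqP => // _; rewrite adjE.
by rewrite dot_etensl adjEr.
Qed.

End FockOperators.

Section FockSplit.
Variables (R : realType) (I : choiceType) (K : hilbertType R[i]).

(** The creation operators exhaust the orthogonal complement of the vacuum
   component. *)
Lemma fock_split (Y : fock I K) :
  has_sum (fun i => creation K i (adj (creation K i) Y)) (Y - etens [::] (Y [::])).
Proof.
have [W iW WE] := row_isometry (@creation_ortho R I K).
have W0 y : (W y) [::] = 0.
  apply: dot_extr => k; rewrite dot0r -dot_etensl adjEr.
  suff -> : adj W (etens [::] k) = 0 by rewrite dot0l.
  apply: hsum_inj => i; rewrite (row_adjE _ _ WE).
  by apply: fock_ext => a; rewrite adj_creationE.
have YE : Y - etens [::] (Y [::]) = W (adj W Y).
  apply: fock_ext => -[|i a]; first by rewrite W0 hsumBE /= subrr.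
  rewrite hsumBE /= subr0 -!adj_creationE -!(row_adjE _ _ WE).
  by rewrite (isometric_adjK iW).
rewrite YE; have := @row_has_sum _ _ _ _ _ W (adj W Y) WE.
by congr (has_sum _ _); apply/funext => i; rewrite (row_adjE _ _ WE).
Qed.

End FockSplit.

(** * Row isometries and the Wold decomposition *)

Section Wold.
Variables (R : realType) (I : choiceType).
Local Notation C := R[i].
Local Notation etens := (@etens R I _).
Local Notation creation := (@creation R I).
Implicit Types (H K L F : hilbertType C).

Definition row_isometric K (V : I -> bop K K) : Prop :=
  forall i j x y, dot (V i x) (V j y) = if i == j then dot x y else 0.

(** The closed linear span of the ranges of the V i, described by duality. *)
Definition in_row_range K (V : I -> bop K K) (m : K) : Prop :=
  forall z, (forall i, adj (V i) z = 0) -> dot m z = 0.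

(** On that span <m, z> is the sum of the <V_i^* m, V_i^* z>. *)
Lemma in_row_range_dot K (V : I -> bop K K) m z : row_isometric V ->
  in_row_range V m -> (forall i, dot (adj (V i) m) (adj (V i) z) = 0) ->
  dot m z = 0.
Proof.
move=> rV mV mz; have [W iW WE] := row_isometry rV.
have /mV : forall i, adj (V i) (z - W (adj W z)) = 0.
  move=> i; rewrite bopB -!(row_adjE _ _ WE) isometric_adjK//.
  by rewrite (row_adjE _ _ WE) subrr.
rewrite dotBr adjEr (_ : dot (adj W m) _ = 0) ?subr0//.
by apply: hsum_dot0 => i; rewrite !(row_adjE _ _ WE).
Qed.

Lemma word_op_gram K (V : I -> bop K K) k (a b : k.-tuple I) x y :
  row_isometric V ->
  dot (word_op V a x) (word_op V b y) = if a == b then dot x y else 0.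
Proof.
move=> rV; rewrite -val_eqE /=; case: a b => a /= ak [b /= bk].
elim: k a b ak bk => [|k IH] [|i a] [|j b] //= ak bk.
rewrite rV eqseq_cons; case: eqP => //= _; exact: IH.
Qed.

(** The isometric half of the Wold decomposition: if w embeds F into M with
   range orthogonal to all V_i M, then the subspaces V_a (w F) are pairwise
   orthogonal, so e_a (x) k |-> V_a (w k) is an isometry that turns the creation
   operators into V. *)
Section Embedding.
Variables (K F : hilbertType C) (V : I -> bop K K) (M : csub K) (w : bop F K).
Hypothesis rV : row_isometric V.
Hypothesis MV : invariant_under V (csub_set M).
Hypothesis iw : isometric w.
Hypothesis Mw : forall k, csub_set M (w k).
Hypothesis Vw : forall i k m, csub_set M m -> dot (V i m) (w k) = 0.

Let Mword a k : csub_set M (word_op V a (w k)).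
Proof. by elim: a => [|i a IH] //=; exact: MV. Qed.

Lemma wold_embedding : exists G : bop (fock I F) K,
  [/\ isometric G, forall a k, G (etens a k) = word_op V a (w k),
      forall i x, G (creation F i x) = V i (G x) &
      forall x, csub_set M (G x)].
Proof.
have gram a b x y : dot (word_op V a (w x)) (word_op V b (w y)) =
    if a == b then dot x y else 0.
  elim: a b => [|i a IH] [|j b] /=.
  - exact: iw.
  - by apply: dot_flip; exact: Vw.
  - exact: Vw.
  by rewrite rV eqseq_cons IH; case: eqP.
have [||G iG GE] := @isometric_extension R (seq I * F) (fock I F) K
    (fun p => etens p.1 p.2) (fun p => word_op V p.1 (w p.2)).
- by move=> p q; rewrite dot_etens gram.
- exact: etens_total.
exists G; split => //.
- by move=> a k; rewrite -(GE (a, k)).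
- move=> i; have := @bop_ext_total R _ _ _ _ (bop_comp G (creation F i))
    (bop_comp (V i) G) (@etens_total R I F).
  apply=> -[a k]; rewrite /= creationE.
  by rewrite -[etens (i :: a) k]/((fun p => etens p.1 p.2) (i :: a, k)) GE (GE (a, k)).
move=> x; apply: ortho2 => y yM; rewrite adjE.
suff -> : adj G y = 0 by rewrite dot0r.
apply: (@etens_total R I F) => -[a k]; rewrite -adjE (GE (a, k)).
by apply: dot_flip; apply: yM; exact: Mword.
Qed.

End Embedding.

Lemma adj_intertwine K F (V : I -> bop K K) (G : bop (fock I F) K) i x :
  (forall i x, G (creation F i x) = V i (G x)) ->
  adj (creation F i) (adj G x) = adj G (adj (V i) x).
Proof.
by move=> GV; apply: dot_extr => y; rewrite -!adjE GV.
Qed.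

(** The Fourier coefficients of V_i x are those of x moved by one letter, as soon
   as V_i x has no component in the wandering subspace itself. *)
Lemma adj_embedding_shift K F (V : I -> bop K K) (G : bop (fock I F) K) i x :
  row_isometric V ->
  (forall i x, G (creation F i x) = V i (G x)) ->
  (forall k, dot (V i x) (G (etens [::] k)) = 0) ->
  adj G (V i x) = creation F i (adj G x).
Proof.
move=> rV VG V0.
apply/eqP; rewrite -subr_eq0; apply/eqP; apply: (@etens_total R I) => -[[|l a] k].
  rewrite dotBr -adjE (dot_flip (V0 k)) sub0r.
  by rewrite dot_etensl creation_nil dot0r oppr0.
rewrite dotBr -adjE -creationE [G _]VG rV creation_ortho adjE.
by case: eqP => _; rewrite subrr.
Qed.

(** The residual part of M lies in the residual part of K. If m in M has no
   coefficient along G, then m is in the span of the V_i M, which kills its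
   vacuum coefficient along A, and each V_i^* m is again such a vector, which
   gives the other coefficients by induction on the word. *)
Lemma shift_part_vanish K F L (V : I -> bop K K) (M : csub K)
    (G : bop (fock I F) K) (A : bop (fock I L) K) :
  (forall i x, G (creation F i x) = V i (G x)) ->
  (forall i x, A (creation L i x) = V i (A x)) ->
  (forall i k, adj (V i) (A (etens [::] k)) = 0) ->
  (forall m, csub_set M m -> (forall k, dot (G (etens [::] k)) m = 0) ->
    in_row_range V m /\ forall i, csub_set M (adj (V i) m)) ->
  forall m, csub_set M m -> adj G m = 0 -> adj A m = 0.
Proof.
move=> GV AV A0 MG m Mm Gm; apply: fock_ext => a.
elim: a m Mm Gm => [|i a IH] m Mm Gm.
all: have [mV mM] := MG m Mm (fun k => etrans (adjE _ _ _) (etrans (congr1 _ Gm) (dot0r _))).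
  apply: dot_extr => k; rewrite dot0r -dot_etensl -adjE; apply: dot_flip.
  by apply: mV => i; exact: A0.
rewrite -adj_creationE (adj_intertwine _ _ AV) IH//.
by rewrite -(adj_intertwine _ _ GV) Gm bop_0.
Qed.

Section WanderingSubspace.
Variables (K : hilbertType C) (V : I -> bop K K) (M : csub K).
Hypothesis rV : row_isometric V.
Hypothesis MV : invariant_under V (csub_set M).

Definition wandering : csub K := Defs.ortho [set y |
  csub_set (Defs.ortho (csub_set M)) y \/
  exists i m, csub_set M m /\ y = V i m].

Lemma wandering_sub x : csub_set wandering x -> csub_set M x.
Proof. by move=> wx; apply: ortho2 => y yM; apply: wx; left. Qed.

Lemma wandering_ortho i m x :
  csub_set M m -> csub_set wandering x -> dot (V i m) x = 0.
Proof. by move=> Mm wx; apply/dot_flip/wx; right; exists i, m. Qed.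

(** The span of the V_i M is the range of the closed subspace of families with
   entries in M under the isometry W attached to V. For m orthogonal to the
   wandering subspace, the difference x between m and its projection on that
   range is wandering, hence orthogonal to m, hence zero. *)
Lemma wandering_complete m : csub_set M m ->
  (forall x, csub_set wandering x -> dot x m = 0) ->
  in_row_range V m /\ forall i, csub_set M (adj (V i) m).
Proof.
move=> Mm mw; have [W iW WE] := row_isometry rV.
pose Mh : csub (hsum I K) := Defs.ortho [set y |
  exists i z, csub_set (Defs.ortho (csub_set M)) z /\ y = single i z].
have MhE y : csub_set Mh y <-> forall i, csub_set M (y i).
  split=> [hy i|hy _ [i [z [zM ->]]]]; last by rewrite dot_singler; apply/dot_flip/zM.
  by apply: ortho2 => z zM; rewrite -dot_singler; apply: hy; exists i, z.
have [p /MhE Mp pE] := proj_ex Mh (adj W m).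
pose x := m - W p.
have MW : csub_set M (W p).
  apply: ortho2 => z zM; rewrite adjE; apply: hsum_dot0 => i.
  by rewrite (row_adjE _ _ WE) -adjE; apply/dot_flip/zM/MV.
have xE : adj W x = adj W m - p by rewrite bopB isometric_adjK.
have wx : csub_set wandering x.
  move=> y [yM|[i [m' [Mm' ->]]]].
    by rewrite dotBl !(dot_flip (yM _ _))// subrr.
  rewrite -WE adjEr xE; apply: pE; apply/MhE => j /=.
  by case: eqP => // _; exact: csub0.
have x0 : x = 0.
  apply: dot_eq0; rewrite {2}/x dotBr mw// sub0r adjEr xE pE ?oppr0//.
  exact/MhE.
have mE : m = W p by apply/eqP; rewrite -subr_eq0 -/x x0.
split=> [z Vz|i]; last by rewrite mE -(row_adjE _ _ WE) isometric_adjK.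
rewrite mE adjE; apply: hsum_dot0 => i.
by rewrite (row_adjE _ _ WE) Vz dot0r.
Qed.

End WanderingSubspace.

Lemma adj_word_nil H (T : I -> bop H H) x : adj (word_op T [::]) x = x.
Proof. by apply: (adj_unique (B := id)). Qed.

Lemma adj_word_cons H (T : I -> bop H H) i a x :
  adj (word_op T (i :: a)) x = adj (word_op T a) (adj (T i) x).
Proof. exact: adj_comp. Qed.

Section Coisometric.
Variables (K L : hilbertType C) (V : I -> bop K K) (A : bop (fock I L) K).
Hypothesis rV : row_isometric V.
Hypothesis AV : forall i x, A (creation L i x) = V i (A x).
Hypothesis A0 : forall m, (forall k, dot (A (etens [::] k)) m = 0) ->
  in_row_range V m.

Lemma null_in_row_range x : adj A x = 0 -> in_row_range V x.
Proof.
by move=> Ax; apply: A0 => k; rewrite adjE Ax dot0r.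
Qed.

(** A vector with no Fourier coefficients is in the span of the ranges of the
   words of any given length k. *)
Lemma null_words_dot k x z : adj A x = 0 ->
  (forall a : k.-tuple I, adj (word_op V a) z = 0) -> dot x z = 0.
Proof.
elim: k x z => [|k IH] x z Ax zV.
  have := zV [tuple]; rewrite (adj_unique (B := id))// => ->.
  by rewrite dot0r.
apply: (in_row_range_dot rV (null_in_row_range Ax)) => i; apply: IH.
  by rewrite -(adj_intertwine _ _ AV) Ax bop_0.
by move=> a; rewrite -adj_comp; exact: (zV [tuple of i :: a]).
Qed.

(** On the residual part all powers of the row are coisometric; this is what
   complete non-coisometry excludes on H. *)
Lemma null_words_sum k x : adj A x = 0 ->
  has_sum (fun a : k.-tuple I => `|adj (word_op V a) x| ^+ 2 : C) (`|x| ^+ 2).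
Proof.
move=> Ax; pose Vk (a : k.-tuple I) := word_op V a.
have [W iW WE] := @row_isometry R _ _ _ Vk (fun a b x y => word_op_gram a b x y rV).
pose y := adj W x.
have yE a : y a = adj (Vk a) x by exact: row_adjE.
have <- : dot y y = `|x| ^+ 2.
  have : dot x (x - W y) = 0.
    apply: (@null_words_dot k) => // a; rewrite -[word_op V a]/(Vk a).
    by rewrite bopB -!(row_adjE _ _ WE) isometric_adjK// subrr.
  by rewrite dotBr adjEr dot_norm => /eqP; rewrite subr_eq0 => /eqP.
have := @has_sum_dot R _ _ y y; congr (has_sum _ _).
by apply/funext => a; rewrite yE dot_norm.
Qed.

End Coisometric.

End Wold.

(** * Closed ranges and restrictions *)

Section Restriction.
Variable R : realType.
Local Notation C := R[i].
Implicit Types (I : choiceType) (H K L F : hilbertType C).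

Lemma crange_ortho H K (A : bop H K) y d :
  (forall x, dot (A x) y = 0) -> csub_set (crange A) d -> dot d y = 0.
Proof.
move=> Ay; have cl := @csub_closed _ _ (Defs.ortho [set y]).
have sub : range A `<=` csub_set (Defs.ortho [set y]).
  by move=> _ [x _ <-] _ ->; exact: Ay.
move=> /(closure_subset sub); rewrite -(closure_id _).1// => h; exact: h.
Qed.

Lemma crange_mem H K (A : bop H K) x : csub_set (crange A) (A x).
Proof. by apply: subset_closure; exists x. Qed.

Lemma to_crange_total H K (A : bop H K) : total_family (to_crange A).
Proof.
move=> y ty; apply: dot_eq0; rewrite dot_subspace.
apply: crange_ortho (subspaceP y) => x.
by have := ty x; rewrite dot_subspace.
Qed.

Lemma to_crangeP H K (A : bop H K) a x y :
  to_crange A (a *: x + y) = a *: to_crange A x + to_crange A y.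
Proof. by apply: val_inj; rewrite /= bopD bopZ. Qed.

(** The intertwining relation between the defect operators is used in this form:
   it makes T and its adjoint exchange the two defect spaces. *)
Lemma crange_map H K (X : bop H K) (A : bop K K) (B : bop H H) d :
  (forall h, A (X h) = X (B h)) -> csub_set (crange B) d ->
  csub_set (crange A) (X d).
Proof.
move=> AX Bd; apply: ortho2 => y yA; rewrite adjE.
apply: crange_ortho Bd => h; rewrite -adjE -AX.
by apply/dot_flip/yA; exact: crange_mem.
Qed.

Lemma subspace_restr H K (X : bop H K) (M : csub H) (N : csub K) :
  (forall m, csub_set M m -> csub_set N (X m)) ->
  exists t : bop M N, forall m, subspace_val (t m) = X (subspace_val m).
Proof.
move=> MN; have [c c0 Xc] := bop_bound X.
have XM (m : M) : X (subspace_val m) \in csub_pred N.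
  by apply/mem_set/MN; exact: subspaceP.
have [||t tE] := @bop_of_bounded R M N (fun m => Subspace (XM m)) c.
- by move=> a x y; apply: val_inj; rewrite /= bopD bopZ.
- by move=> m; rewrite !subspace_norm; exact: Xc.
by exists t => m; rewrite tE.
Qed.

Lemma single_bop I K (i : I) : exists2 A : bop K (hsum I K),
  isometric A & forall k, A k = single i k.
Proof.
have iA (k l : K) : dot (single i k) (single i l) = dot k l by rewrite dot_single eqxx.
have [|k|A AE] := @bop_of_bounded _ _ _ (single i : K -> _) 1.
- move=> c x y; apply: hsum_inj => b; rewrite hsumDE hsumZE /=.
  by case: eqP => // _; rewrite scaler0 addr0.
- by rewrite mul1r (norm_of_dot (iA k k)).
by exists A => // x y; rewrite !AE.
Qed.

End Restriction.

(** * Row contractions and their defect operators *)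

Section RowContraction.
Variables (R : realType) (I : choiceType) (H : hilbertType R[i]).
Variable T : I -> bop H H.
Hypothesis rT : row_contraction T.
Local Notation C := R[i].

Lemma row_contraction_bessel h (J : {fset I}) :
  \sum_(i <- J) `|adj (T i) h| ^+ 2 <= `|h| ^+ 2.
Proof.
have [Q QT Q1] := rT.
apply: (@le_trans _ _ (dot (Q h) h)); last by rewrite -dot_norm; exact: Q1.
rewrite -subr_ge0.
apply: (@cvgC_ge0 _ _ totally (fun L =>
    dot (partial_sum (fun i => T i (adj (T i) h)) L) h
    - \sum_(i <- J) `|adj (T i) h| ^+ 2)); last first.
  apply: cvgB; last exact: cvg_cst.
  exact: (continuous_cvg _ (@dot_continuous _ _ h (Q h)) (QT h)).
exists J => // L /= JL.
have -> : dot (partial_sum (fun i => T i (adj (T i) h)) L) h =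
    \sum_(i <- L) `|adj (T i) h| ^+ 2.
  rewrite dotC partial_sumE dot_sumr rmorph_sum; apply: eq_bigr => i _ /=.
  by rewrite -dotC adjE dot_norm.
rewrite (big_fsetID _ (mem J)) /=.
have -> : [fset i in L | i \in J]%fset = J.
  apply/fsetP => i; rewrite !inE /= andbC.
  by case: (boolP (i \in J)) => //= /(fsubsetP JL) ->.
by rewrite addrC addrK sumr_ge0// => i _; rewrite exprn_ge0.
Qed.

(** The row operator is the adjoint of the column h |-> (T_i^* h), which is
   bounded by Bessel's inequality. *)
Lemma row_op_spec : [/\ contractive (row_op T),
  forall i h, row_op T (single i h) = T i h &
  forall h : hsum I H, has_sum (fun i => T i (h i)) (row_op T h)].
Proof.
have sq h : (fun i => adj (T i) h) \in @sqsum_pred R I H.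
  by apply/asboolP; exists (`|h| ^+ 2) => J; exact: row_contraction_bessel.
have cB h : `|HSum (sq h)| <= 1 * `|h|.
  by rewrite mul1r; apply: hsum_norm_le => // J; exact: row_contraction_bessel.
have [|Cl ClE] := @bop_of_bounded _ _ _ (fun h => HSum (sq h)) 1 _ cB.
  by move=> a x y; apply: hsum_inj => i; rewrite hsumDE hsumZE /= bopD bopZ.
have AE i h : adj Cl (single i h) = T i h.
  by apply: dot_extr => x; rewrite -adjE ClE dot_singler /= adjEr.
have sumA h := @row_has_sum _ _ _ _ T (adj Cl) h AE.
have sumT : forall h : hsum I H, has_sum (fun i => T i (h i)) (row_op T h).
  apply: (@the_bopP R _ _ [set A | forall h : hsum I H, has_sum (fun i => T i (h i)) (A h)]).
  by exists (adj Cl).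
have rE h : row_op T h = adj Cl h := has_sum_unique (sumT h) (sumA h).
split=> // [h|i h]; rewrite rE//.
by apply: contractive_adj => x; rewrite ClE -[leRHS]mul1r.
Qed.

Let Rw := row_op T.
Let Dr := defect_row T.
Let Ds := defect_star T.

Lemma adj_row_opE h i : (adj Rw h) i = adj (T i) h.
Proof. by have [_ TE _] := row_op_spec; exact: row_adjE. Qed.

Lemma row_square_op h : the_bop (row_square T) h = Rw (adj Rw h).
Proof.
have [_ _ sT] := row_op_spec.
have QT : row_square T (the_bop (row_square T)).
  by apply: the_bopP; have [Q QT _] := rT; exists Q.
apply: has_sum_unique (QT h) _; have := sT (adj Rw h).
by congr has_sum; apply/funext => i; rewrite adj_row_opE.
Qed.

Let cRw : contractive Rw. Proof. by have [] := row_op_spec. Qed.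

Let cN : contractive (bop_comp Rw (adj Rw)).
Proof.
by move=> x /=; rewrite (le_trans (cRw _))//; exact: (contractive_adj cRw).
Qed.

Let sN x y : dot (bop_comp Rw (adj Rw) x) y = dot x (bop_comp Rw (adj Rw) y).
Proof. by rewrite /= [LHS]adjE [RHS]adjEr. Qed.

Let starN x : bop_sub (bop_id H) (the_bop (row_square T)) x =
  x - bop_comp Rw (adj Rw) x.
Proof. by rewrite /= row_square_op. Qed.

Lemma defect_star_sq x : Ds (Ds x) = x - Rw (adj Rw x).
Proof. by have [h _] := bop_sqrtP cN sN starN; rewrite h starN. Qed.

Lemma defect_star_sym x y : dot (Ds x) y = dot x (Ds y).
Proof. by have [_ h] := bop_sqrtP cN sN starN; exact: h. Qed.

Lemma dot_defect_star x y :
  dot (Ds x) (Ds y) = dot x y - dot (adj Rw x) (adj Rw y).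
Proof. by rewrite defect_star_sym defect_star_sq dotBr adjEr. Qed.

Lemma defect_row_sym x y : dot (Dr x) y = dot x (Dr y).
Proof. exact: defect_sym. Qed.

Lemma dot_defect_row x y : dot (Dr x) (Dr y) = dot x y - dot (Rw x) (Rw y).
Proof. exact: dot_defect. Qed.

(** The relation (1 - TT^* ) T = T (1 - T^*T) passes to the square roots. *)
Lemma defect_star_row x : Ds (Rw x) = Rw (Dr x).
Proof.
apply: (bop_sqrt_intertwine cN sN (contractive_comp_adj cRw) (@comp_adj_sym _ _ _ Rw)
  starN) => //.
Qed.

Lemma defect_row_star x : Dr (adj Rw x) = adj Rw (Ds x).
Proof.
apply: dot_extr => y.
by rewrite -defect_row_sym -!adjE -defect_star_row defect_star_sym.
Qed.

End RowContraction.

(** * The isometric dilation and the characteristic function *)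

(** An orthogonal sum given by its two isometric embeddings, so that the space
   itself can remain arbitrary. *)
Record orthogonal_sum (R : realType) (H L K : hilbertType R[i])
    (j : bop H K) (J : bop L K) : Prop := OrthogonalSum {
  osum_j : isometric j ;
  osum_J : isometric J ;
  osum_jJ : forall h f, dot (j h) (J f) = 0 ;
  osum_total : forall x, (forall h, dot (j h) x = 0) ->
    (forall f, dot (J f) x = 0) -> x = 0 }.

Section OrthogonalSum.
Variables (R : realType) (H L : hilbertType R[i]).

Lemma orthogonal_sum_ex : exists (K : hilbertType R[i]) (j : bop H K) (J : bop L K),
  orthogonal_sum j J.
Proof.
have [|f|J JE] := @bop_of_bounded R L (hprod H L) (fun f => hpair 0 f) 1.
- by move=> a x y; congr hpair; rewrite /= scaler0 addr0.
- by rewrite mul1r (le_trans (hprod_norm_le _))//= normr0 add0r.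
have [|f|j jE] := @bop_of_bounded R H (hprod H L) (fun f => hpair f 0) 1.
- by move=> a x y; congr hpair; rewrite /= scaler0 addr0.
- by rewrite mul1r (le_trans (hprod_norm_le _))//= normr0 addr0.
exists (hprod H L), j, J; split.
- by move=> x y; rewrite !jE dot_hprod /= dot0l addr0.
- by move=> x y; rewrite !JE dot_hprod /= dot0l add0r.
- by move=> x y; rewrite jE JE dot_hprod /= dot0l dot0r addr0.
move=> x jx Jx; apply: dot_eq0; have := jx x.1; have := Jx x.2.
by rewrite jE JE !dot_hprod /= !dot0l add0r addr0 => -> ->; rewrite addr0.
Qed.

Variables (K : hilbertType R[i]) (j : bop H K) (J : bop L K).
Hypothesis jJ : orthogonal_sum j J.

Lemma osum_adj_jJ f : adj j (J f) = 0.
Proof. by apply: dot_extr => h; rewrite -adjE (osum_jJ jJ) dot0r. Qed.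

Lemma osum_adj_Jj h : adj J (j h) = 0.
Proof.
by apply: dot_extr => f; rewrite -adjE dot0r; apply: dot_flip; exact: osum_jJ.
Qed.

Lemma osum_split x : x = j (adj j x) + J (adj J x).
Proof.
apply/eqP; rewrite -subr_eq0; apply/eqP; apply: (osum_total jJ) => h.
  rewrite adjE bopB bopD (isometric_adjK (osum_j jJ)) osum_adj_jJ addr0 subrr.
  exact: dot0r.
rewrite adjE bopB bopD (isometric_adjK (osum_J jJ)) osum_adj_Jj add0r subrr.
exact: dot0r.
Qed.

Lemma osum_dot x y :
  dot x y = dot (adj j x) (adj j y) + dot (adj J x) (adj J y).
Proof. by rewrite {1}(osum_split y) dotDr !adjEr. Qed.

Lemma osum_ext x y : adj j x = adj j y -> adj J x = adj J y -> x = y.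
Proof. by move=> xy1 xy2; rewrite (osum_split x) xy1 xy2 -osum_split. Qed.

Lemma osum_pair h f : adj j (j h + J f) = h /\ adj J (j h + J f) = f.
Proof.
rewrite !bopD (isometric_adjK (osum_j jJ)) (isometric_adjK (osum_J jJ)).
by rewrite osum_adj_jJ osum_adj_Jj addr0 add0r.
Qed.

End OrthogonalSum.

(** An isometric dilation of the row T on K together with the data of its
   functional model: j embeds H with V_i^* j = j T_i^*, J embeds F^2 (x) E as
   the complement of H, and the adjoint of G is the Fourier transform of K along
   the wandering subspace of V, whose restriction to F^2 (x) E is Theta. *)
Record dilates (R : realType) (I : choiceType) (H E Es K : hilbertType R[i])
    (T : I -> bop H H) (Theta : bop (fock I E) (fock I Es)) (V : I -> bop K K)
    (j : bop H K) (J : bop (fock I E) K) (G : bop (fock I Es) K) : Prop := Dilates {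
  dil_row : row_isometric V ;
  dil_j : isometric j ;
  dil_J : isometric J ;
  dil_jJ : forall h f, dot (j h) (J f) = 0 ;
  dil_onto : forall x, adj J x = 0 -> exists h, x = j h ;
  dil_adj : forall i h, adj (V i) (j h) = j (adj (T i) h) ;
  dil_VJ : forall i f, J (creation E i f) = V i (J f) ;
  dil_G : isometric G ;
  dil_VG : forall i f, G (creation Es i f) = V i (G f) ;
  dil_G0 : forall i k, adj (V i) (G (etens [::] k)) = 0 ;
  dil_Theta : forall f, adj G (J f) = Theta f ;
  dil_cnc : cnc T -> forall x, adj G x = 0 -> adj J x = 0 -> x = 0 }.

Section Dilation.
Variables (R : realType) (I : choiceType) (H : hilbertType R[i]).
Variable T : I -> bop H H.
Hypothesis rT : row_contraction T.
Local Notation C := R[i].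
Local Notation etens := (@etens R I _).
Local Notation creation := (@creation R I).
Local Notation ampl W := (@ampl R I _ _ W).
Local Notation charfun_symbol := (@charfun_symbol R I H T).
Local Notation Rw := (row_op T).
Local Notation Dr := (defect_row T).
Local Notation Ds := (defect_star T).
Local Notation E := (Drow T).
Local Notation Es := (Dstar T).

Lemma row_op_single i h : Rw (single i h) = T i h.
Proof. by have [_ ->] := row_op_spec rT. Qed.

Lemma row_op_crange (d : E) : csub_set (crange Ds) (Rw (subspace_val d)).
Proof. exact: crange_map (defect_star_row rT) (subspaceP d). Qed.

Lemma row_adj_restr_ex : exists t : bop Es E,
  forall d, subspace_val (t d) = adj Rw (subspace_val d).
Proof.
apply: subspace_restr => m Mm.
exact: crange_map (defect_row_star rT) Mm.
Qed.

Section OnSum.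
Variables (K : hilbertType C) (j : bop H K) (J : bop (fock I E) K).
Hypothesis jJ : orthogonal_sum j J.

(** The Schaeffer form of the dilation:
   V_i (h, f) = (T_i h, 1 (x) Delta_T (e_i (x) h) + S_i f). *)
Lemma dilation_row_ex : exists V : I -> bop K K, forall i x,
  adj j (V i x) = T i (adj j x) /\
  adj J (V i x) = etens [::] (to_crange Dr (single i (adj j x)))
                  + creation E i (adj J x).
Proof.
suff /choice[V VE] : forall i, exists Vi : bop K K, forall x : K,
  adj j (Vi x) = T i (adj j x) /\
  adj J (Vi x) = etens [::] (to_crange Dr (single i (adj j x)))
                  + creation E i (adj J x).
  by exists V.
move=> i; have [A iA AE] := single_bop H i; have [B iB BE] := @etens_bop R I E [::].
have [f fE] : exists f : K -> K, forall x, adj j (f x) = T i (adj j x) /\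
  adj J (f x) = etens [::] (to_crange Dr (single i (adj j x)))
                  + creation E i (adj J x).
  by eexists => x; exact: osum_pair.
have [|x|V VE] := @bop_of_bounded R K K f 1; last first.
- by exists V => x; rewrite VE; exact: fE.
- rewrite mul1r (norm_of_dot (_ : _ = dot x x))//.
  rewrite !(osum_dot jJ) (fE x).1 (fE x).2.
  rewrite dotDl !dotDr -!BE iB dot_subspace /= dot_defect_row//.
  rewrite !row_op_single dot_single eqxx !BE creation_isometric.
  rewrite dot_etensl creation_nil dot0r dot_etensr creation_nil dot0l addr0 add0r.
  by rewrite addrA [_ + (_ - _)]addrC subrK.
move=> a x y; apply: (osum_ext jJ).
  by rewrite (bopD (adj j)) (bopZ (adj j)) !(fE _).1 !bopD !bopZ.
rewrite [RHS]bopD (bopZ _ a (f x)) !(fE _).2.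
rewrite -!AE -!BE bopD bopZ bopD bopZ to_crangeP !bopD !bopZ addrACA.
by rewrite -scalerDr.
Qed.

(** The wandering subspace of the dilation is the range of
   d |-> (Delta_* d, - 1 (x) T^* d), a copy of the defect space of T^*. *)
Lemma dilation_w_ex (t : bop Es E) : exists w : bop Es K, forall d,
  adj j (w d) = Ds (subspace_val d) /\ adj J (w d) = - etens [::] (t d).
Proof.
have [B iB BE] := @etens_bop R I E [::].
have [c c0 tc] := bop_bound t; have [c' c'0 Dc] := bop_bound Ds.
pose f (d : Es) := j (Ds (subspace_val d)) + J (- etens [::] (t d)).
have fE d := osum_pair jJ (Ds (subspace_val d)) (- etens [::] (t d)).
have [|d|w wE] := @bop_of_bounded R Es K f (c' + c); last first.
- by exists w => d; rewrite wE; exact: fE.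
- rewrite (le_trans (ler_normD _ _))// mulrDl lerD//.
    by rewrite (isometric_norm (osum_j jJ)) (le_trans (Dc _))// subspace_norm.
  by rewrite (isometric_norm (osum_J jJ)) normrN -BE isometric_norm// tc.
move=> a x y; rewrite /f -!BE /= !bopD !bopZ !bopN !bopD !bopZ opprD.
by rewrite scalerDr scalerN addrACA.
Qed.

Section WithMaps.
Variables (V : I -> bop K K) (t : bop Es E) (w : bop Es K).
Hypothesis VE : forall i x,
  adj j (V i x) = T i (adj j x) /\
  adj J (V i x) = etens [::] (to_crange Dr (single i (adj j x)))
                  + creation E i (adj J x).
Hypothesis tE : forall d, subspace_val (t d) = adj Rw (subspace_val d).
Hypothesis wE : forall d,
  adj j (w d) = Ds (subspace_val d) /\ adj J (w d) = - etens [::] (t d).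

Lemma dilation_row : row_isometric V.
Proof.
move=> i k x y; rewrite !(osum_dot jJ) !(VE _ _).1 !(VE _ _).2.
rewrite dotDl !dotDr dot_etens eqxx.
rewrite dot_subspace /= dot_defect_row// !row_op_single dot_single creation_ortho.
rewrite dot_etensl creation_nil dot0r dot_etensr creation_nil dot0l addr0 add0r.
rewrite addrA [_ + (_ - _)]addrC subrK.
by case: eqP => // _; rewrite addr0.
Qed.

Lemma dilation_VJ i f : J (creation E i f) = V i (J f).
Proof.
apply: (osum_ext jJ); rewrite ?(VE _ _).1 ?(VE _ _).2 !(osum_adj_jJ jJ) ?bop_0//.
rewrite !(isometric_adjK (osum_J jJ)).
have -> : to_crange Dr (single i 0) = 0.
  have [A _ AE] := single_bop H i.
  by apply: val_inj; rewrite /= -AE !bop_0.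
by rewrite etens0 add0r.
Qed.

(** This is Delta_* T = T Delta_T. *)
Lemma dilation_wandering i k x : dot (V i x) (w k) = 0.
Proof.
rewrite (osum_dot jJ) (VE _ _).1 (VE _ _).2 (wE _).1 (wE _).2.
rewrite dotNr dotDl dot_etens eqxx dot_etensr creation_nil.
rewrite dot0l addr0 dot_subspace /= tE -row_op_single -defect_star_sym//.
by rewrite defect_star_row// -adjE subrr.
Qed.

Lemma dilation_w_isometric : isometric w.
Proof.
move=> x y; rewrite (osum_dot jJ) !(wE _).1 !(wE _).2 dotNl dotNr opprK dot_etens eqxx.
by rewrite dot_defect_star// !dot_subspace !tE subrK.
Qed.

Lemma dilation_adj_j i h : adj (V i) (j h) = j (adj (T i) h).
Proof.
apply: dot_extr => x; rewrite -adjE !(osum_dot jJ) (VE _ _).1.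
rewrite !(isometric_adjK (osum_j jJ)) !(osum_adj_Jj jJ) !dot0r !addr0.
by rewrite adjE.
Qed.

Lemma dilation_adj_J i d :
  adj (V i) (J (etens [::] d)) = j (Dr (subspace_val d) i).
Proof.
apply: dot_extr => x; rewrite -adjE !(osum_dot jJ) (VE _ _).2.
rewrite (isometric_adjK (osum_J jJ)) (isometric_adjK (osum_j jJ)).
rewrite (osum_adj_Jj jJ) (osum_adj_jJ jJ) !dot0r add0r addr0.
rewrite dotDl dot_etens eqxx dot_etensr creation_nil dot0l addr0.
by rewrite dot_subspace /= defect_row_sym// dot_singlel.
Qed.

(** Let m = (h, f) be orthogonal to the wandering subspace, which says
   Delta_* h = T f_0 for the vacuum component f_0 of f, and let z = (h', f') be
   killed by all V_i^*, which says T^* h' = - Delta_T f'_0 and f' = 1 (x) f'_0.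
   Writing <h, h'> = <Delta_* h, Delta_* h'> + <T^* h, T^* h'> and exchanging the
   defect operators gives <h, h'> = - <f_0, f'_0>, that is <m, z> = 0. *)
Lemma dilation_complete m : (forall k, dot (w k) m = 0) -> in_row_range V m.
Proof.
move=> wm z Vz.
set h := adj j m; set f := adj J m; set h' := adj j z; set f' := adj J z.
have e1 : Ds h = Rw (subspace_val (f [::])).
  set u := Rw _; apply/eqP; rewrite -subr_eq0; apply/eqP/dot_eq0.
  have Mu : Ds h - u \in csub_pred (crange Ds).
    apply/mem_set; rewrite -[Ds h - u]addrC -scaleN1r; apply: csubP.
      exact: row_op_crange.
    exact: crange_mem.
  have := wm (Subspace Mu); rewrite (osum_dot jJ) (wE _).1 (wE _).2.
  rewrite dotNl dot_etensl -/h -/f.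
  rewrite dot_subspace tE /= -adjEr -/u defect_star_sym// => {1}<-.
  by rewrite dotBr.
have e2 : adj Rw h' = - Dr (subspace_val (f' [::])).
  apply: hsum_inj => i; rewrite adj_row_opE//; apply: dot_extr => x.
  have := adjE (V i) (j x) z.
  rewrite Vz dot0r (osum_dot jJ) (VE _ _).1 (VE _ _).2 (isometric_adjK (osum_j jJ)).
  rewrite (osum_adj_Jj jJ) -/h' -/f'.
  rewrite bop_0 addr0 dot_etensl dot_subspace /= adjE.
  rewrite defect_row_sym// dot_singlel => /eqP; rewrite addr_eq0 => /eqP ->.
  by rewrite -dotNr.
have e3 : f' = etens [::] (f' [::]).
  apply: fock_ext => -[|i a]; first by [].
  apply: dot_extr => k; rewrite dot0r -dot_etensl -creationE.
  by rewrite -adjE dilation_VJ adjE Vz dot0r.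
rewrite (osum_dot jJ) -/h -/h' -/f -/f' e3 dot_etensr dot_subspace.
have -> : dot h h' = dot (Ds h) (Ds h') + dot (adj Rw h) (adj Rw h').
  by rewrite dot_defect_star// subrK.
rewrite e1 e2 adjE -defect_row_star// e2 bopN !dotNr.
rewrite -defect_row_sym// dot_defect_row// -adjEr -defect_star_row//.
rewrite -defect_star_sym// e1; ring.
Qed.

Lemma dilation_adj_word a h : adj (word_op V a) (j h) = j (adj (word_op T a) h).
Proof.
elim: a h => [|i a IH] h; first by rewrite !adj_word_nil.
by rewrite (adj_word_cons V i a) (adj_word_cons T i a) dilation_adj_j.
Qed.

Section WithFourier.
Variable G : bop (fock I Es) K.
Hypothesis GE : forall a k, G (etens a k) = word_op V a (w k).
Hypothesis VG : forall i x, G (creation Es i x) = V i (G x).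

(** The Fourier transform restricted to H is the Poisson kernel of T. *)
Lemma fourier_j h a : (adj G (j h)) a = to_crange Ds (adj (word_op T a) h).
Proof.
apply: dot_extr => k; rewrite -dot_etensl -adjE GE adjE dilation_adj_word.
rewrite (osum_dot jJ) (wE _).1 (osum_adj_Jj jJ) dot0r addr0.
by rewrite (isometric_adjK (osum_j jJ)) dot_subspace /= defect_star_sym.
Qed.

Lemma fourier_J_nil d :
  subspace_val ((adj G (J (etens [::] d))) [::]) = - Rw (subspace_val d).
Proof.
have Md : Rw (subspace_val d) \in csub_pred (crange Ds).
  by apply/mem_set; exact: row_op_crange.
have -> : (adj G (J (etens [::] d))) [::] = - Subspace Md.
  apply: dot_extr => k; rewrite -dot_etensl -adjE GE [word_op _ _ _]/=.
  rewrite (osum_dot jJ) (wE _).2 (osum_adj_jJ jJ) (isometric_adjK (osum_J jJ)).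
  rewrite dot0r add0r dotNl dot_etens eqxx dotNr !dot_subspace /= tE.
  by rewrite -adjEr.
by [].
Qed.

Lemma fourier_J_cons d i : adj (creation Es i) (adj G (J (etens [::] d))) =
  adj G (j (Dr (subspace_val d) i)).
Proof. by rewrite (adj_intertwine _ _ VG) dilation_adj_J. Qed.

Hypothesis GV : forall i x, adj G (V i x) = creation Es i (adj G x).

Lemma fourier_J_multi_analytic : multi_analytic (bop_comp (adj G) J).
Proof. by move=> i x; rewrite /= dilation_VJ GV. Qed.

(** The vacuum coefficient of 1 (x) d is - T d, and V_i^* (1 (x) d) is the vector
   (Delta_T d)_i of H, whose coefficients are given by the Poisson kernel. *)
Lemma fourier_J_symbol d :
  ampl (Defs.incl (crange Ds)) (adj G (J (etens [::] d))) = charfun_symbol d.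
Proof.
have ii : isometric (Defs.incl (crange Ds)) by move=> x y.
pose Y := ampl (Defs.incl (crange Ds)) (adj G (J (etens [::] d))).
have inner i : sum (fun a : seq I => etens a
    (Ds (adj (word_op T a) (Dr (subspace_val d) i)))) = adj (creation H i) Y.
  rewrite -[RHS](has_sumE (@has_sum_single _ _ _ (adj (creation H i) Y))).
  congr (sum _); apply/funext => a; congr (etens a _).
  rewrite adj_creationE amplE// -adj_creationE fourier_J_cons fourier_j.
  by [].
have outer : sum (fun i => creation H i (sum (fun a : seq I => etens a
    (Ds (adj (word_op T a) (Dr (subspace_val d) i)))))) = Y - etens [::] (Y [::]).
  rewrite -(has_sumE (@fock_split _ _ _ Y)); congr (sum _); apply/funext => i.
  by rewrite inner.
have first : sum (fun i => T i (subspace_val d i)) = Rw (subspace_val d).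
  by have [_ _ sT] := row_op_spec rT; apply: has_sumE; exact: sT.
rewrite /charfun_symbol outer first /Y amplE//= fourier_J_nil.
have [A _ AE] := @etens_bop R I H [::].
by rewrite -!AE bopN opprK addrCA addNr addr0.
Qed.

Lemma charfun_fourier f : charfun T f = adj G (J f).
Proof.
pose P := [set Theta : bop (fock I E) (fock I Es) | multi_analytic Theta /\
    forall h, ampl (Defs.incl (crange Ds)) (Theta (etens [::] h))
              = charfun_symbol h].
have PJ : P (bop_comp (adj G) J).
  split; first exact: fourier_J_multi_analytic.
  by move=> h; exact: fourier_J_symbol.
have [mC sC] : P (charfun T) by apply: the_bopP; exists (bop_comp (adj G) J).
have ii : isometric (Defs.incl (crange Ds)) by move=> x y.
have [ia _] := ampl_spec I ii.
apply: (@bop_ext_total R _ _ _ _ (charfun T) (bop_comp (adj G) J) (@etens_total R I E)).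
move=> -[a k] /=; elim: a k => [|i a IH] k.
  rewrite -(isometric_adjK ia (charfun T _)) sC -fourier_J_symbol.
  by rewrite (isometric_adjK ia).
by rewrite -creationE mC IH dilation_VJ GV.
Qed.

End WithFourier.

End WithMaps.

End OnSum.

(** If x is orthogonal to F^2 (x) E then x = j h, and if moreover all its Fourier
   coefficients vanish then the words of T^* preserve the norm of h at every
   length; so complete non-coisometry forces x = 0. *)
Lemma charfun_dilation : exists (K : hilbertType C) (V : I -> bop K K)
  (j : bop H K) (J : bop (fock I E) K) (G : bop (fock I Es) K),
  dilates T (charfun T) V j J G.
Proof.
have [K [j [J jJ]]] := orthogonal_sum_ex H (fock I E).
have [V VE] := dilation_row_ex jJ.
have [t tE] := row_adj_restr_ex.
have [w wE] := dilation_w_ex jJ t.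
have rV := dilation_row jJ VE.
have Vw := dilation_wandering jJ VE tE wE.
have VJ := dilation_VJ jJ VE.
pose full : csub K := Defs.ortho set0.
have fullE x : csub_set full x by [].
have [||||G [iG GE VG _]] := @wold_embedding R I K Es V full w rV.
- by move=> i h _.
- exact (dilation_w_isometric jJ tE wE).
- by [].
- by move=> i k m _; exact: Vw.
have G0 k : G (etens [::] k) = w k by rewrite GE.
have complete m : (forall k, dot (G (etens [::] k)) m = 0) -> in_row_range V m.
  move=> Gm; apply: (dilation_complete jJ VE tE wE) => k; rewrite -G0; exact: Gm.
have adjG i x : adj G (V i x) = creation Es i (adj G x).
  by apply: adj_embedding_shift => // k; rewrite G0.
exists K, V, j, J, G; split => //.
- exact: osum_j jJ.
- exact: osum_J jJ.
- exact: osum_jJ jJ.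
- move=> x Jx; exists (adj j x).
  by rewrite {1}(osum_split jJ x) Jx bop_0 addr0.
- exact (dilation_adj_j jJ VE).
- move=> i k; apply: dot_extr => x.
  by rewrite -adjE G0 dot0r Vw.
- by move=> f; rewrite (charfun_fourier jJ VE tE wE GE VG adjG).
move=> cT x Gx Jx.
have xE : x = j (adj j x) by rewrite {1}(osum_split jJ x) Jx bop_0 addr0.
rewrite xE (cT (adj j x)) ?bop_0// => k _.
have := null_words_sum rV VG complete k Gx.
rewrite {1 2}xE (isometric_norm (osum_j jJ)).
congr (has_sum _ _); apply/funext => a.
by rewrite (dilation_adj_word jJ VE) (isometric_norm (osum_j jJ)).
Qed.

End Dilation.

(** * Coincidence of multi-analytic operators *)

Section Coincidence.
Variables (R : realType) (I : choiceType).
Local Notation C := R[i].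
Local Notation etens := (@etens R I _).
Local Notation creation := (@creation R I).
Local Notation ampl W := (@ampl R I _ _ W).
Implicit Types (H K L E F Es : hilbertType C).

Lemma ampl_creation K L (W : bop K L) i x : isometric W ->
  ampl W (creation K i x) = creation L i (ampl W x).
Proof.
move=> iW; have [_ aE] := ampl_spec I iW.
have := @bop_ext_total R _ _ _ _ (bop_comp (ampl W) (creation K i))
  (bop_comp (creation L i) (ampl W)) (@etens_total R I K).
by apply=> -[a k]; rewrite /= creationE !aE creationE.
Qed.

Lemma adj_ampl_eq0 K L (W : bop K L) x : unitary W -> adj (ampl W) x = 0 -> x = 0.
Proof.
move=> [iW oW] Wx; apply: fock_ext => a; apply: dot_extr => k.
have [l <-] := oW k; rewrite dot0r -dot_etensl.
by have [_ <-] := ampl_spec I iW; rewrite adjE Wx dot0r.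
Qed.

(** The unitaries of the coincidence are absorbed into J and G. *)
Lemma dilates_coincide H E Es E' Es' K (T : I -> bop H H)
    (Theta : bop (fock I E) (fock I Es)) (Theta' : bop (fock I E') (fock I Es'))
    (V : I -> bop K K) (j : bop H K) (J : bop (fock I E') K) (G : bop (fock I Es') K) :
  coincide Theta Theta' -> dilates T Theta' V j J G ->
  exists J' G', dilates T Theta V j J' G'.
Proof.
move=> [W [Ws [uW uWs WT]]] D.
have [iW _] := uW; have [iWs _] := uWs.
have [ia aE] := ampl_spec I iW; have [ias asE] := ampl_spec I iWs.
exists (bop_comp J (ampl W)), (bop_comp G (ampl Ws)).
split.
- exact: dil_row D.
- exact: dil_j D.
- by move=> x y /=; rewrite (dil_J D) ia.
- by move=> h f; exact: (dil_jJ D).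
- move=> x; rewrite adj_comp => /(adj_ampl_eq0 uW); exact: (dil_onto D).
- exact (dil_adj D).
- by move=> i f; rewrite /= ampl_creation// (dil_VJ D).
- by move=> x y /=; rewrite (dil_G D) ias.
- by move=> i f; rewrite /= ampl_creation// (dil_VG D).
- by move=> i k; rewrite /= asE (dil_G0 D).
- move=> f; rewrite adj_comp /= (dil_Theta D) -WT.
  by rewrite (isometric_adjK ias).
move=> cT x Gx Jx; apply: (dil_cnc D cT).
  by apply: (adj_ampl_eq0 uWs); rewrite -(adj_comp G (ampl Ws)).
by apply: (adj_ampl_eq0 uW); rewrite -(adj_comp J (ampl W)).
Qed.

End Coincidence.

(** * Defect shifts and the factor map *)

Section Defects.
Variables (R : realType) (I : choiceType).
Local Notation C := R[i].
Local Notation creation := (@creation R I).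
Implicit Types (E F Es : hilbertType C).

Lemma dot_to_crange_defect E F (Theta : bop (fock I E) (fock I F)) f g :
  contractive Theta ->
  dot (to_crange (defect Theta) f) (to_crange (defect Theta) g) =
  dot f g - dot (Theta f) (Theta g).
Proof. by move=> cT; rewrite dot_subspace /= dot_defect. Qed.

Section Shift.
Variables (E F : hilbertType C) (Theta : bop (fock I E) (fock I F)).
Hypothesis cT : contractive Theta.
Hypothesis mT : multi_analytic Theta.
Local Notation D := (to_crange (defect Theta)).

Lemma defect_shiftE i f : defect_shift Theta i (D f) = D (creation E i f).
Proof.
suff [W _ WE] : exists2 W : bop (defect_space Theta) (defect_space Theta),
    isometric W & forall f, W (D f) = D (creation E i f).
  apply: (@the_bopP R _ _ [set V | forall f, V (D f) = D (creation E i f)]).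
  by exists W.
apply: isometric_extension => [x y|]; last exact: to_crange_total.
by rewrite !dot_to_crange_defect// !mT !creation_isometric.
Qed.

Lemma defect_shift_row : row_isometric (defect_shift Theta).
Proof.
move=> i j x y.
have e f g : dot (defect_shift Theta i (D f)) (defect_shift Theta j (D g)) =
    if i == j then dot (D f) (D g) else 0.
  rewrite !defect_shiftE !dot_to_crange_defect// !mT !creation_ortho.
  by case: eqP => //; rewrite subrr.
have e2 g : adj (defect_shift Theta i) (defect_shift Theta j (D g)) =
    if i == j then D g else 0.
  apply/eqP; rewrite -subr_eq0; apply/eqP.
  apply: (@to_crange_total R _ _ (defect Theta)) => f.
  rewrite dotBr -adjE e; case: eqP => _; first by rewrite subrr.
  by rewrite dot0r subrr.
rewrite adjE.
have [P PE] : exists P : bop (defect_space Theta) (defect_space Theta),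
    forall z, P z = if i == j then z else 0.
  by case: eqP => _; [exists (bop_id _) | exists (bop0 _ _)].
have -> : adj (defect_shift Theta i) (defect_shift Theta j y) = P y.
  have := @bop_ext_total R _ _ _ _
    (bop_comp (adj (defect_shift Theta i)) (defect_shift Theta j)) P
    (@to_crange_total R _ _ (defect Theta)).
  by apply=> g; rewrite PE -e2.
by rewrite PE; case: eqP => _ //; rewrite dot0r.
Qed.

End Shift.

Section Factor.
Variables (E F Es : hilbertType C) (Theta : bop (fock I E) (fock I Es)).
Variables (Theta1 : bop (fock I E) (fock I F)) (Theta2 : bop (fock I F) (fock I Es)).
Hypotheses (cT : contractive Theta) (c1 : contractive Theta1) (c2 : contractive Theta2).
Hypothesis TE : forall f, Theta f = Theta2 (Theta1 f).

(** |Delta_2 Theta_1 f|^2 + |Delta_1 f|^2 telescopes to |f|^2 - |Theta f|^2. *)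
Lemma factor_map_spec : isometric (factor_map Theta Theta1 Theta2) /\
  forall f, factor_map Theta Theta1 Theta2 (to_crange (defect Theta) f) =
    hpair (to_crange (defect Theta2) (Theta1 f)) (to_crange (defect Theta1) f).
Proof.
pose P := [set X : bop (defect_space Theta)
    (hprod (defect_space Theta2) (defect_space Theta1)) |
  forall f, X (to_crange (defect Theta) f) =
    hpair (to_crange (defect Theta2) (Theta1 f)) (to_crange (defect Theta1) f)].
have [||X iX XE] := @isometric_extension R (fock I E) (defect_space Theta)
    (hprod (defect_space Theta2) (defect_space Theta1)) (to_crange (defect Theta))
    (fun f => hpair (to_crange (defect Theta2) (Theta1 f)) (to_crange (defect Theta1) f)).
- move=> x y; rewrite dot_hprod /= !dot_to_crange_defect// !TE.
  by rewrite [RHS]addrC addrA subrK.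
- exact: to_crange_total.
have fE : P (factor_map Theta Theta1 Theta2) by apply: the_bopP; exists X.
split=> // x y; rewrite -(iX x y).
have e z : factor_map Theta Theta1 Theta2 z = X z.
  apply: (@bop_ext_total R _ _ _ _ _ X (@to_crange_total R _ _ (defect Theta))).
  by move=> f; rewrite fE XE.
by rewrite !e.
Qed.

End Factor.

End Defects.

(** * The model space of a factorization *)

Section Model.
Variables (R : realType) (I : choiceType) (E F Es : hilbertType R[i]).
Variables (Theta1 : bop (fock I E) (fock I F)) (Theta2 : bop (fock I F) (fock I Es)).
Local Notation C := R[i].
Local Notation etens := (@etens R I _).
Local Notation creation := (@creation R I).
Local Notation D1 := (to_crange (defect Theta1)).
Local Notation D2 := (to_crange (defect Theta2)).
Local Notation MK := (model_dilation Theta1 Theta2).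
Local Notation triple := (@triple R I E F Es Theta1 Theta2).

Lemma tripleP a f phi psi f' phi' psi' :
  triple (a *: f + f') (a *: phi + phi') (a *: psi + psi') =
  a *: triple f phi psi + triple f' phi' psi'.
Proof. by []. Qed.

Lemma triple_surj (x : MK) : exists f phi psi, x = triple f phi psi.
Proof. by case: x => [[f phi] psi]; exists f, phi, psi. Qed.

Lemma dot_triple f phi psi f' phi' psi' :
  dot (triple f phi psi) (triple f' phi' psi') =
  dot f f' + dot phi phi' + dot psi psi'.
Proof. by []. Qed.

Lemma triple_inj f phi psi f' phi' psi' :
  triple f phi psi = triple f' phi' psi' -> [/\ f = f', phi = phi' & psi = psi'].
Proof. by case. Qed.

End Model.

(* The nested products are hidden, so that unification and simplification never
   unfold a vector of the dilation space beyond its three components. *)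
Opaque model_dilation triple.

Section ModelRow.
Variables (R : realType) (I : choiceType) (E F Es : hilbertType R[i]).
Variables (Theta1 : bop (fock I E) (fock I F)) (Theta2 : bop (fock I F) (fock I Es)).
Hypotheses (c1 : contractive Theta1) (c2 : contractive Theta2).
Hypotheses (m1 : multi_analytic Theta1) (m2 : multi_analytic Theta2).
Local Notation C := R[i].
Local Notation etens := (@etens R I _).
Local Notation creation := (@creation R I).
Local Notation D1 := (to_crange (defect Theta1)).
Local Notation D2 := (to_crange (defect Theta2)).
Local Notation MK := (model_dilation Theta1 Theta2).
Local Notation MS := (model_space Theta1 Theta2).
Local Notation triple := (@triple R I E F Es Theta1 Theta2).
Local Notation H1 := (model_H1 Theta1 Theta2).
Local Notation H2 := (model_H2 Theta1 Theta2).

Lemma tripleD f phi psi f' phi' psi' :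
  triple (f + f') (phi + phi') (psi + psi') = triple f phi psi + triple f' phi' psi'.
Proof. by have := tripleP 1 f phi psi f' phi' psi'; rewrite !scale1r. Qed.

Lemma triple0 : triple 0 0 0 = 0.
Proof. by apply: (@addrI _ (triple 0 0 0)); rewrite -tripleD !addr0. Qed.

Lemma model_shift_ex : exists2 W : I -> bop MK MK, row_isometric W &
  forall i f phi psi, W i (triple f phi psi) = triple (creation Es i f)
    (defect_shift Theta2 i phi) (defect_shift Theta1 i psi).
Proof.
suff /choice[W WE] : forall i, exists W : bop MK MK, forall f phi psi,
    W (triple f phi psi) = triple (creation Es i f)
    (defect_shift Theta2 i phi) (defect_shift Theta1 i psi).
  exists W => // i j x y.
  have [f [phi [psi ->]]] := triple_surj x; have [f' [phi' [psi' ->]]] := triple_surj y.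
  rewrite !WE !dot_triple creation_ortho (defect_shift_row c1 m1) (defect_shift_row c2 m2).
  by case: eqP => // _; rewrite !addr0.
move=> i.
have /choice[W WE] : forall x : MK, exists y : MK, forall f phi psi,
    x = triple f phi psi -> y = triple (creation Es i f)
    (defect_shift Theta2 i phi) (defect_shift Theta1 i psi).
  move=> x; have [f [phi [psi ->]]] := triple_surj x.
  by eexists => f' phi' psi' /triple_inj[<- <- <-].
have [||W' W'E] := @bop_of_bounded R MK MK W 1; last first.
- by exists W' => f phi psi; rewrite W'E; apply: WE.
- move=> x; rewrite mul1r (norm_of_dot (_ : _ = dot x x))//.
  have [f [phi [psi xE]]] := triple_surj x.
  rewrite (WE _ _ _ _ xE) xE !dot_triple creation_isometric.
  by rewrite (defect_shift_row c1 m1) (defect_shift_row c2 m2) eqxx.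
move=> a x y.
have [f [phi [psi xE]]] := triple_surj x; have [f' [phi' [psi' yE]]] := triple_surj y.
rewrite (WE _ _ _ _ xE) (WE _ _ _ _ yE) -tripleP -!bopZ -!bopD.
by apply: WE; rewrite xE yE tripleP.
Qed.

(** The graph that is removed from the dilation space of the model is closed: it
   is the range of an isometry. *)
Lemma model_graph_ex : exists2 g : bop (fock I E) MK, isometric g &
  forall f, g f = triple (Theta2 (Theta1 f)) (D2 (Theta1 f)) (D1 f).
Proof.
pose g f := triple (Theta2 (Theta1 f)) (D2 (Theta1 f)) (D1 f).
have ig f f' : dot (g f) (g f') = dot f f'.
  rewrite dot_triple !dot_to_crange_defect//.
  by rewrite [_ + (dot (Theta1 f) _ - _)]addrC subrK addrC subrK.
have [a x y|x|G GE] := @bop_of_bounded R (fock I E) MK g 1.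
- by rewrite /g !bopD !bopZ !to_crangeP tripleP.
- by rewrite mul1r (norm_of_dot (ig x x)).
by exists G => // x y; rewrite !GE.
Qed.

Lemma model_graph2_ex : exists2 d : bop (fock I F) MK, isometric d &
  forall f, d f = triple (Theta2 f) (D2 f) 0.
Proof.
pose g f := triple (Theta2 f) (D2 f) 0.
have ig f f' : dot (g f) (g f') = dot f f'.
  rewrite dot_triple !dot_to_crange_defect// dot0l addr0.
  by rewrite addrC subrK.
have [a x y|x|G GE] := @bop_of_bounded R (fock I F) MK g 1.
- by rewrite /g !bopD !bopZ !to_crangeP -tripleP scaler0 addr0.
- by rewrite mul1r (norm_of_dot (ig x x)).
by exists G => // x y; rewrite !GE.
Qed.

(** Here g and d parametrise the graphs of Theta_2 Theta_1 and of Theta_2, and W is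
   the row isometry of the model dilation. The subspaces H1 and H2 are described
   through orthogonality to d and to the third summand, which reduces their
   properties to the invariance of the two graphs under W. *)
Section Structure.
Variables (W : I -> bop MK MK) (g : bop (fock I E) MK) (d : bop (fock I F) MK).
Hypothesis rW : row_isometric W.
Hypothesis WE : forall i f phi psi, W i (triple f phi psi) = triple (creation Es i f)
    (defect_shift Theta2 i phi) (defect_shift Theta1 i psi).
Hypotheses (ig : isometric g) (iso_d : isometric d).
Hypothesis gE : forall f, g f = triple (Theta2 (Theta1 f)) (D2 (Theta1 f)) (D1 f).
Hypothesis dE : forall f, d f = triple (Theta2 f) (D2 f) 0.

Lemma model_g_split f : g f = d (Theta1 f) + triple 0 0 (D1 f).
Proof. by rewrite gE dE -tripleD !addr0 add0r. Qed.

Lemma model_gW i f : g (creation E i f) = W i (g f).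
Proof. by rewrite !gE WE !defect_shiftE// m1 m2. Qed.

Lemma model_dW i f : d (creation F i f) = W i (d f).
Proof. by rewrite !dE WE bop_0 !defect_shiftE// m2. Qed.

Lemma model_adjW i f phi psi :
  adj (W i) (triple f phi psi) = triple (adj (creation Es i) f)
    (adj (defect_shift Theta2 i) phi) (adj (defect_shift Theta1 i) psi).
Proof.
apply: dot_extr => x; rewrite -adjE; have [f' [phi' [psi' ->]]] := triple_surj x.
by rewrite WE !dot_triple !adjE.
Qed.

Lemma model_spaceP x : csub_set MS x <-> forall f, dot x (g f) = 0.
Proof.
split=> [xg f|xg _ [f _ <-]]; last by rewrite -gE.
by apply: xg; exists f => //; rewrite gE.
Qed.

Lemma model_H2P x : H2 x <->
  (forall f, dot x (d f) = 0) /\ forall psi, dot x (triple 0 0 psi) = 0.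
Proof.
split=> [[[f [phi ->]] xd]|[xd x3]].
  split=> [h|psi]; first by apply: xd; exists h => //; rewrite dE.
  by rewrite dot_triple !dot0r dot0l !addr0.
split; last by move=> _ [h _ <-]; rewrite -dE.
have [f [phi [psi xE]]] := triple_surj x; exists f, phi; rewrite xE; congr triple.
by apply: dot_eq0; have := x3 psi; rewrite xE dot_triple !dot0r !add0r.
Qed.

Lemma model_H2_sub x : H2 x -> csub_set MS x.
Proof.
move=> /model_H2P[xd x3]; apply/model_spaceP => f.
by rewrite model_g_split dotDr xd x3 addr0.
Qed.

(** The nontrivial direction recovers x from its components along the range of d
   and the third summand: what is left of x lies in H2, so it vanishes. *)
Lemma model_H1P x : H1 x <->
  csub_set MS x /\ forall y, H2 y -> dot x y = 0.
Proof.
have edge f psi : triple (Theta2 f) (D2 f) psi = d f + triple 0 0 psi.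
  by rewrite dE -tripleD !addr0 add0r.
split=> [[[f [psi ->]] xg]|[xg x2]].
  split=> // y /model_H2P[yd y3]; apply: dot_flip.
  by rewrite edge dotDr yd y3 addr0.
split; last exact: xg.
have [f [phi [psi xE]]] := triple_surj x.
exists (adj d x), psi; rewrite edge.
set z := d (adj d x) + triple 0 0 psi.
have d3 f' psi' : dot (d f') (triple 0 0 psi') = 0.
  by rewrite dE dot_triple !dot0r dot0l !addr0.
have yH : H2 (x - z).
  apply/model_H2P; split=> [f'|psi'].
    rewrite dotBl dotDl iso_d -adjEr (dot_flip (d3 _ _)) addr0 subrr//.
  by rewrite dotBl dotDl d3 add0r xE !dot_triple !dot0r !add0r subrr.
have zy : dot z (x - z) = 0.
  by have /model_H2P[yd y3] := yH; apply: dot_flip; rewrite dotDr yd y3 addr0.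
have : x - z = 0 by apply: dot_eq0; rewrite dotBl zy subr0 x2.
by move/eqP; rewrite subr_eq0 => /eqP.
Qed.

(** If y is orthogonal to the graph and to H1, it is orthogonal to every vector l
   orthogonal to H2, because l differs from an element of H1 by an element of the
   graph. *)
Lemma model_H2_complement : H2 = ominus (csub_set MS) H1.
Proof.
apply/seteqP; split=> y.
  move=> yH; split; first exact: model_H2_sub.
  by move=> x /model_H1P[_ xH]; apply: dot_flip; exact: xH.
move=> [/model_spaceP yg yH].
have reduce l : (forall z, H2 z -> dot l z = 0) -> dot y l = 0.
  move=> lH; have /yH : H1 (l - g (adj g l)).
    apply/model_H1P; split.
      by apply/model_spaceP => f; rewrite dotBl ig -adjEr subrr.
    move=> z zH; rewrite dotBl lH// sub0r.
    by have /model_spaceP zg := model_H2_sub zH; rewrite (dot_flip (zg _)) oppr0.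
  by rewrite dotBr yg subr0.
apply/model_H2P; split=> [f|psi]; apply: reduce => z /model_H2P[zd z3].
  exact: dot_flip.
exact: dot_flip.
Qed.

Lemma model_H2_adjW i x : H2 x -> H2 (adj (W i) x).
Proof.
move=> /model_H2P[xd x3]; apply/model_H2P; split=> [f|psi].
  by rewrite -adjEr -model_dW xd.
by rewrite -adjEr WE !bop_0 x3.
Qed.

Lemma model_space_adjW i x : csub_set MS x -> csub_set MS (adj (W i) x).
Proof.
by move=> /model_spaceP xg; apply/model_spaceP => f; rewrite -adjEr -model_gW xg.
Qed.

Lemma model_row_ex : exists TT : I -> bop MS MS, forall i x y,
  dot (TT i x) y = dot (W i (subspace_val x)) (subspace_val y).
Proof.
exists (fun i => bop_comp (adj (Defs.incl MS)) (bop_comp (W i) (Defs.incl MS))).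
move=> i x y.
by rewrite -[LHS]/(dot (adj (Defs.incl MS) (W i (Defs.incl MS x))) y) -adjEr.
Qed.

Section ModelCompression.
Variable TT : I -> bop MS MS.
Hypothesis TTE : forall i x y,
  dot (TT i x) y = dot (W i (subspace_val x)) (subspace_val y).

Lemma adj_model_row i x : subspace_val (adj (TT i) x) = adj (W i) (subspace_val x).
Proof.
have Mx : adj (W i) (subspace_val x) \in csub_pred MS.
  by apply/mem_set/model_space_adjW; exact: subspaceP.
have -> : adj (TT i) x = Subspace Mx.
  by apply: dot_extr => y; rewrite -adjE TTE dot_subspace /= adjE.
by [].
Qed.

Lemma model_row_is_model : is_model_row TT.
Proof.
by move=> i f phi psi x xE; rewrite adj_model_row xE model_adjW.
Qed.

Lemma model_row_contraction : row_contraction TT.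
Proof.
have [Wr iWr WrE] := row_isometry rW.
have cW : contractive Wr by move=> y; rewrite isometric_norm.
have [j jE] : exists j : bop MS MK, forall x, j x = subspace_val x.
  by exists (Defs.incl MS).
exists (bop_comp (adj j) (bop_comp (bop_comp Wr (adj Wr)) j)).
  move=> x; have := @has_sum_bop _ _ _ _ (adj j) _ _
    (@row_has_sum _ _ _ _ _ Wr (adj Wr (j x)) WrE).
  congr (has_sum _ _); apply/funext => i.
  rewrite -[LHS]/(adj j (W i (adj Wr (j x) i))) (row_adjE _ _ WrE) jE.
  apply: dot_extl => y; rewrite TTE adj_model_row -adjEr.
  by rewrite jE.
move=> x.
rewrite -[bop_comp _ _ x]/(adj j (Wr (adj Wr (j x)))) -adjEr adjE !dot_norm.
rewrite ler_pXn2r ?nnegrE// (le_trans (contractive_adj cW _))//.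
by rewrite jE -subspace_norm.
Qed.

(** The adjoint of the row preserves H2, the complement of H1. *)
Lemma model_H1_invariant :
  invariant_under TT (@subspace_val _ _ _ @^-1` H1).
Proof.
move=> i x /model_H1P[_ xH]; apply/model_H1P; split; first exact: subspaceP.
move=> y yH; have My : y \in csub_pred MS by apply/mem_set/model_H2_sub.
have [z zE] : exists z : MS, subspace_val z = y by exists (Subspace My).
rewrite -zE in yH *.
rewrite -(dot_subspace (TT i x) z) (TTE i x z) (adjE (W i)) (xH _ (model_H2_adjW i yH)).
by [].
Qed.

(** The corresponding subspace of H is the complement of the preimage of H2. *)
Lemma model_H1_transport (H : hilbertType C) (T : I -> bop H H) (U : bop H MS) :
  unitary_equivalence T TT U ->
  exists M : csub H,
    [set subspace_val (U h) | h in csub_set M] = H1 /\ invariant_under T (csub_set M).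
Proof.
move=> [uU UT].
pose M : csub H := Defs.ortho [set adj U y | y in @subspace_val _ _ _ @^-1` H2].
have ME h : csub_set M h <-> H1 (subspace_val (U h)).
  split=> [hM|/model_H1P[_ hU] _ [y yH <-]].
    apply/model_H1P; split; first exact: subspaceP.
    move=> y yH; have My : y \in csub_pred MS by apply/mem_set/model_H2_sub.
    have : dot h (adj U (Subspace My)) = 0 by apply: hM; exists (Subspace My).
    by rewrite -adjE dot_subspace.
  by rewrite -adjE dot_subspace hU.
exists M; split.
  apply/seteqP; split=> [_ [h /ME hM <-]//|x xH].
  have Mx : x \in csub_pred MS by apply/mem_set; have /model_H1P[] := xH.
  have [h hE] := uU.2 (Subspace Mx).
  by exists h; rewrite ?hE//; apply/ME; rewrite hE.
move=> i h /ME hM; apply/ME; rewrite UT; exact: model_H1_invariant.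
Qed.

(** A unitary Psi from the dilation space of T to that of the model which respects
   the row isometries and takes F^2 (x) E to the graph takes the complement of the
   former, H, to the complement of the latter, the model space. *)
Section Equivalence.
Variables (H K : hilbertType C) (T : I -> bop H H).
Variables (Theta : bop (fock I E) (fock I Es)).
Variables (V : I -> bop K K) (j : bop H K) (J : bop (fock I E) K) (G : bop (fock I Es) K).
Hypothesis dil : dilates T Theta V j J G.
Variable Psi : bop K MK.
Hypothesis uP : unitary Psi.
Hypothesis PJ : forall f, Psi (J f) = g f.
Hypothesis PV : forall i x, Psi (V i x) = W i (Psi x).

Lemma model_equivalence : exists2 U : bop H MS,
  unitary_equivalence T TT U & forall h, subspace_val (U h) = Psi (j h).
Proof.
have iP := uP.1.
have Mj h : Psi (j h) \in csub_pred MS.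
  by apply/mem_set/model_spaceP => f; rewrite -PJ iP (dil_jJ dil).
have iU h h' : dot (Subspace (Mj h) : MS) (Subspace (Mj h')) = dot h h'.
  by rewrite dot_subspace /= iP (dil_j dil).
have [a x y|x|U UE] := @bop_of_bounded R H MS (fun h => Subspace (Mj h)) 1.
- by apply: val_inj; rewrite /= !(bopD, bopZ).
- by rewrite mul1r (norm_of_dot (iU x x)).
exists U; last by move=> h; rewrite UE.
have U_isom : isometric U by move=> x y; rewrite !UE.
have oU y : exists h, U h = y.
  have [x xE] := uP.2 (subspace_val y).
  have [|h hE] := dil_onto dil (x := x).
    apply: dot_extr => f; rewrite -adjE dot0r -iP PJ xE; apply: dot_flip.
    by have /model_spaceP := subspaceP y.
  by exists h; apply: val_inj; rewrite UE /= -hE.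
split=> [//|i h].
apply: dot_extl => y; have [h' <-] := oU y.
rewrite U_isom TTE !UE /= -PV iP [RHS]adjE (dil_adj dil) (dil_j dil).
by rewrite adjE.
Qed.

End Equivalence.

End ModelCompression.

End Structure.

End ModelRow.

(** * Factorizations and invariant subspaces *)

Section Factorizations.
Variables (R : realType) (I : choiceType) (H E Es K : hilbertType R[i]).
Variables (T : I -> bop H H) (Theta : bop (fock I E) (fock I Es)).
Variables (V : I -> bop K K) (j : bop H K) (J : bop (fock I E) K).
Variable G : bop (fock I Es) K.
Hypothesis dil : dilates T Theta V j J G.
Hypothesis cT : cnc T.
Hypothesis cTheta : contractive Theta.
Local Notation C := R[i].
Local Notation etens := (@etens R I _).
Local Notation creation := (@creation R I).

Let rV := dil_row dil.

(** For a completely non-coisometric row, the Fourier part of the dilation and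
   F^2 (x) E span the dilation space. *)
Lemma dilation_total x : (forall g, dot (G g) x = 0) ->
  (forall f, dot (J f) x = 0) -> x = 0.
Proof.
move=> Gx Jx; apply: (dil_cnc dil cT).
  by apply: dot_extr => g; rewrite -adjE Gx dot0r.
by apply: dot_extr => f; rewrite -adjE Jx dot0r.
Qed.

Section Converse.
Variables (F : hilbertType C) (Theta1 : bop (fock I E) (fock I F)).
Variable Theta2 : bop (fock I F) (fock I Es).
Hypothesis reg : regular_factorization Theta Theta1 Theta2.
Local Notation MK := (model_dilation Theta1 Theta2).
Local Notation triple := (@triple R I E F Es Theta1 Theta2).
Local Notation D1 := (to_crange (defect Theta1)).
Local Notation D2 := (to_crange (defect Theta2)).
Variables (W : I -> bop MK MK) (g : bop (fock I E) MK).
Hypothesis WE : forall i f phi psi, W i (triple f phi psi) = triple (creation Es i f)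
    (defect_shift Theta2 i phi) (defect_shift Theta1 i psi).
Hypotheses (ig : isometric g) (gW : forall i f, g (creation E i f) = W i (g f)).
Hypothesis gE : forall f, g f = triple (Theta2 (Theta1 f)) (D2 (Theta1 f)) (D1 f).

(** This is where regularity enters: a vector (0, phi, psi) has the form X z, and
   being orthogonal to the vectors X (Delta f) it is zero. *)
Lemma regular_total (x : MK) : (forall f, dot (triple f 0 0) x = 0) ->
  (forall f, dot (g f) x = 0) -> x = 0.
Proof.
have [[m1 c1] [m2 c2] TE [_ onto]] := reg.
have [fi fE] := factor_map_spec cTheta c1 c2 TE.
have [f [phi [psi ->]]] := triple_surj x => x1 xg.
have f0 : f = 0.
  by apply: dot_eq0; have := x1 f; rewrite dot_triple !dot0l !addr0.
have [z zE] := onto (hpair phi psi).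
have z0 : z = 0.
  apply: (@to_crange_total R _ _ (defect Theta)) => h.
  rewrite -fi fE zE; have := xg h.
  by rewrite gE dot_triple f0 dot0r add0r.
by move: zE; rewrite z0 bop_0 f0 => -[<- <-]; exact: triple0.
Qed.

(** The total families G f, J f in K and (f, 0, 0), g f in the model have the same
   Gram matrix, whose only nontrivial entry is <f, Theta h>. *)
Lemma regular_unitary : exists2 P : bop K MK, unitary P &
  (forall f, P (J f) = g f) /\ forall i x, P (V i x) = W i (P x).
Proof.
have [_ _ TE _] := reg.
pose a (s : fock I Es + fock I E) : K :=
  match s with inl f => G f | inr f => J f end.
pose b (s : fock I Es + fock I E) : MK :=
  match s with inl f => triple f 0 0 | inr f => g f end.
have ta : total_family a.
  by move=> x ax; apply: dilation_total => f; [exact: (ax (inl f))|exact: (ax (inr f))].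
have tb : total_family b.
  by move=> x bx; apply: regular_total => f; [exact: (bx (inl f))|exact: (bx (inr f))].
have Gg f h : dot (G f) (J h) = dot (triple f 0 0) (g h).
  by rewrite adjE (dil_Theta dil) TE gE dot_triple !dot0l !addr0.
have [|//|P iP PE] := @isometric_extension R _ K MK a b.
  move=> [f|f] [h|h] /=.
  - by rewrite (dil_G dil) dot_triple !dot0l !addr0.
  - exact: Gg.
  - by rewrite dotC Gg -dotC.
  - by rewrite (dil_J dil) ig.
have PG f : P (G f) = triple f 0 0 := PE (inl f).
have PJ f : P (J f) = g f := PE (inr f).
exists P; last split=> // i x.
  apply: (isometric_unitary iP) => y Py; apply: tb => s.
  by rewrite -PE adjE Py dot0r.
have := @bop_ext_total R _ _ _ _ (bop_comp P (V i)) (bop_comp (W i) P) ta.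
apply=> -[f|f] /=; first by rewrite -(dil_VG dil) !PG WE !bop_0.
by rewrite -(dil_VJ dil) !PJ gW.
Qed.

End Converse.

Section Forward.
Variable H1 : csub H.
Hypothesis TH1 : invariant_under T (csub_set H1).

Let H2 := ominus setT (csub_set H1).

(** The subspace H1 (+) F^2 (x) E of the dilation space, written as the complement
   of j (H2); it is V-invariant because H1 is T-invariant. *)
Definition lifted_subspace : csub K := Defs.ortho [set j h | h in H2].
Local Notation M := lifted_subspace.

Lemma lifted_invariant : invariant_under V (csub_set M).
Proof.
move=> i m Mm _ [h h2 <-]; rewrite adjE (dil_adj dil); apply: Mm.
exists (adj (T i) h) => //; split => // h1 h1H.
by rewrite -adjEr; apply: h2.2; exact: TH1.
Qed.

Lemma lifted_J f : csub_set M (J f).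
Proof. by move=> _ [h _ <-]; apply: dot_flip; exact: dil_jJ dil _ _. Qed.

Lemma lifted_j h : csub_set H1 h -> csub_set M (j h).
Proof.
by move=> h1 _ [h' h2 <-]; rewrite (dil_j dil); apply/dot_flip/h2.2.
Qed.

Local Notation F := (csub_type (wandering V M)).

Section WithEmbedding.
Variable D : bop (fock I F) K.
Hypothesis iD : isometric D.
Hypothesis DV : forall i x, D (creation F i x) = V i (D x).
Hypothesis DM : forall x, csub_set M (D x).
Hypothesis D0 : forall k, D (etens [::] k) = subspace_val k.

(** With D the Wold embedding of the lifted subspace, the two factors are the
   Fourier transform of F^2 (x) E inside that subspace and the Fourier transform
   of the shift part of the subspace inside K. *)
Definition factor1 : bop (fock I E) (fock I F) := bop_comp (adj D) J.
Definition factor2 : bop (fock I F) (fock I Es) := bop_comp (adj G) D.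

Lemma factor1_multi_analytic : multi_analytic factor1.
Proof.
move=> i f; rewrite /= (dil_VJ dil); apply: adj_embedding_shift => // k.
rewrite D0; apply: wandering_ortho (subspaceP k); exact: lifted_J.
Qed.

Lemma factor2_multi_analytic : multi_analytic factor2.
Proof.
move=> i f; rewrite /= DV; apply: adj_embedding_shift => //.
  exact: dil_VG dil.
by move=> k; rewrite adjE (dil_G0 dil) dot0r.
Qed.

Lemma factor1_contractive : contractive factor1.
Proof.
move=> f /=; have cD : contractive D by move=> x; rewrite isometric_norm.
by rewrite (le_trans (contractive_adj cD _))// (isometric_norm (dil_J dil)).
Qed.

Lemma factor2_contractive : contractive factor2.
Proof.
move=> f /=; have cG : contractive G by move=> x; rewrite (isometric_norm (dil_G dil)).
by rewrite (le_trans (contractive_adj cG _))// isometric_norm.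
Qed.

Lemma lifted_vanish m : csub_set M m -> adj G (m - D (adj D m)) = 0.
Proof.
move=> Mm; apply: (shift_part_vanish (V := V) (M := M) (G := D)) => //.
- exact (dil_VG dil).
- exact (dil_G0 dil).
- move=> x Mx Dx; apply: (wandering_complete rV lifted_invariant Mx) => y wy.
  have wy' : y \in csub_pred (wandering V M) by exact/mem_set.
  by have := Dx (Subspace wy'); rewrite D0.
- rewrite -[m - _]addrC -scaleN1r; apply: csubP => //.
by rewrite bopB (isometric_adjK iD) subrr.
Qed.

(** The component of J f outside the range of D is residual in K, so it does not
   contribute to the Fourier transform of J f. *)
Lemma factorE f : Theta f = factor2 (factor1 f).
Proof.
rewrite -(dil_Theta dil) /=; apply/eqP; rewrite -subr_eq0 -bopB.
by rewrite lifted_vanish//; exact: lifted_J.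
Qed.

Local Notation MK := (model_dilation factor1 factor2).
Local Notation triple := (@triple R I E F Es factor1 factor2).
Local Notation D1 := (to_crange (defect factor1)).
Local Notation D2 := (to_crange (defect factor2)).
Variables (W : I -> bop MK MK) (g : bop (fock I E) MK) (d : bop (fock I F) MK).
Hypothesis WE : forall i f phi psi, W i (triple f phi psi) = triple (creation Es i f)
    (defect_shift factor2 i phi) (defect_shift factor1 i psi).
Hypotheses (ig : isometric g) (iso_d : isometric d).
Hypothesis gE : forall f, g f = triple (factor2 (factor1 f)) (D2 (factor1 f)) (D1 f).
Hypothesis dE : forall f, d f = triple (factor2 f) (D2 f) 0.
Hypothesis gW : forall i f, g (creation E i f) = W i (g f).
Hypothesis dW : forall i f, d (creation F i f) = W i (d f).

(** Adding D f and its image d f to the two families makes the family in the model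
   total whether or not the factorization is regular. *)
Lemma lifted_unitary : exists2 P : bop K MK, unitary P &
  [/\ forall f, P (G f) = triple f 0 0, forall f, P (J f) = g f,
      forall f, P (D f) = d f & forall i x, P (V i x) = W i (P x)].
Proof.
pose a (s : fock I Es + fock I E + fock I F) : K :=
  match s with inl (inl f) => G f | inl (inr f) => J f | inr f => D f end.
pose b (s : fock I Es + fock I E + fock I F) : MK :=
  match s with inl (inl f) => triple f 0 0 | inl (inr f) => g f | inr f => d f end.
have ta : total_family a.
  by move=> x ax; apply: dilation_total => f;
    [exact: (ax (inl (inl f)))|exact: (ax (inl (inr f)))].
have tb : total_family b.
  move=> x; have [f [phi [psi ->]]] := triple_surj x => bx.
  have f0 : f = 0.
    by apply: dot_eq0; have := bx (inl (inl f)); rewrite /= dot_triple !dot0l !addr0.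
  have p0 : phi = 0.
    apply: (@to_crange_total R _ _ (defect factor2)) => h.
    by have := bx (inr h); rewrite /= dE dot_triple f0 dot0r dot0l add0r addr0.
  have q0 : psi = 0.
    apply: (@to_crange_total R _ _ (defect factor1)) => h.
    by have := bx (inl (inr h)); rewrite /= gE dot_triple f0 p0 !dot0r !add0r.
  by rewrite f0 p0 q0 triple0.
have GJ f h : dot (G f) (J h) = dot (triple f 0 0) (g h).
  by rewrite adjE (dil_Theta dil) factorE gE dot_triple !dot0l !addr0.
have GD f h : dot (G f) (D h) = dot (triple f 0 0) (d h).
  by rewrite adjE dE dot_triple !dot0l !addr0.
have DJ f h : dot (D f) (J h) = dot (d f) (g h).
  have -> : g h = d (factor1 h) + triple 0 0 (D1 h).
    by rewrite gE dE -tripleD !addr0 add0r.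
  rewrite dotDr iso_d dE dot_triple !dot0r dot0l !addr0.
  by rewrite adjE.
have [|//|P iP PE] := @isometric_extension R _ K MK a b.
  move=> [[f|f]|f] [[h|h]|h] /=.
  - by rewrite (dil_G dil) dot_triple !dot0l !addr0.
  - exact: GJ.
  - exact: GD.
  - by rewrite dotC GJ -dotC.
  - by rewrite (dil_J dil) ig.
  - by rewrite dotC DJ -dotC.
  - by rewrite dotC GD -dotC.
  - exact: DJ.
  - by rewrite iD iso_d.
have PG f : P (G f) = triple f 0 0 := PE (inl (inl f)).
have PJ f : P (J f) = g f := PE (inl (inr f)).
have PD f : P (D f) = d f := PE (inr f).
exists P; last split=> // i x.
  apply: (isometric_unitary iP) => y Py; apply: tb => s.
  by rewrite -PE adjE Py dot0r.
have := @bop_ext_total R _ _ _ _ (bop_comp P (V i)) (bop_comp (W i) P) ta.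
apply=> -[[f|f]|f] /=.
- by rewrite -(dil_VG dil) !PG WE !bop_0.
- by rewrite -(dil_VJ dil) !PJ gW.
- by rewrite -DV !PD dW.
Qed.

Variable P : bop K MK.
Hypothesis uP : unitary P.
Hypotheses (PG : forall f, P (G f) = triple f 0 0) (PJ : forall f, P (J f) = g f)
  (PD : forall f, P (D f) = d f).

(** A vector (0, phi, psi) orthogonal to the graph comes from a vector of K that is
   orthogonal to the total family of the G f and J f. *)
Lemma lifted_regular : regular_factorization Theta factor1 factor2.
Proof.
split.
- by split; [exact: factor1_multi_analytic|exact: factor1_contractive].
- by split; [exact: factor2_multi_analytic|exact: factor2_contractive].
- exact: factorE.
have [fi fE] := factor_map_spec cTheta factor1_contractive factor2_contractive factorE.
apply: (isometric_unitary fi) => -[phi psi] Xy.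
have [x xE] := uP.2 (triple 0 phi psi).
have x0 : x = 0.
  apply: dilation_total => f; rewrite -uP.1 xE.
    by rewrite PG dot_triple dot0r !dot0l !addr0.
  rewrite PJ gE dot_triple dot0r add0r.
  have := adjE (factor_map Theta factor1 factor2) (to_crange (defect Theta) f) (hpair phi psi).
  by rewrite Xy dot0r fE.
move: xE; rewrite x0 bop_0 -(@triple0 R I E F Es factor1 factor2).
by move=> /triple_inj[_ <- <-].
Qed.

(** Under P the range of D becomes the graph of Theta_2, and the residual part of
   the lifted subspace becomes the third summand of the model: both follow from
   the vanishing of the Fourier transform on the residual part. *)
Lemma lifted_H2 h : model_H2 factor1 factor2 (P (j h)) <-> H2 h.
Proof.
have H2P := model_H2P dE.
split=> [/H2P[xd x3]|h2].
  split=> // h1 h1H; rewrite -(dil_j dil).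
  have Mm := lifted_j h1H.
  pose z := j h1 - D (adj D (j h1)).
  have -> : j h1 = D (adj D (j h1)) + z by rewrite addrC subrK.
  rewrite dotDr -uP.1 PD xd add0r -uP.1.
  have [f [phi [psi zE]]] := triple_surj (P z).
  have f0 : f = 0.
    apply: dot_eq0; have : dot (triple f 0 0) (P z) = 0.
      by rewrite -PG uP.1 adjE lifted_vanish// dot0r.
    by rewrite zE dot_triple !dot0l !addr0.
  have p0 : phi = 0.
    apply: (@to_crange_total R _ _ (defect factor2)) => k.
    have : dot (d k) (P z) = 0.
      by rewrite -PD uP.1 adjE bopB (isometric_adjK iD) subrr dot0r.
    by rewrite zE dE dot_triple f0 dot0r dot0l add0r addr0.
  by rewrite zE f0 p0 x3.
have xM m : csub_set M m -> dot (j h) m = 0.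
  by move=> Mm; apply/dot_flip/Mm; exists h.
apply/H2P; split=> [f|psi]; first by rewrite -PD uP.1 xM.
have [f [phi [q qE]]] := triple_surj (P (j h)).
suff q0 : q = 0 by rewrite qE q0 dot_triple !dot0r dot0l !addr0.
apply: (@to_crange_total R _ _ (defect factor1)) => k.
have : dot (triple 0 0 (D1 k)) (P (j h)) = 0.
  have -> : triple 0 0 (D1 k) = P (J k) - P (D (factor1 k)).
    rewrite PJ PD gE dE; apply/eqP; rewrite eq_sym subr_eq -tripleD.
    by rewrite !addr0 !add0r.
  by rewrite -bopB uP.1 dotBl !(dot_flip (xM _ _)) ?subrr//; exact: lifted_J.
by rewrite qE dot_triple !dot0l !add0r.
Qed.

End WithEmbedding.

End Forward.

End Factorizations.

(** * The correspondence *)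

Section ModelTheorem.
Variables (R : realType) (I : choiceType) (H E Es : hilbertType R[i]).
Variables (T : I -> bop H H) (Theta : bop (fock I E) (fock I Es)).
Hypotheses (rT : row_contraction T) (cT : cnc T) (cTheta : contractive Theta).
Hypothesis co : coincide Theta (charfun T).

Lemma coincide_dilation : exists (K : hilbertType R[i]) (V : I -> bop K K)
  (j : bop H K) (J : bop (fock I E) K) (G : bop (fock I Es) K),
  dilates T Theta V j J G.
Proof.
have [K [V [j [J [G D]]]]] := charfun_dilation rT.
have [J' [G' D']] := dilates_coincide co D.
by exists K, V, j, J', G'.
Qed.

Lemma invariant_subspace_factorization (H1 : csub H) :
  invariant_under T (csub_set H1) ->
  exists (F : hilbertType R[i]) (Theta1 : bop (fock I E) (fock I F))
      (Theta2 : bop (fock I F) (fock I Es)),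
    regular_factorization Theta Theta1 Theta2 /\
    exists TT : I -> bop (model_space Theta1 Theta2) (model_space Theta1 Theta2),
    [/\ is_model_row TT, row_contraction TT &
        exists U : bop H (model_space Theta1 Theta2),
        [/\ unitary_equivalence T TT U,
            [set subspace_val (U h) | h in csub_set H1] = model_H1 Theta1 Theta2 &
            [set subspace_val (U h) | h in ominus setT (csub_set H1)]
              = model_H2 Theta1 Theta2]].
Proof.
move=> TH1; have [K [V [j [J [G dil]]]]] := coincide_dilation.
pose M := lifted_subspace j H1.
have MV : invariant_under V (csub_set M) := lifted_invariant dil TH1.
pose w := Defs.incl (wandering V M).
have [|||D [iD DE DV DM]] := @wold_embedding R I K _ V M w (dil_row dil) MV.
- by move=> x y.
- by move=> k; apply: wandering_sub (subspaceP k).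
- by move=> i k m Mm; apply: wandering_ortho (subspaceP k).
have D0 k : D (etens [::] k) = subspace_val k by rewrite DE.
pose F1 := factor1 J D; pose F2 := factor2 G D.
have m1 : multi_analytic F1 := factor1_multi_analytic dil DV D0.
have m2 : multi_analytic F2 := factor2_multi_analytic dil DV.
have c1 : contractive F1 := factor1_contractive dil iD.
have c2 : contractive F2 := factor2_contractive dil iD.
have [W rW WE] := model_shift_ex c1 c2 m1 m2.
have [g ig gE] := model_graph_ex c1 c2.
have [d iso_d dE] := model_graph2_ex F1 c2.
have gW := model_gW c1 c2 m1 m2 WE gE.
have dW := model_dW c2 m2 WE dE.
have [P uP [PG PJ PD PV]] := lifted_unitary dil cT TH1 iD DV DM D0 WE ig iso_d gE dE gW dW.
exists _, F1, F2; split.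
  exact (lifted_regular dil cT cTheta TH1 iD DV DM D0 gE uP PG PJ).
have [TT TTE] := model_row_ex W.
exists TT; split.
- exact: model_row_is_model.
- exact: model_row_contraction.
have [U [uU UT] UE] := model_equivalence gE TTE dil uP PJ PV.
have H2P h : model_H2 F1 F2 (subspace_val (U h)) <-> ominus setT (csub_set H1) h.
  by rewrite UE; exact (lifted_H2 dil TH1 iD DV DM D0 gE dE uP PG PJ PD h).
have onto x : csub_set (model_space F1 F2) x -> exists h, subspace_val (U h) = x.
  move=> /mem_set Mx; have [h hE] := uU.2 (Subspace Mx).
  by exists h; rewrite hE.
have sub2 := model_H2_sub gE dE.
have H1P := model_H1P iso_d dE.
have isoU h h' : dot (subspace_val (U h)) (subspace_val (U h')) = dot h h'.
  by rewrite -dot_subspace uU.1.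
exists U; split=> //; apply/seteqP; split.
- move=> _ [h h1 <-]; apply/H1P; split; first exact: subspaceP.
  move=> y y2; have [h' hE] := onto y (sub2 y y2); rewrite -hE isoU.
  by apply: dot_flip; move: y2; rewrite -hE => /H2P[_]; exact.
- move=> x /H1P[/onto[h <-] h2]; exists h => //.
  apply: ortho2 => y yH; rewrite -isoU; apply: h2; exact/H2P.
- by move=> _ [h h2 <-]; exact/H2P.
- move=> x x2; have [h hE] := onto x (sub2 x x2); exists h => //.
  by apply/H2P; rewrite hE.
Qed.

Lemma regular_factorization_model (F : hilbertType R[i])
      (Theta1 : bop (fock I E) (fock I F))
      (Theta2 : bop (fock I F) (fock I Es)) :
    regular_factorization Theta Theta1 Theta2 ->
    exists TT : I -> bop (model_space Theta1 Theta2) (model_space Theta1 Theta2),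
    [/\ is_model_row TT,
        row_contraction TT,
        invariant_under TT (@subspace_val _ _ _ @^-1` model_H1 Theta1 Theta2),
        model_H2 Theta1 Theta2
          = ominus (csub_set (model_space Theta1 Theta2))
                   (model_H1 Theta1 Theta2) &
        (exists U : bop H (model_space Theta1 Theta2),
           unitary_equivalence T TT U) /\
        (forall U : bop H (model_space Theta1 Theta2),
           unitary_equivalence T TT U ->
           exists H1 : csub H,
             [set subspace_val (U h) | h in csub_set H1] = model_H1 Theta1 Theta2 /\
             invariant_under T (csub_set H1))].
Proof.
move=> reg; have [[m1 c1] [m2 c2] TE uX] := reg.
have [K [V [j [J [G dil]]]]] := coincide_dilation.
have [W rW WE] := model_shift_ex c1 c2 m1 m2.
have [g ig gE] := model_graph_ex c1 c2.
have [d iso_d dE] := model_graph2_ex Theta1 c2.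
have gW := model_gW c1 c2 m1 m2 WE gE.
have [P uP [PJ PV]] := regular_unitary dil cT cTheta reg WE ig gW gE.
have [TT TTE] := model_row_ex W.
have [U eqU UE] := model_equivalence gE TTE dil uP PJ PV.
exists TT; split.
- exact: model_row_is_model.
- exact: model_row_contraction.
- exact: model_H1_invariant.
- exact: model_H2_complement.
split; first by exists U.
exact: model_H1_transport.
Qed.

End ModelTheorem.

Theorem theorem3p2 (R : realType) (n : option nat) (hn : n <> Some 0%N)
    (H E Es : hilbertType R[i]) (T : gens n -> bop H H)
    (Theta : bop (fock (gens n) E) (fock (gens n) Es)) :
  row_contraction T -> cnc T ->
  multi_analytic Theta -> contractive Theta ->
  coincide Theta (charfun T) ->
  (forall H1 : csub H, invariant_under T (csub_set H1) ->
    exists (F : hilbertType R[i])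
      (Theta1 : bop (fock (gens n) E) (fock (gens n) F))
      (Theta2 : bop (fock (gens n) F) (fock (gens n) Es)),
    regular_factorization Theta Theta1 Theta2 /\
    exists TT : gens n -> bop (model_space Theta1 Theta2)
                              (model_space Theta1 Theta2),
    [/\ is_model_row TT,
        row_contraction TT &
        exists U : bop H (model_space Theta1 Theta2),
        [/\ unitary_equivalence T TT U,
            [set subspace_val (U h) | h in csub_set H1] = model_H1 Theta1 Theta2 &
            [set subspace_val (U h) | h in ominus setT (csub_set H1)]
              = model_H2 Theta1 Theta2]]) /\
  (forall (F : hilbertType R[i])
      (Theta1 : bop (fock (gens n) E) (fock (gens n) F))
      (Theta2 : bop (fock (gens n) F) (fock (gens n) Es)),
    regular_factorization Theta Theta1 Theta2 ->
    exists TT : gens n -> bop (model_space Theta1 Theta2)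
                              (model_space Theta1 Theta2),
    [/\ is_model_row TT,
        row_contraction TT,
        invariant_under TT (@subspace_val _ _ _ @^-1` model_H1 Theta1 Theta2),
        model_H2 Theta1 Theta2
          = ominus (csub_set (model_space Theta1 Theta2))
                   (model_H1 Theta1 Theta2) &
        (exists U : bop H (model_space Theta1 Theta2),
           unitary_equivalence T TT U) /\
        (forall U : bop H (model_space Theta1 Theta2),
           unitary_equivalence T TT U ->
           exists H1 : csub H,
             [set subspace_val (U h) | h in csub_set H1] = model_H1 Theta1 Theta2 /\
             invariant_under T (csub_set H1))]).
Proof.
move=> rT cT _ cTheta co; split.
  by move=> H1; exact: (invariant_subspace_factorization rT cT cTheta co).
by move=> F Theta1 Theta2; exact: (regular_factorization_model rT cT cTheta co).
Qed.
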